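(* Assume (A1): the matrices $\sigma$ and $\alpha_0=\mu(\{0\})$ are invertible. Let $\bar\phi:\mathbb{R}^n\to\mathbb{R}$ be bounded and Borel measurable and let $\phi:\mathcal{D}\to\mathbb{R}$ be given by $\phi=\bar\phi\circ\mathcal{P}$. Then for every $t\in(0,T]$ the function $R_t[\phi]:\mathcal{D}\to\mathbb{R}$ is differentiable. Moreover there exists $C>0$ such that for all $t\in(0,T]$, $x\in\mathcal{D}$ and $h\in\mathcal{D}$ $$|\nabla R_t[\phi](x)h|\le C\,\frac{|h|}{\sqrt t}\,\|\phi\|_\infty .$$
   Context: Fix $d>0$, $T>0$, $n\ge1$. Let $a_0,\sigma\in\mathrm{Mat}(n\times n)$ be real matrices, let $a_1$ be an $n\times n$-matrix-valued finite regular measure on $[-d,0]$ with $a_1(\{0\})=0$, and let $W$ be a standard Wiener process in $\mathbb{R}^n$ on a complete probability space. $D_b([-d,0),\mathbb{R}^n)$ is the set of bounded càdlàg functions on $[-d,0)$ having a finite left limit as $\theta\nearrow0$, and $\mathcal{D}=\mathbb{R}^n\times D_b([-d,0),\mathbb{R}^n)$ is the Banach space with norm $|(x_0,x_1)|=|x_0|+\|x_1\|_\infty$. For $x=(x_0,x_1)\in\mathcal{D}$ let $y$ be the solution of $$dy(t)=a_0y(t)\,dt+\int_{-d}^0a_1(d\theta)\,y(t+\theta)\,dt+\sigma\,dW_t,\quad t\in[0,T],\qquad y(0)=x_0,\quad y(\theta)=x_1(\theta),\ \theta\in[-d,0),$$ put $y_t(\theta)=y(t+\theta)$, $\theta\in[-d,0)$,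 and $Z^x(t)=(y(t),y_t)\in\mathcal{D}$ (the $\mathcal{D}$-valued Ornstein–Uhlenbeck process $Z^x(t)=e^{tA}x+\int_0^te^{(t-s)A}G\,dW_s$, where $e^{tA}x$ is the value of $(y(t),y_t)$ when $\sigma=0$ and $Gu=(\sigma u,0)$). The transition semigroup is $R_t[f](x)=\mathbb{E}[f(Z^x(t))]$ for bounded measurable $f:\mathcal{D}\to\mathbb{R}$. $\mu$ is a regular (finite) measure on $[-d,0]$ with values in $\mathrm{Mat}(n\times n)$ such that $\alpha_0:=\mu(\{0\})>0$; $\bar\mu(A)=\mu(A\setminus\{0\})$ for Borel $A\subset[-d,0]$, so that $\mu=\alpha_0\delta_0+\bar\mu$. The map $\mathcal{P}:\mathcal{D}\to\mathbb{R}^n$ is $\mathcal{P}(x_0,x_1)=\alpha_0x_0+\int_{[-d,0)}\bar\mu(d\theta)\,x_1(\theta)$. *)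

(* Defs.v *)
From HB Require Import structures.
From mathcomp Require Import all_boot all_order all_algebra.
From mathcomp Require Import all_classical all_reals all_analysis.
From mathcomp Require Import ring.
Set Implicit Arguments.
Unset Strict Implicit.
Unset Printing Implicit Defensive.
Import Order.TTheory GRing.Theory Num.Theory.
Import numFieldNormedType.Exports.
Local Open Scope classical_set_scope.
Local Open Scope ring_scope.

Section EuclideanNorm.
Context {R : realType} {n : nat}.
Implicit Types u v : 'cV[R]_n.

(* The norm that the library puts on matrices is the max norm. *)
Definition enorm u : R := Num.sqrt (\sum_i u i ord0 ^+ 2).

Lemma enorm_ge0 u : 0 <= enorm u.
Proof. exact: sqrtr_ge0. Qed.

Lemma enorm0 : enorm 0 = 0.
Proof.
by rewrite /enorm big1 ?sqrtr0// => i _; rewrite mxE expr0n.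
Qed.

Lemma sqr_enorm u : enorm u ^+ 2 = \sum_i u i ord0 ^+ 2.
Proof. by rewrite sqr_sqrtr// sumr_ge0// => i _; exact: sqr_ge0. Qed.

Lemma enorm_eq0 u : enorm u = 0 -> u = 0.
Proof.
move=> u0; apply/colP => i; rewrite mxE; apply/eqP.
have /eqP : \sum_i u i ord0 ^+ 2 = 0 by rewrite -sqr_enorm u0 expr0n.
rewrite psumr_eq0 => [|j _]; last exact: sqr_ge0.
by move=> /allP/(_ i (mem_index_enum _)); rewrite sqrf_eq0.
Qed.

Lemma enormZ (a : R) u : enorm (a *: u) = `|a| * enorm u.
Proof.
rewrite /enorm (eq_bigr (fun i => a ^+ 2 * u i ord0 ^+ 2)); last first.
  by move=> i _; rewrite mxE exprMn.
by rewrite -mulr_sumr sqrtrM ?sqr_ge0// sqrtr_sqr.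
Qed.

Lemma enorm_dot u v : \sum_i u i ord0 * v i ord0 <= enorm u * enorm v.
Proof.
have [/enorm_eq0 ->|u0] := eqVneq (enorm u) 0.
  by rewrite enorm0 mul0r big1// => i _; rewrite mxE mul0r.
have [/enorm_eq0 ->|v0] := eqVneq (enorm v) 0.
  by rewrite enorm0 mulr0 big1// => i _; rewrite mxE mulr0.
have ugt0 : 0 < enorm u by rewrite lt_neqAle eq_sym u0 enorm_ge0.
have vgt0 : 0 < enorm v by rewrite lt_neqAle eq_sym v0 enorm_ge0.
have : 0 <= \sum_i (enorm v * u i ord0 - enorm u * v i ord0) ^+ 2.
  by apply: sumr_ge0 => i _; exact: sqr_ge0.
rewrite (eq_bigr (fun i => (enorm v ^+ 2 * u i ord0 ^+ 2
    + enorm u ^+ 2 * v i ord0 ^+ 2)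
    - (enorm u * enorm v *+ 2) * (u i ord0 * v i ord0))); last first.
  by move=> i _; ring.
rewrite sumrB big_split/= -!mulr_sumr -!sqr_enorm.
set a := enorm u; set b := enorm v; set S := \sum_i _.
rewrite (_ : _ - _ = (a * b *+ 2) * (a * b - S)); last by ring.
by rewrite pmulr_rge0 ?subr_ge0// pmulrn_lgt0// mulr_gt0.
Qed.

Lemma enormD u v : enorm (u + v) <= enorm u + enorm v.
Proof.
rewrite -(@ler_pXn2r _ 2)// ?nnegrE ?addr_ge0 ?enorm_ge0//.
rewrite sqrrD !sqr_enorm.
rewrite (eq_bigr (fun i => (u i ord0 ^+ 2 + v i ord0 ^+ 2)
    + (u i ord0 * v i ord0) *+ 2)); last first.
  by move=> i _; rewrite mxE sqrrD addrAC.
rewrite big_split/= big_split/= sumrMnl [leRHS]addrAC lerD2l.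
by rewrite lerMn2r enorm_dot orbT.
Qed.

End EuclideanNorm.

(* A function on [-d, 0) is encoded by its extension by 0 to the whole line,
   so that equality of codes is equality of functions on [-d, 0). *)
Definition bounded_cadlag {R : realType} {n : nat} (d : R)
    (f : R -> 'cV[R]_n) : Prop :=
  [/\ forall s, ~ (- d <= s < 0) -> f s = 0,
      exists M : R, forall s, - d <= s < 0 -> enorm (f s) <= M,
      forall s, - d <= s < 0 -> f r @[r --> s^'+] --> f s &
      forall s, - d < s <= 0 ->
        exists l : 'cV[R]_n, f r @[r --> s^'-] --> l].

Section StateSpace.
Context (R : realType) (n : nat) (d : R).

Definition state_pred : {pred 'cV[R]_n * (R -> 'cV[R]_n)} :=
  [pred x | `[< bounded_cadlag d x.2 >]].

Lemma state_pred_submod : submod_closed state_pred.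
Proof.
split.
  apply/asboolP; split => //.
  - by exists 0 => s _; rewrite enorm0.
  - by move=> s _; exact: cvg_cst.
  - by move=> s _; exists 0; exact: cvg_cst.
move=> a x y /asboolP[x1 [Mx x2] x3 x4] /asboolP[y1 [My y2] y3 y4].
apply/asboolP; split => /=.
- by move=> s sd; rewrite /= !fctE x1// y1// scaler0 addr0.
- exists (`|a| * Mx + My) => s sd; apply: (le_trans (enormD _ _)).
  by rewrite enormZ lerD ?y2// ler_wpM2l// x2.
- by move=> s sd; apply: cvgD; [apply: cvgZr; exact: x3|exact: y3].
- move=> s sd; have [lx xl] := x4 _ sd; have [ly yl] := y4 _ sd.
  by exists (a *: lx + ly); apply: cvgD => //; exact: cvgZr.
Qed.

HB.instance Definition _ := GRing.isSubmodClosed.Build R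
  ('cV[R]_n * (R -> 'cV[R]_n))%type state_pred state_pred_submod.

Inductive state : predArgType := State x & x \in state_pred.

Definition state_val (x : state) : 'cV[R]_n * (R -> 'cV[R]_n) :=
  let: State z _ := x in z.

HB.instance Definition _ := [isSub of state for state_val].
HB.instance Definition _ := [Choice of state by <:].
HB.instance Definition _ := [SubChoice_isSubLmodule of state by <:].

Definition present (x : state) : 'cV[R]_n := (\val x).1.
Definition past (x : state) : R -> 'cV[R]_n := (\val x).2.

Definition past_norm (x : state) : R :=
  sup [set enorm (past x s) | s in `[- d, 0[].

Definition state_norm (x : state) : R := enorm (present x) + past_norm x.

Lemma pastP x : bounded_cadlag d (past x).
Proof. exact/asboolP/(valP x). Qed.

Lemma past_out x s : ~ (- d <= s < 0) -> past x s = 0.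
Proof. by case: (pastP x) => + _ _ _; apply. Qed.

Lemma past_ubound x : has_ubound [set enorm (past x s) | s in `[- d, 0[].
Proof.
have [_ [M xM] _ _] := pastP x.
by exists M => _ [s sd <-]; apply: xM; move: sd; rewrite /= in_itv.
Qed.

Lemma past_norm_ge0 x : 0 <= past_norm x.
Proof.
rewrite /past_norm; set A := [set _ | _ in _].
have [->|/set0P[r Ar]] := eqVneq A set0; first by rewrite sup0.
apply: (le_trans _ (ub_le_sup (past_ubound x) Ar)).
by case: Ar => s _ <-; exact: enorm_ge0.
Qed.

Lemma le_past_norm x s : enorm (past x s) <= past_norm x.
Proof.
have [sd|/negP sd] := boolP (- d <= s < 0).
  by apply: (ub_le_sup (past_ubound x)); exists s; rewrite //= in_itv.
by rewrite past_out// enorm0 past_norm_ge0.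
Qed.

Lemma past_norm_le x (M : R) : 0 <= M ->
  (forall s, enorm (past x s) <= M) -> past_norm x <= M.
Proof.
move=> M0 xM; rewrite /past_norm; set A := [set _ | _ in _].
have [->|/set0P A0] := eqVneq A set0; first by rewrite sup0.
by apply: ge_sup => // _ [s _ <-].
Qed.

Lemma past_normZ_le (a : R) x : past_norm (a *: x) <= `|a| * past_norm x.
Proof.
apply: past_norm_le => [|s]; first by rewrite mulr_ge0 ?past_norm_ge0.
by rewrite /past linearZ/= enormZ ler_wpM2l// le_past_norm.
Qed.

Lemma state_normD x y : state_norm (x + y) <= state_norm x + state_norm y.
Proof.
rewrite /state_norm addrACA lerD//.
  by rewrite /present raddfD; exact: enormD.
apply: past_norm_le => [|s]; first by rewrite addr_ge0 ?past_norm_ge0.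
rewrite /past raddfD; apply: (le_trans (enormD _ _)).
by rewrite lerD ?le_past_norm.
Qed.

Lemma state_normZ (a : R) x : state_norm (a *: x) = `|a| * state_norm x.
Proof.
rewrite /state_norm mulrDr; congr (_ + _).
  by rewrite /present linearZ/= enormZ.
apply/eqP; rewrite eq_le past_normZ_le/=.
have [->|a0] := eqVneq a 0; first by rewrite normr0 mul0r past_norm_ge0.
rewrite -ler_pdivlMl ?normr_gt0// -normfV.
by rewrite -[in leLHS](scalerK a0 x) past_normZ_le.
Qed.

Lemma state_norm0_eq0 x : state_norm x = 0 -> x = 0.
Proof.
move=> /eqP; rewrite paddr_eq0 ?enorm_ge0 ?past_norm_ge0//.
move=> /andP[/eqP/enorm_eq0 x0 /eqP x1]; apply/val_inj.
rewrite [LHS]surjective_pairing -/(present x) -/(past x) x0 raddf0/=.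
congr pair; apply/funext => s; apply: enorm_eq0.
by apply/eqP; rewrite eq_le enorm_ge0 -x1 le_past_norm.
Qed.

HB.instance Definition _ := Lmodule_isNormed.Build R state
  state_normD state_normZ state_norm0_eq0.

End StateSpace.
Arguments state : clear implicits.

Section DelayProcess.
Context {R : realType} {n : nat}.

(* Integral of a real function against a signed measure: the value does not
   depend on the Hahn decomposition that is picked. *)
Definition charge_integral (nu : {charge set (measurableTypeR R) -> \bar R})
    (A : set R) (f : R -> R) : R :=
  let PN := cid (Hahn_decomposition nu) in
  let QN := cid (projT2 PN) in
  \int[jordan_pos (projT2 QN)]_(s in A) f s -
  \int[jordan_neg (projT2 QN)]_(s in A) f s.

(* A matrix-valued finite measure is the matrix of its entries; finite signed
   Borel measures on the line are automatically regular. *)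
Definition mx_charge := 'I_n -> 'I_n -> {charge set (measurableTypeR R) -> \bar R}.

Definition concentrated_on (A : set R) (m : mx_charge) : Prop :=
  forall i j (B : set R), measurable B -> B `&` A = set0 -> m i j B = 0%E.

Definition mx_atom (m : mx_charge) (s : R) : 'M[R]_n :=
  \matrix_(i, j) fine (m i j [set s]).

Definition mx_integral (m : mx_charge) (A : set R) (f : R -> 'cV[R]_n) :
    'cV[R]_n :=
  \col_i \sum_j charge_integral (m i j) A (fun s => f s j ord0).

Definition drop_atom0 (m : mx_charge) : mx_charge := fun i j =>
  crestr0 (m i j) (measurableC (measurable_set1 0)).

Definition delay_map (d : R) (mu : mx_charge) (x : state R n d) : 'cV[R]_n :=
  mx_atom mu 0 *m present x + mx_integral (drop_atom0 mu) `[- d, 0[ (past x).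

Definition borel_vec_fun (g : 'cV[R]_n -> R) : Prop :=
  measurable_fun setT
    (g : g_sigma_algebraType (@open 'cV[R]_n) -> R).

Definition bounded_function (T : Type) (g : T -> R) : Prop :=
  exists M, forall z, `|g z| <= M.

Definition sup_norm (T : Type) (g : T -> R) : R := sup (range (fun z => `|g z|)).

Context {disp : measure_display} {Omega : measurableType disp}.
Variable P : probability Omega R.

(* Taking B i = setT gives the product rule for subfamilies. *)
Definition mutually_independent (I : finType) (X : I -> Omega -> R) : Prop :=
  forall B : I -> set R, (forall i, measurable (B i)) ->
    P (\bigcap_(i in setT) (X i @^-1` B i)) =
    (\prod_(i : I) P (X i @^-1` B i))%E.

(* On consecutive intervals the coordinates of all the increments are jointly
   independent, and each is centred Gaussian with variance the length of the
   interval: the increments are independent with law N(0, (t - s) I_n). *)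
Definition standard_wiener (W : R -> Omega -> 'cV[R]_n) : Prop :=
  [/\ forall (t : R) i, 0 <= t -> measurable_fun setT (fun w => W t w i ord0),
      {ae P, forall w, W 0 w = 0},
      {ae P, forall w, {within `[0, +oo[, continuous (fun t => W t w)}} &
      forall (m : nat) (s : nat -> R), 0 <= s 0%N ->
        (forall k, (k < m)%N -> s k < s k.+1) ->
        let incr (k : 'I_m * 'I_n) w :=
          W (s k.1.+1) w k.2 ord0 - W (s k.1) w k.2 ord0 in
        mutually_independent incr /\
        forall k (B : set R), measurable B ->
          P (incr k @^-1` B) = normal_prob 0 (Num.sqrt (s k.1.+1 - s k.1)) B].

(* The noise is additive, so the equation is understood pathwise; adaptedness
   of y follows from uniqueness of the solution along each path. *)
Definition delay_solution (d T : R) (a0 sigma : 'M[R]_n) (a1 : mx_charge)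
    (W : R -> Omega -> 'cV[R]_n) (x : state R n d)
    (y : R -> Omega -> 'cV[R]_n) : Prop :=
  (forall (t : R) i, 0 <= t <= T -> measurable_fun setT (fun w => y t w i ord0)) /\
  {ae P, forall w,
    [/\ forall s : R, - d <= s < 0 -> y s w = past x s,
        y 0 w = present x,
        {within `[0, T], continuous (fun t => y t w)} &
        forall t : R, 0 <= t <= T ->
          y t w = present x
            + \col_i \int[lebesgue_measure]_(s in `[0, t])
                (a0 *m y s w
                 + mx_integral a1 `[- d, 0] (fun r => y (s + r) w)) i ord0
            + sigma *m W t w]}.

(* (y(t), y_t), with y_t extended by 0 outside [-d, 0). *)
Definition segment (d t : R) (f : R -> 'cV[R]_n) : 'cV[R]_n * (R -> 'cV[R]_n) :=
  (f t, fun r => if - d <= r < 0 then f (t + r) else 0).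

(* The default value is only taken on the null set of the w whose path is not
   a solution. *)
Definition ou_process (d : R) (y : R -> Omega -> 'cV[R]_n) (t : R) (w : Omega) :
    state R n d :=
  insubd 0 (segment d t (fun s => y s w)).

Definition transition (d : R) (y : state R n d -> R -> Omega -> 'cV[R]_n)
    (t : R) (f : state R n d -> R) (x : state R n d) : R :=
  fine 'E_P[fun w => f (ou_process d (y x) t w)].

End DelayProcess.

(* Main.v *)
Require Import Defs.
From HB Require Import structures.
From mathcomp Require Import all_boot all_order all_algebra.
From mathcomp Require Import all_classical all_reals all_analysis.
From mathcomp Require Import measurable_realfun ring lra.
Set Implicit Arguments.
Unset Strict Implicit.
Unset Printing Implicit Defensive.
Import Order.TTheory GRing.Theory Num.Theory.
Import numFieldNormedType.Exports.
Local Open Scope classical_set_scope.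
Local Open Scope ring_scope.

(** The observation [delay_map mu] of the process at time [t] is
    [drift x + xi]: the drift is linear and bounded in the initial state [x],
    and the noise [xi], a linear functional of the Wiener path up to time [t],
    does not depend on [x] ([delay_map_solution]). The transition semigroup
    applied to [phibar \o delay_map mu] is therefore the function
    E[phibar (u + xi)] of a vector [u], evaluated at [u = drift x]
    ([transition_regularised]), and it remains to differentiate this function
    although [phibar] is only measurable, with a derivative of order
    [t ^ -1/2].

    The derivative comes from a shift of the Wiener path along a ramp that is
    zero until the last [q]-th part of the time interval and then rises
    linearly to [v]. The shift moves [xi] by [B v], where the matrix [B] is the
    [ramp_response], and by the Cameron-Martin formula it multiplies the law
    by exp (l(v) - k |v|^2 / 2), where [k = q / t] and [l(v)] is linear in [v],
    namely [k] times the scalar product of [v] with the increment of the path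
    over the ramp ([wiener_quasi_invariant]):
      E[g (xi + B v)] = E[g (xi) exp (l(v) - k |v|^2 / 2)].
    To first order in [v] the right side is E[g (xi)] + E[g (xi) l(v)].
    By the inequality e^x >= 1 + x the remainder of the density is at least
    - k |v|^2 / 2; as its mean is zero, its absolute value has mean at most
    k |v|^2, which is the Taylor estimate ([regularised_taylor]). A scaling
    argument then bounds the linear term by a multiple of k^(1/2) |v|
    ([regularised_diff_le]).

    Every vector [h] is of the form [B v], with [v] of the size of [h],
    once [B] is invertible with an inverse bounded uniformly in [t]. For large
    [q] the ramp is so short that the path driven by it is still close to the
    ramp itself at time [t], and the part of [mu] on [-d, 0) sees almost
    nothing of it, as the mass of [-T / q, 0) is small. So [B] is close to the
    product of the atom of [mu] at [0] with [sigma], which is invertible by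
    assumption ([ramp_response_close]); one [q] serves all [t <= T].

    The Cameron-Martin formula is proved along grids. For a step path the
    noise is a combination of finitely many independent Gaussian increments,
    which can be shifted one after another ([integral_shift_coordinates]), and
    the resulting density is the same for every grid that contains the start of
    the ramp. Refining the grid gives the formula for continuous test functions
    and then for Borel ones ([quasi_invariance_limit]). The noise therefore has
    to be continuous in the path for uniform convergence and defined for
    discontinuous step paths as well; for this reason it is built as the limit
    of observed Picard iterates ([response]). *)

(** * Integrals against a density *)

Section Density.
Local Open Scope ereal_scope.
Context d (T : measurableType d) (R : realType).
Variables (mu : {measure set T -> \bar R}) (f : T -> R).

Definition density_measure (mf : measurable_fun setT f)
    (f0 : forall x, (0 <= f x)%R) (A : set T) : \bar R :=
  \int[mu]_(x in A) (f x)%:E.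

Hypothesis (mf : measurable_fun setT f) (f0 : forall x, (0 <= f x)%R).
Local Notation nu := (density_measure mf f0).

Import HBNNSimple.

Let nu0 : nu set0 = 0. Proof. exact: integral_set0. Qed.

Let nu_ge0 A : 0 <= nu A.
Proof. by apply: integral_ge0 => x _; rewrite lee_fin. Qed.

Let nu_sigma_additive : semi_sigma_additive nu.
Proof.
apply: semi_sigma_additive_nng_induced => [|x]; last by rewrite lee_fin.
exact/measurable_EFinP.
Qed.

HB.instance Definition _ := isMeasure.Build _ _ _ nu nu0 nu_ge0
  nu_sigma_additive.

(** By simple functions and monotone convergence. *)
Lemma ge0_integral_density (F : T -> \bar R) : measurable_fun setT F ->
  (forall x, 0 <= F x) -> \int[nu]_x F x = \int[mu]_x (F x * (f x)%:E).
Proof.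
move=> mF F0; pose h := nnsfun_approx measurableT mF.
have hF x : (fun n => (h n x)%:E) @ \oo --> F x by exact: cvg_nnsfun_approx.
have ndh x : {homo (fun n => (h n x)%:E) : a b / (a <= b)%N >-> a <= b}.
  by move=> a b ab; rewrite lee_fin; exact/lefP/nd_nnsfun_approx.
have mh n : measurable_fun setT (EFin \o h n) by exact/measurable_EFinP.
have mfE : measurable_fun setT (EFin \o f) by exact/measurable_EFinP.
transitivity (limn (fun n => \int[nu]_x (h n x)%:E)).
  rewrite -monotone_convergence//; last by move=> n x _; rewrite lee_fin.
  by apply: eq_integral => x _; apply/esym/cvg_lim => //; exact: hF.
transitivity (limn (fun n => \int[mu]_x ((h n x)%:E * (f x)%:E))); last first.
  rewrite -monotone_convergence//.
  - apply: eq_integral => x _; apply/cvg_lim => //.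
    by apply: cvgeZr => //; exact: hF.
  - by move=> n; apply: emeasurable_funM => //; exact: mh.
  - by move=> n x _; rewrite mule_ge0 ?lee_fin.
  - by move=> x _ a b ab; rewrite lee_wpmul2r ?lee_fin//; exact: ndh.
congr (limn _); apply/funext => n.
pose s x (y : R) := (y * \1_(h n @^-1` [set y]) x)%:E.
have s0 x y : 0 <= s x y by exact: nnfun_muleindic_ge0.
have ms y : measurable_fun setT (s ^~ y).
  by apply/measurable_EFinP; exact: measurable_funM.
transitivity (\int[nu]_x (\sum_(y \in range (h n)) s x y)).
  by apply: eq_integral => x _; rewrite fimfunE -fsumEFin.
transitivity (\int[mu]_x (\sum_(y \in range (h n)) (s x y * (f x)%:E))); last first.
  by apply: eq_integral => x _; rewrite fimfunE -fsumEFin// ge0_mule_fsuml// => y; exact: s0.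
rewrite !ge0_integral_fsum//; last 2 first.
- by move=> y; apply: emeasurable_funM => //; exact: ms.
- by move=> y x _; apply: mule_ge0; [exact: s0|rewrite lee_fin].
apply: eq_fsbigr => y _; rewrite integralZl_indic_nnsfun// integral_indic// setIT.
under [RHS]eq_integral do rewrite /s EFinM -muleA.
have [y0|y0] := leP 0%R y; last first.
  rewrite preimage_nnfun0// measure0 mule0.
  by rewrite integral0_eq// => x _; rewrite indicE in_set0 mul0e mule0.
rewrite (ge0_integralZl _ measurableT) ?lee_fin//.
- congr (_ * _); rewrite [LHS]integral_mkcond.
  by apply: eq_integral => x _; rewrite epatch_indic muleC.
- by apply: emeasurable_funM => //; exact/measurable_EFinP.
- by move=> x _; apply: mule_ge0; rewrite lee_fin.
Qed.

End Density.

(** * Shifting independent Gaussian variables *)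

Section CoordinateSpace.
Context (R : realType) (J : finType).

Definition rectangles : set (set (J -> R)) :=
  [set A | exists2 B : J -> set R, (forall j, measurable (B j)) &
     A = [set x | forall j, B j (x j)]].

(** The index is any finite type: the increments of a Wiener path on a grid
    are indexed by a time step and a coordinate. *)
Definition coord_space := g_sigma_algebraType rectangles.

Lemma measurable_coord j : measurable_fun setT (fun x : coord_space => x j).
Proof.
move=> _ B mB; rewrite setTI; apply: sub_sigma_algebra.
exists (fun i => if i == j then B else setT).
  by move=> i; case: ifP.
apply/seteqP; split=> [x /= Bx i|x /= /(_ j)]; last by rewrite eqxx.
by case: eqP => [->|].
Qed.

Lemma setI_closed_rectangles : setI_closed rectangles.
Proof.
move=> _ _ [B mB ->] [C mC ->]; exists (fun j => B j `&` C j).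
  by move=> j; exact: measurableI.
by apply/seteqP; split=> [x /= [Bx Cx] j|x /= BCx]; [split|split=> j; case: (BCx j)].
Qed.

Context d (T : measurableType d).

Lemma bigcap_fin_measurable (A : J -> set T) :
  (forall j, measurable (A j)) -> measurable [set w | forall j, A j w].
Proof.
move=> mA; rewrite (_ : [set w | _] = \bigcap_(j in [set: J]) A j).
  by apply: fin_bigcap_measurable => //; exact: finite_finset.
by apply/seteqP; split=> [w /= Aw j _|w /= Aw j]; apply: Aw.
Qed.

Lemma measurable_to_coord_space (X : T -> coord_space) :
  (forall j, measurable_fun setT (fun w => X w j)) -> measurable_fun setT X.
Proof.
move=> mX; apply: (@measurability _ _ T (g_sigma_algebraType rectangles) setT X rectangles erefl).
move=> _ [_ [B mB ->] <-].
rewrite setTI; apply: bigcap_fin_measurable => j.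
by rewrite -[X in measurable X]setTI; exact: mX.
Qed.

End CoordinateSpace.
Arguments rectangles : clear implicits.
Arguments coord_space : clear implicits.

(** Rectangles are stable under intersection and generate the product
    sigma-algebra, so that the product rule of independence, which is about
    rectangles, determines joint laws. *)
Lemma eq_integral_rectangles (R : realType) (J : finType)
    d1 (T1 : measurableType d1) d2 (T2 : measurableType d2)
    (m1 : {measure set T1 -> \bar R}) (m2 : {measure set T2 -> \bar R})
    (X1 : T1 -> coord_space R J) (X2 : T2 -> coord_space R J)
    (F : coord_space R J -> \bar R) :
  (m1 setT < +oo)%E ->
  (forall j, measurable_fun setT (fun w => X1 w j)) ->
  (forall j, measurable_fun setT (fun w => X2 w j)) ->
  (forall B : J -> set R, (forall j, measurable (B j)) ->
    m1 [set w | forall j, B j (X1 w j)] = m2 [set w | forall j, B j (X2 w j)]) ->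
  measurable_fun setT F -> (forall x, 0 <= F x)%E ->
  (\int[m1]_w F (X1 w) = \int[m2]_w F (X2 w))%E.
Proof.
move=> m1oo /measurable_to_coord_space mX1 /measurable_to_coord_space mX2.
move=> m12 mF F0.
rewrite -[LHS](ge0_integral_pushforward mX1 m1 measurableT mF)//.
rewrite -[RHS](ge0_integral_pushforward mX2 m2 measurableT mF)//.
apply: eq_measure_integral => A mA _.
apply: (@measure_unique _ R (g_sigma_algebraType (rectangles R J)) (rectangles R J) (fun=> setT) erefl) => //.
- exact: setI_closed_rectangles.
- by move=> _; exists (fun=> setT) => //; apply/seteqP; split.
- by rewrite bigcup_const.
- by move=> _ [B mB ->]; exact: m12.
Qed.

Section GaussianShift.
Context (R : realType).
Local Notation leb := (@lebesgue_measure R).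

(** The density of N(c, s^2) with respect to N(0, s^2). *)
Definition shift_density (s c x : R) : R :=
  expR (c * x / s ^+ 2 - c ^+ 2 / (s ^+ 2 *+ 2)).

Lemma measurable_shift_density s c : measurable_fun setT (shift_density s c).
Proof.
apply: measurableT_comp => //; apply: measurable_funB => //.
by apply: measurable_funM => //; exact: measurable_funM.
Qed.

Lemma normal_pdf_shift s c x : s != 0 ->
  normal_pdf c s x = shift_density s c x * normal_pdf 0 s x.
Proof.
move=> s0; rewrite !normal_pdfE// mulrCA; congr (_ * _).
rewrite /normal_fun /shift_density -expRD; congr expR.
by field.
Qed.

Lemma lebesgue_translation (c : R) (A : set R) : measurable A ->
  leb [set x | A (x + c)] = leb A.
Proof.
have mc : measurable_fun setT (fun x : measurableTypeR R => x + c : measurableTypeR R).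
  exact: measurable_funD.
move=> mA; apply/esym; move: A mA.
apply: (lebesgue_measure_unique (mu := pushforward leb
  (fun x : measurableTypeR R => x + c : measurableTypeR R))).
move=> _ [[a b] _ <-]/=; rewrite /pushforward.
rewrite (_ : _ @^-1` _ = [set` `]a - c, b - c]]).
  by rewrite !lebesgue_measure_itv/= !lte_fin ltrD2r -!EFinB opprB addrA subrK.
by apply/seteqP; split=> x /=; rewrite !in_itv/= ltrBlDr lerBrDr.
Qed.

(** Lebesgue measure is translation invariant, so that the shift falls on the
    normal density. *)
Lemma normal_prob_shift (s c : R) (B : set R) : s != 0 -> measurable B ->
  (normal_prob 0%R s [set x : R | B (x + c)%R] =
   \int[normal_prob 0%R s]_(x in B) (shift_density s c x)%:E)%E.
Proof.
move=> s0 mB.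
have mc : measurable_fun setT (fun x : measurableTypeR R => x + c : measurableTypeR R).
  exact: measurable_funD.
have mpdf a : measurable_fun setT (fun x => (normal_pdf a s x)%:E).
  by apply/measurable_EFinP; exact: measurable_normal_pdf.
have pdf0 a x : (0 <= (normal_pdf a s x)%:E)%E by rewrite lee_fin normal_pdf_ge0.
transitivity (\int[leb]_(x in B) (normal_pdf c s x)%:E)%E.
  rewrite (eq_measure_integral (pushforward leb (fun x : measurableTypeR R => x + c : measurableTypeR R))).
    rewrite (ge0_integral_pushforward mc)//; last exact: (measurable_funTS (mpdf c)).
    apply: eq_integral => x _ /=.
    by rewrite !normal_pdfE// [in RHS]normal_fun_center/= addrK.
  by move=> A mA _; rewrite [RHS]lebesgue_translation.
have mpdf0 := measurable_normal_pdf 0 s.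
have pdf00 := normal_pdf_ge0 0 s.
have mlam := measurable_shift_density s c.
rewrite [RHS](eq_measure_integral (density_measure leb mpdf0 pdf00))//.
rewrite [LHS]integral_mkcond [RHS]integral_mkcond ge0_integral_density.
- apply: eq_integral => x _; rewrite !patchE; case: ifP => _; last by rewrite mul0e.
  by rewrite -EFinM normal_pdf_shift.
- apply/(measurable_restrict _ mB measurableT); rewrite setTI.
  exact/measurable_funTS/measurable_EFinP.
- by move=> x; rewrite patchE; case: ifP => // _; rewrite lee_fin expR_ge0.
Qed.

End GaussianShift.

Section CoordinateShift.
Context (R : realType) (J : finType) d (Omega : measurableType d).
Variables (P : probability Omega R) (X : J -> Omega -> R).
Hypothesis mX : forall j, measurable_fun setT (X j).
Hypothesis indX : mutually_independent P X.
Variables (s : J -> R).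
Hypothesis s0 : forall j, s j != 0.
Hypothesis lawX : forall j (B : set R), measurable B ->
  P (X j @^-1` B) = normal_prob 0 (s j) B.

Let mXB j B : measurable B -> measurable (X j @^-1` B).
Proof. by move=> mB; rewrite -[X in measurable X]setTI; exact: mX. Qed.

Let indXE (B : J -> set R) : (forall j, measurable (B j)) ->
  P [set w | forall j, B j (X j w)] = (\prod_(j : J) P (X j @^-1` B j))%E.
Proof.
move=> mB; rewrite -indX//; congr (P _).
by apply/seteqP; split=> [w Bw j _|w Bw j]; apply: Bw.
Qed.

Definition shift_at (j : J) (c : R) (x : J -> R) (i : J) : R :=
  x i + (if i == j then c else 0).

(** By independence, the law of one coordinate restricted to a rectangle in
    the others is a multiple of its unrestricted law. *)
Lemma rectangle_shift_at (j : J) (c : R) (B : J -> set R) :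
  (forall j, measurable (B j)) ->
  (P [set w | forall i, B i (shift_at j c (X ^~ w) i)] =
   \int[P]_(w in [set w | forall i, B i (X i w)])
      (shift_density (s j) c (X j w))%:E)%E.
Proof.
move=> mB.
pose B' C i := if i == j then C else B i.
have mB' C : measurable C -> forall i, measurable (B' C i).
  by move=> mC i; rewrite /B'; case: ifP.
pose q := (\prod_(i | i != j) P (X i @^-1` B i))%E.
have PB' C : measurable C ->
    P [set w | forall i, B' C i (X i w)] = (P (X j @^-1` C) * q)%E.
  move=> mC; rewrite indXE; last exact: mB'.
  rewrite (bigD1 j)//= /B' eqxx; congr (_ * _)%E.
  by apply: eq_bigr => i /negbTE ->.
have mc : measurable [set x : R | B j (x + c)].
  have mcf : measurable_fun setT (fun x : R => x + c) by exact: measurable_funD.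
  by rewrite -[X in measurable X]setTI; exact: mcf.
transitivity (normal_prob 0%R (s j) [set x : R | B j (x + c)%R] * q)%E.
  rewrite -lawX// -PB'//; congr (P _); apply/seteqP; split=> w /= Bw i.
    have := Bw i; rewrite /shift_at /B'; case: eqP => [->//|_].
    by rewrite addr0.
  have := Bw i; rewrite /shift_at /B'; case: eqP => [->//|_].
  by rewrite addr0.
pose A := [set w | forall i, B' setT i (X i w)].
have mA : measurable A by apply: bigcap_fin_measurable => i; apply: mXB; exact: mB'.
have -> : [set w | forall i, B i (X i w)] = A `&` X j @^-1` B j.
  apply/seteqP; split=> [w /= Bw|w /= [Aw Bw] i].
    by split=> // i; rewrite /B'; case: ifP.
  by have := Aw i; rewrite /B'; case: eqP => [->|].
have qfin : q \is a fin_num.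
  by rewrite /q; apply: prode_fin_num => i _; exact/fin_num_measure/mXB.
have q0 : (0 <= q)%E by apply: prode_ge0 => i _; exact: measure_ge0.
have qnn : 0 <= fine q by exact: fine_ge0.
have mlam := measurable_shift_density (s j) c.
have mA1 : measurable_fun setT (\1_A : Omega -> R) by exact: measurable_indic.
have A10 w : 0 <= (\1_A w : R) by rewrite indicE.
pose f w := ((fun x => (shift_density (s j) c x)%:E) \_ (B j)) (X j w).
have mXj : measurable_fun setT (X j : Omega -> measurableTypeR R) := mX j.
have mf : measurable_fun setT
    ((fun x : measurableTypeR R => (shift_density (s j) c x)%:E) \_ (B j)).
  apply/(measurable_restrict _ (mB j) measurableT); rewrite setTI.
  exact/measurable_funTS/measurable_EFinP.
have f0 x : (0 <= ((fun x => (shift_density (s j) c x)%:E) \_ (B j)) x)%E.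
  by rewrite patchE; case: ifP => // _; rewrite lee_fin expR_ge0.
transitivity (\int[density_measure P mA1 A10]_w f w)%E; last first.
  rewrite ge0_integral_density; last 2 first.
  - exact: (measurableT_comp mf mXj).
  - by move=> w; exact: f0.
  rewrite integral_mkcondl [RHS]integral_mkcond.
  apply: eq_integral => w _; rewrite /f !patchE/= indicE.
  have -> : (X j w \in B j) = (w \in X j @^-1` B j) by [].
  by case: ifP => _; case: (w \in A); rewrite ?(mule0,mule1,mul0e).
rewrite -[RHS](ge0_integral_pushforward mXj (density_measure P mA1 A10) measurableT mf)//.
transitivity (\int[mscale (NngNum qnn) (normal_prob 0%R (s j))]_x
    (((fun x => (shift_density (s j) c x)%:E) \_ (B j)) x))%E.
  rewrite ge0_integral_mscale//= fineK// muleC normal_prob_shift//.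
  by rewrite -integral_mkcond.
apply: eq_measure_integral.
move=> C mC _; transitivity (P (A `&` X j @^-1` C)); last first.
  by apply/esym; exact: (integral_indic P (mXB j mC) mA).
transitivity ((fine q)%:E * normal_prob 0%R (s j) C)%E; first by [].
rewrite fineK// muleC -lawX// -PB'//.
congr (P _); apply/seteqP; split=> [w /= Cw|w /= [Aw Cw] i].
  split; last by have := Cw j; rewrite /B' eqxx.
  by move=> i; have := Cw i; rewrite /B'; case: eqP.
by have := Aw i; rewrite /B'; case: eqP => [->|].
Qed.

(** By [rectangle_shift_at] the two sides agree on rectangles, that is on
    indicators of a generating family. *)
Lemma integral_shift_at (j : J) (c : R) (F : coord_space R J -> \bar R) :
  measurable_fun setT F -> (forall x, 0 <= F x)%E ->
  (\int[P]_w F (shift_at j c (X ^~ w)) =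
   \int[P]_w (F (X ^~ w) * (shift_density (s j) c (X j w))%:E))%E.
Proof.
move=> mF F0.
have mlam : measurable_fun setT (fun w => shift_density (s j) c (X j w)).
  by apply: measurableT_comp (mX j); exact: measurable_shift_density.
have lam0 w : 0 <= shift_density (s j) c (X j w) by exact: expR_ge0.
have mXc : measurable_fun setT (fun w => (X ^~ w : coord_space R J)).
  exact: measurable_to_coord_space.
transitivity (\int[density_measure P mlam lam0]_w F (X ^~ w))%E.
  apply: eq_integral_rectangles => //.
  - by rewrite (le_lt_trans (probability_le1 _ _)) ?ltry.
  - by move=> i; apply: measurable_funD => //; case: ifP.
  - by move=> B mB; exact: rectangle_shift_at.
rewrite ge0_integral_density//.
exact: (measurableT_comp mF mXc).
Qed.

Definition shift_along (l : seq J) (c : J -> R) (x : J -> R) (i : J) : R :=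
  x i + (if i \in l then c i else 0).

(** Shifting one coordinate does not move the densities of the coordinates
    treated before it; a repeated entry of [l] would be shifted once but
    charged twice, hence [uniq l]. *)
Lemma integral_shift_along (l : seq J) (c : J -> R) (F : coord_space R J -> \bar R) :
  uniq l -> measurable_fun setT F -> (forall x, 0 <= F x)%E ->
  (\int[P]_w F (shift_along l c (X ^~ w)) =
   \int[P]_w (F (X ^~ w) * (\prod_(j <- l) shift_density (s j) (c j) (X j w))%:E))%E.
Proof.
elim: l F => [|j l IH] F ul mF F0.
  apply: eq_integral => w _; rewrite big_nil mule1; congr F.
  by apply/funext => i; rewrite /shift_along in_nil addr0.
have /andP[jl {}ul] := ul.
have mshift : measurable_fun setT (shift_at j (c j) : coord_space R J -> coord_space R J).
  apply: measurable_to_coord_space => i.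
  by apply: measurable_funD; [exact: measurable_coord|case: ifP].
pose F1 x := F (shift_at j (c j) x).
have mF1 : measurable_fun setT (F1 : coord_space R J -> \bar R).
  exact: (measurableT_comp mF mshift).
pose lam (x : coord_space R J) := \prod_(i <- l) shift_density (s i) (c i) (x i).
have mlam : measurable_fun setT lam.
  apply: measurable_prod => i _.
  apply: measurableT_comp; last exact: measurable_coord.
  exact: measurable_shift_density.
have lam0 x : 0 <= lam x by apply: prodr_ge0 => i _; exact: expR_ge0.
transitivity (\int[P]_w F1 (shift_along l c (X ^~ w)))%E.
  apply: eq_integral => w _; congr F; apply/funext => i.
  rewrite /shift_at /shift_along in_cons -addrA; congr (_ + _).
  by have [->|ij] := eqVneq i j; rewrite ?(negbTE jl) ?add0r//= addr0.
rewrite IH//; last by move=> x; exact: F0.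
pose F2 x := (F x * (lam x)%:E)%E.
transitivity (\int[P]_w F2 (shift_at j (c j) (X ^~ w)))%E.
  apply: eq_integral => w _; congr (_ * _%:E)%E.
  apply: eq_big_seq => i il; rewrite /shift_at; case: eqP => [ij|_].
    by rewrite -ij il in jl.
  by rewrite addr0.
rewrite integral_shift_at.
- by apply: eq_integral => w _; rewrite /F2 -muleA -EFinM big_cons mulrC.
- by apply: emeasurable_funM => //; exact/measurable_EFinP.
- by move=> x; apply: mule_ge0 => //; rewrite lee_fin.
Qed.

(** Finite-dimensional Cameron-Martin formula for independent centred
    Gaussian variables, obtained by shifting one coordinate after another. *)
Lemma integral_shift_coordinates (c : J -> R) (F : coord_space R J -> \bar R) :
  measurable_fun setT F -> (forall x, 0 <= F x)%E ->
  (\int[P]_w F (fun j => (X j w + c j)%R) =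
   \int[P]_w (F (X ^~ w) * (\prod_j shift_density (s j) (c j) (X j w))%:E))%E.
Proof.
move=> mF F0; rewrite -integral_shift_along ?index_enum_uniq//.
apply: eq_integral => w _; congr F; apply/funext => i.
by rewrite /shift_along mem_index_enum.
Qed.

End CoordinateShift.

(** * Max norm and Borel sets of column vectors *)

Section MaxNorm.
Context {R : realType} {n : nat}.
Implicit Types u v : 'cV[R]_n.

Lemma le_coord_norm u i : `|u i ord0| <= `|u|.
Proof. by rewrite [leRHS]mx_normrE; exact: (le_bigmax _ (fun i => `|u i.1 i.2|) (i, ord0)). Qed.

Lemma norm_le_coord u (e : R) : 0 <= e ->
  (forall i, `|u i ord0| <= e) -> `|u| <= e.
Proof.
move=> e0 ue; rewrite [leLHS]mx_normrE; apply: bigmax_le => // -[i j] _ /=.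
by rewrite ord1.
Qed.

Lemma norm_lt_coord u (e : R) : 0 < e ->
  (forall i, `|u i ord0| < e) -> `|u| < e.
Proof.
move=> e0 ue; rewrite [ltLHS]mx_normrE; apply: bigmax_lt => // -[i j] _ /=.
by rewrite ord1.
Qed.

Lemma norm_mulmx_le (A : 'M[R]_n) u :
  `|A *m u| <= (\sum_i \sum_j `|A i j|) * `|u|.
Proof.
apply: norm_le_coord => [|i].
  by rewrite mulr_ge0// sumr_ge0// => i _; exact: sumr_ge0.
rewrite mxE (le_trans (ler_norm_sum _ _ _))//.
apply: (@le_trans _ _ (\sum_j `|A i j| * `|u|)).
  by apply: ler_sum => j _; rewrite normrM ler_wpM2l// le_coord_norm.
rewrite -mulr_suml ler_wpM2r// [leRHS](bigD1 i)//= lerDl.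
by apply: sumr_ge0 => k _; exact: sumr_ge0.
Qed.

Lemma cvg_coord (T : Type) (F : set_system T) {FF : Filter F}
    (f : T -> 'cV[R]_n) (l : 'cV[R]_n) :
  (forall i, f x i ord0 @[x --> F] --> l i ord0) -> f @ F --> l.
Proof.
move=> fl; apply/cvgrPdist_lt => e e0.
have : \forall x \near F, forall i, `|l i ord0 - f x i ord0| < e.
  by apply: filter_forall => i; move/cvgrPdist_lt : (fl i); apply.
apply: filterS => x fxe; apply: norm_lt_coord => // i.
by rewrite !mxE; exact: fxe.
Qed.

End MaxNorm.

Section BorelVectors.
Context {R : realType} {n : nat}.
Local Notation V := 'cV[R]_n.
Local Notation borelV := (g_sigma_algebraType (@open V)).

(** Boxes with rational centres and radii form a countable base, which turns
    measurability of the coordinates into Borel measurability. *)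
Lemma open_box_cover (U : set V) (u : V) : open U -> U u ->
  exists (q : 'cV[rat]_n) (k : nat),
    [/\ forall i, `|u i ord0 - ratr (q i ord0)| < k.+1%:R^-1 &
        forall v : V, (forall i, `|v i ord0 - ratr (q i ord0)| < k.+1%:R^-1) -> U v].
Proof.
move=> oU Uu; have /nbhs_ballP[e /= e0 eU] := open_nbhs_nbhs (conj oU Uu).
have [k ke] : exists k, 2 / k.+1%:R < e.
  have := @near_infty_natSinv_lt R (PosNum (divr_gt0 e0 (ltr0n R 2))).
  move=> [k _ /(_ k (leqnn k))]/= ke; exists k.
  by rewrite -ltr_pdivlMl// mulrC.
have /choice[q uq] : forall i, exists q : rat, `|u i ord0 - ratr q| < k.+1%:R^-1.
  move=> i; have : u i ord0 - k.+1%:R^-1 < u i ord0 + k.+1%:R^-1.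
    by rewrite ltrBlDr -addrA ltrDl addr_gt0// invr_gt0.
  move=> /rat_in_itvoo[q]; rewrite in_itv/= => /andP[a b].
  by exists q; rewrite distrC ltr_distl a b.
exists (\col_i q i), k; split=> [i|v vq]; first by rewrite mxE.
apply: eU; rewrite -ball_normE/=; apply: norm_lt_coord => // i.
rewrite !mxE -[X in `|X|](subrKA (ratr (q i))) (le_lt_trans (ler_normD _ _))//.
apply: lt_trans ke; rewrite mulr2n mulrDl mul1r ltrD//.
by have := vq i; rewrite mxE distrC.
Qed.

Lemma measurable_vec d (T : measurableType d) (X : T -> V) :
  (forall i, measurable_fun setT (fun w => X w i ord0)) ->
  measurable_fun setT (X : T -> borelV).
Proof.
move=> mX; apply: (@measurability _ _ T borelV setT X (@open V) erefl).
move=> _ [U oU <-]; rewrite setTI.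
pose box (z : 'cV[rat]_n * nat) : set V :=
  [set v : V | forall i, `|v i ord0 - ratr (z.1 i ord0)| < z.2.+1%:R^-1].
have mbox z : measurable (X @^-1` box z).
  apply: (@bigcap_fin_measurable 'I_n _ _
    (fun i => [set w | `|X w i ord0 - ratr (z.1 i ord0)| < z.2.+1%:R^-1])) => i.
  have mf : measurable_fun setT (fun w => `|X w i ord0 - ratr (z.1 i ord0)|).
    by apply: measurableT_comp => //; exact: measurable_funB.
  rewrite (_ : [set w | _] = (fun w => `|X w i ord0 - ratr (z.1 i ord0)|) @^-1` `]-oo, z.2.+1%:R^-1[).
    by rewrite -[X in measurable X]setTI; exact: mf.
  by apply/seteqP; split=> w /=; rewrite in_itv.
rewrite (_ : X @^-1` U = \bigcup_k (if unpickle k is Some z then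
    if `[< box z `<=` U >] then X @^-1` box z else set0 else set0)).
  by apply: bigcupT_measurable => k; case: unpickle => // z; case: ifP.
apply/seteqP; split=> [w /= Uw|w [k _]].
  have [q [k [wq qU]]] := open_box_cover oU Uw.
  exists (pickle (q, k)) => //; rewrite pickleK.
  by case: asboolP => // -[].
by case: unpickle => // z; case: asboolP => // zU /zU.
Qed.

Lemma continuous_measurable_vec (g : V -> R) : continuous g ->
  measurable_fun setT (g : borelV -> R).
Proof.
move=> cg; apply: (measurability _ (RGenOpens.measurableE R)).
move=> _ [_ [a [b ->]] <-]; rewrite setTI; apply: sub_sigma_algebra.
by apply: open_comp => // x _; exact: cg.
Qed.

(** The distance to the complement of [U], truncated at [1] so that it makes
    sense when [U] is the whole space. *)
Definition gauge (U : set V) (u : V) : R :=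
  inf ([set `|u - z| | z in ~` U] `|` [set 1]).

Let gauge_lb (U : set V) (u : V) :
  lbound ([set `|u - z| | z in ~` U] `|` [set 1] : set R) 0.
Proof. by move=> _ [[z _ <-]|->]. Qed.

Let gauge_has_inf (U : set V) (u : V) :
  has_inf ([set `|u - z| | z in ~` U] `|` [set 1]).
Proof. by split; [exists 1; right|exists 0; exact: gauge_lb]. Qed.

Lemma gauge_ge0 U u : 0 <= gauge U u.
Proof. by apply: lb_le_inf; [case: (gauge_has_inf U u)|exact: gauge_lb]. Qed.

Lemma gauge_out U u : ~ U u -> gauge U u = 0.
Proof.
move=> Uu; apply/eqP; rewrite eq_le gauge_ge0 andbT.
apply: ge_inf; first by case: (gauge_has_inf U u).
by left; exists u; rewrite // subrr normr0.
Qed.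

Lemma gauge_gt0 U u : open U -> U u -> 0 < gauge U u.
Proof.
move=> oU Uu; have /nbhs_ballP[e /= e0 eU] := open_nbhs_nbhs (conj oU Uu).
apply: (@lt_le_trans _ _ (Num.min e 1)); first by rewrite lt_min e0 ltr01.
apply: lb_le_inf; first by case: (gauge_has_inf U u).
move=> _ [[z Uz <-]|->]; last by rewrite ge_min lexx orbT.
rewrite ge_min leNgt; apply/orP; left; apply/negP => uz.
by apply: Uz; apply: eU; rewrite -ball_normE.
Qed.

Lemma gauge_lip U u v : gauge U u <= gauge U v + `|u - v|.
Proof.
rewrite -lerBlDr; apply: lb_le_inf; first by case: (gauge_has_inf U v).
have inf_le x : ([set `|u - z| | z in ~` U] `|` [set 1]) x -> gauge U u <= x.
  by move=> h; apply: ge_inf => //; case: (gauge_has_inf U u).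
move=> _ [[z Uz <-]|->]; rewrite lerBlDr.
  apply: (@le_trans _ _ `|u - z|); first by apply: inf_le; left; exists z.
  by rewrite [leRHS]addrC -[X in `|X| <= _](subrKA v) ler_normD.
by rewrite (@le_trans _ _ 1) ?lerDl//; apply: inf_le; right.
Qed.

Lemma continuous_gauge U : continuous (gauge U).
Proof.
move=> u; apply/(@cvgrPdist_lt _ _ _ (nbhs u)) => e e0; near=> v.
have uv : `|u - v| < e.
  by near: v; apply/nbhs_ballP; exists e => // v; rewrite -ball_normE.
rewrite ltr_norml; apply/andP; split.
  by rewrite ltrNl opprB ltrBlDr addrC (le_lt_trans (gauge_lip U v u))// ltrD2l distrC.
by rewrite ltrBlDr addrC (le_lt_trans (gauge_lip U u v))// ltrD2l.
Unshelve. all: by end_near. Qed.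

(** Continuous functions that tend to the indicator of [U] when [U] is open. *)
Definition open_approx (U : set V) (k : nat) (u : V) : R :=
  Num.min 1 (k%:R * gauge U u).

Lemma open_approx_ge0 U k u : 0 <= open_approx U k u.
Proof. by rewrite le_min ler01 mulr_ge0 ?gauge_ge0. Qed.

Lemma open_approx_le1 U k u : open_approx U k u <= 1.
Proof. by rewrite ge_min lexx. Qed.

Lemma continuous_open_approx U k : continuous (open_approx U k).
Proof.
move=> u; apply: (@continuous_min R V (cst 1) (fun u => k%:R * gauge U u)).
  exact: (@cvg_cst _ _ _ (nbhs u)).
by apply: (@cvgM _ _ (nbhs u)); [exact: cvg_cst|exact: continuous_gauge].
Qed.

Lemma cvg_open_approx U u : open U ->
  open_approx U k u @[k --> \oo] --> (\1_U u : R).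
Proof.
move=> oU; have [Uu|Uu] := pselect (U u); last first.
  rewrite indicE memNset//= (_ : (fun _ => _) = cst 0); first exact: cvg_cst.
  by apply/funext => k; rewrite /open_approx gauge_out// mulr0 min_r.
rewrite indicE mem_set//=; have U0 := gauge_gt0 oU Uu.
apply: cvg_near_cst; near=> k; rewrite /open_approx min_l//.
rewrite -ler_pdivrMr// mul1r; near: k; exact: nbhs_infty_ger.
Unshelve. all: by end_near. Qed.

End BorelVectors.

(** * Quasi-invariance in the limit *)

Section QuasiInvarianceLimit.
Context (R : realType) (n : nat) d (Omega : measurableType d).
Local Notation V := 'cV[R]_n.
Local Notation borelV := (g_sigma_algebraType (@open V)).
Variable P : probability Omega R.

Lemma integral_unit_cvg (g_ : nat -> Omega -> R) (g D : Omega -> R) :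
  measurable_fun setT D -> (forall w, 0 <= D w) ->
  P.-integrable setT (EFin \o D) ->
  (forall k, measurable_fun setT (g_ k)) -> measurable_fun setT g ->
  (forall k w, 0 <= g_ k w <= 1) ->
  {ae P, forall w, g_ k w @[k --> \oo] --> g w} ->
  (\int[P]_w (g_ k w * D w)%:E @[k --> \oo] --> \int[P]_w (g w * D w)%:E)%E.
Proof.
move=> mD D0 iD mg_ mg g01 gg.
have [] := @dominated_convergence _ _ _ P setT measurableT
  (fun k w => (g_ k w * D w)%:E) (fun w => (g w * D w)%:E) (EFin \o D) => //.
- by move=> k; apply/measurable_EFinP; exact: measurable_funM.
- by apply/measurable_EFinP; exact: measurable_funM.
- apply: filterS gg => w gw _; apply: cvg_EFin; first exact: nearW.
  by apply: cvgM => //; exact: cvg_cst.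
- apply: aeW => w k _; rewrite lee_fin normrM (ger0_norm (D0 w)).
  have /andP[a b] := g01 k w.
  by rewrite ger0_norm// ler_piMl.
Qed.

Lemma bounded_integral_cvg (g_ : nat -> Omega -> R) (g : Omega -> R) :
  (forall k, measurable_fun setT (g_ k)) -> measurable_fun setT g ->
  (forall k w, 0 <= g_ k w <= 1) ->
  {ae P, forall w, g_ k w @[k --> \oo] --> g w} ->
  (\int[P]_w (g_ k w)%:E @[k --> \oo] --> \int[P]_w (g w)%:E)%E.
Proof.
move=> mg_ mg g01 gg.
have e f : (\int[P]_w (f w)%:E = \int[P]_w (f w * 1)%:E)%E.
  by apply: eq_integral => w _; rewrite mulr1.
rewrite (eq_cvg _ _ (fun k => e (g_ k))) e.
apply: integral_unit_cvg => //.
exact: finite_measure_integrable_cst.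
Qed.

(** Dominated convergence reaches the limit for continuous test functions
    only, since [G (xi_ k w)] need not converge for a Borel [G]. The measures
    on both sides then agree on open sets, by [open_approx], hence on all the
    Borel sets. *)
Lemma quasi_invariance_limit (xi_ : nat -> Omega -> V) (xi : Omega -> V)
    (b_ : nat -> V) (b : V) (Lam : Omega -> R) (G : borelV -> \bar R) :
  (forall k i, measurable_fun setT (fun w => xi_ k w i ord0)) ->
  (forall i, measurable_fun setT (fun w => xi w i ord0)) ->
  {ae P, forall w, xi_ k w @[k --> \oo] --> xi w} ->
  b_ @ \oo --> b ->
  measurable_fun setT Lam -> (forall w, 0 <= Lam w) ->
  P.-integrable setT (EFin \o Lam) ->
  (forall k (g : V -> R), continuous g -> (forall u, 0 <= g u <= 1) ->
    (\int[P]_w (g (xi_ k w + b_ k))%:E =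
     \int[P]_w (g (xi_ k w) * Lam w)%:E)%E) ->
  measurable_fun setT G -> (forall u, 0 <= G u)%E ->
  (\int[P]_w G (xi w + b)%R = \int[P]_w (G (xi w) * (Lam w)%:E))%E.
Proof.
move=> mxi_ mxi xic bc mLam Lam0 iLam H mG G0.
have mxib_ k i : measurable_fun setT (fun w => (xi_ k w + b_ k) i ord0).
  under eq_fun do rewrite mxE; exact: measurable_funD.
have mxib i : measurable_fun setT (fun w => (xi w + b) i ord0).
  under eq_fun do rewrite mxE; exact: measurable_funD.
have mcomp (X : Omega -> V) (g : V -> R) :
    (forall i, measurable_fun setT (fun w => X w i ord0)) -> continuous g ->
    measurable_fun setT (g \o X).
  move=> mX cg; have mg := continuous_measurable_vec cg.
  by apply: (measurableT_comp mg); exact: measurable_vec.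
have cont (g : V -> R) : continuous g -> (forall u, 0 <= g u <= 1) ->
    (\int[P]_w (g (xi w + b))%:E = \int[P]_w (g (xi w) * Lam w)%:E)%E.
  move=> cg g01.
  have l1 : (\int[P]_w (g (xi_ k w + b_ k))%:E @[k --> \oo] -->
             \int[P]_w (g (xi w + b))%:E)%E.
    apply: bounded_integral_cvg => //.
    - by move=> k; exact: mcomp.
    - exact: mcomp.
    - apply: filterS xic => w xiw; apply: (@continuous_cvg _ _ _ _ _ _ g).
        exact: cg.
      exact: cvgD.
  have l2 : (\int[P]_w (g (xi_ k w) * Lam w)%:E @[k --> \oo] -->
             \int[P]_w (g (xi w) * Lam w)%:E)%E.
    apply: integral_unit_cvg => //.
    - by move=> k; exact: mcomp.
    - exact: mcomp.
    - apply: filterS xic => w xiw; apply: (@continuous_cvg _ _ _ _ _ _ g) => //.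
      exact: cg.
  move: l1; rewrite (eq_cvg _ _ (fun k => H k g cg g01)) => l1.
  exact: (cvg_unique _ l1 l2).
pose X1 w : borelV := xi w + b; pose X2 w : borelV := xi w.
have mX1 : measurable_fun setT X1 by exact: measurable_vec.
have mX2 : measurable_fun setT X2 by exact: measurable_vec.
rewrite -(ge0_integral_density P mLam Lam0 (F := fun w => G (X2 w))); last 2 first.
- exact: (measurableT_comp mG mX2).
- by move=> w; exact: G0.
rewrite -[LHS](ge0_integral_pushforward mX1 P measurableT mG)//.
rewrite -[RHS](ge0_integral_pushforward mX2 (density_measure P mLam Lam0) measurableT mG)//.
apply: eq_measure_integral => A mA _.
apply: (@measure_unique _ R borelV (@open V) (fun=> setT) erefl) => //.
- by move=> U U' oU oU'; exact: openI.
- by move=> _; exact: openT.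
- by rewrite bigcup_const.
- move=> U oU; have mU : (@open V).-sigma.-measurable U by exact: sub_sigma_algebra.
  have mU1 : measurable (X1 @^-1` U) by rewrite -[X in measurable X]setTI; exact: mX1.
  have mU2 : measurable (X2 @^-1` U) by rewrite -[X in measurable X]setTI; exact: mX2.
  have mI1 : measurable_fun setT (fun w => \1_U (X1 w) : R).
    by have := measurable_indic mU1; apply.
  have mI2 : measurable_fun setT (fun w => \1_U (X2 w) : R).
    by have := measurable_indic mU2; apply.
  have a01 k u : 0 <= open_approx U k u <= 1.
    by rewrite open_approx_ge0 open_approx_le1.
  have l1 : (\int[P]_w (open_approx U k (X1 w))%:E @[k --> \oo] -->
             \int[P]_w (\1_U (X1 w))%:E)%E.
    apply: bounded_integral_cvg => //.
    - by move=> k; apply: mcomp => //; exact: continuous_open_approx.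
    - by apply: aeW => w; exact: cvg_open_approx.
  have l2 : (\int[P]_w (open_approx U k (X2 w) * Lam w)%:E @[k --> \oo] -->
             \int[P]_w (\1_U (X2 w) * Lam w)%:E)%E.
    apply: integral_unit_cvg => //.
    - by move=> k; apply: mcomp => //; exact: continuous_open_approx.
    - by apply: aeW => w; exact: cvg_open_approx.
  transitivity (\int[P]_w (\1_U (X1 w))%:E)%E.
    by apply/esym; have := integral_indic P measurableT mU1; rewrite setIT.
  transitivity (\int[P]_w (\1_U (X2 w) * Lam w)%:E)%E; last first.
    rewrite [RHS]integral_mkcond; apply: eq_integral => w _.
    rewrite patchE indicE.
    have -> : (X2 w \in U) = (w \in X2 @^-1` U) by [].
    by case: ifP; rewrite ?mul1r ?mul0r.
  move: l1; rewrite (eq_cvg _ _ (fun k => cont _ (@continuous_open_approx _ _ U k) (a01 k))).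
  by move=> l1; exact: (cvg_unique _ l1 l2).
- by move=> _; apply: (le_lt_trans (probability_le1 P measurableT)); rewrite ltry.
Qed.

End QuasiInvarianceLimit.

(** * Smoothing along quasi-invariant directions *)

Section Smoothing.
Context (R : realType) (n : nat) d (Omega : measurableType d).
Local Notation V := 'cV[R]_n.
Local Notation borelV := (g_sigma_algebraType (@open V)).
Variables (P : probability Omega R) (xi : Omega -> V) (score : 'I_n -> Omega -> R).
Variables (kappa : R) (B : 'M[R]_n).
Hypothesis mxi : forall i, measurable_fun setT (fun w => xi w i ord0).
Hypothesis mscore : forall i, measurable_fun setT (score i).
Hypothesis kappa0 : 0 <= kappa.

(** [score_form] is the exponent of a Gaussian density at first order in the
    shift, and [score_var] is half its variance when the scores are
    independent, centred and of variance [kappa]. *)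
Definition score_form (v : V) (w : Omega) : R := \sum_i v i ord0 * score i w.
Definition score_var (v : V) : R := kappa / 2 * \sum_i v i ord0 ^+ 2.
Definition tilt (v : V) (w : Omega) : R := expR (score_form v w - score_var v).

Hypothesis quasi_invariant : forall (v : V) (G : borelV -> \bar R),
  measurable_fun setT G -> (forall u, 0 <= G u)%E ->
  (\int[P]_w G (xi w + B *m v)%R = \int[P]_w (G (xi w) * (tilt v w)%:E))%E.

Lemma measurable_score_form v : measurable_fun setT (score_form v).
Proof. by apply: measurable_sum => i; exact: measurable_funM. Qed.

Lemma measurable_tilt v : measurable_fun setT (tilt v).
Proof.
apply: measurableT_comp => //; apply: measurable_funB => //.
exact: measurable_score_form.
Qed.

(* Local copies, within reach of the closing tactics below. *)
Let mform := measurable_score_form.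
Let mtilt := measurable_tilt.

Lemma score_formZ a v w : score_form (a *: v) w = a * score_form v w.
Proof. by rewrite /score_form mulr_sumr; apply: eq_bigr => i _; rewrite mxE mulrA. Qed.

Lemma score_formD u v w : score_form (u + v) w = score_form u w + score_form v w.
Proof. by rewrite -big_split; apply: eq_bigr => i _; rewrite mxE mulrDl. Qed.

Lemma score_varZ a v : score_var (a *: v) = a ^+ 2 * score_var v.
Proof.
rewrite /score_var mulrCA; congr (_ * _); rewrite mulr_sumr.
by apply: eq_bigr => i _; rewrite mxE exprMn.
Qed.

Lemma score_var_ge0 v : 0 <= score_var v.
Proof. by rewrite mulr_ge0 ?divr_ge0// sumr_ge0// => i _; exact: sqr_ge0. Qed.

(** Together with the mean of [tilt v], which is one, this convexity bound
    gives every estimate below. *)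
Let tilt_ge v w : 1 + score_form v w - score_var v <= tilt v w.
Proof. by rewrite -addrA; exact: expR_ge1Dx. Qed.

Let integral_tilt v : (\int[P]_w (tilt v w)%:E = 1)%E.
Proof.
have := @quasi_invariant v (cst 1%E) (measurable_cst _) (fun=> lee01).
under [in RHS]eq_integral do rewrite mul1e.
by move=> <-; rewrite integral_cst//= mul1e probability_setT.
Qed.

Let integrable_le (f D : Omega -> R) : measurable_fun setT f ->
  P.-integrable setT (EFin \o D) -> (forall w, `|f w| <= D w) ->
  P.-integrable setT (EFin \o f).
Proof.
move=> mf iD fD; apply: le_integrable iD => //; first exact/measurable_EFinP.
by move=> w _; rewrite /= lee_fin (le_trans (fD w))// ler_norm.
Qed.

Let integrable_cst (c : R) : P.-integrable setT (EFin \o (fun=> c)).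
Proof. exact: finite_measure_integrable_cst. Qed.

Let integrable_add (f g : Omega -> R) : P.-integrable setT (EFin \o f) ->
  P.-integrable setT (EFin \o g) -> P.-integrable setT (EFin \o (fun w => f w + g w)).
Proof.
move=> i j; rewrite (_ : EFin \o _ = (EFin \o f) \+ (EFin \o g))%E//.
exact: integrableD.
Qed.

Let integrable_scale (a : R) (f : Omega -> R) : P.-integrable setT (EFin \o f) ->
  P.-integrable setT (EFin \o (fun w => a * f w)).
Proof.
by move=> i; rewrite (_ : EFin \o _ = (fun w => a%:E * (EFin \o f) w))%E//; exact: integrableZl.
Qed.

Let integrable_tilt v : P.-integrable setT (EFin \o tilt v).
Proof.
apply/integrableP; split; first exact/measurable_EFinP.
under eq_integral do rewrite /= ger0_norm ?expR_ge0//.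
by rewrite integral_tilt ltry.
Qed.

(** [score_form v] is dominated by the densities of the two opposite shifts,
    which have mean one. *)
Let integrable_score_form v : P.-integrable setT (EFin \o score_form v).
Proof.
apply: (@integrable_le _ (fun w => (tilt v w + tilt ((-1) *: v) w) + score_var v)) => //.
  by do 2 apply: integrable_add => //.
move=> w; have a := tilt_ge v w; have b := tilt_ge ((-1) *: v) w.
rewrite score_formZ score_varZ in b.
have c : 0 <= tilt v w by exact: expR_ge0.
have e : 0 <= tilt ((-1) *: v) w by exact: expR_ge0.
rewrite ler_norml; apply/andP; split; nra.
Qed.

Let Rintegral_cst1 (c : R) : \int[P]_w c = c.
Proof.
rewrite Rintegral_cst//; have -> : fine (P setT) = 1; last by rewrite mulr1.
by rewrite probability_setT.
Qed.

Let Rintegral_tilt v : \int[P]_w tilt v w = 1.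
Proof. by rewrite /Rintegral integral_tilt. Qed.

(** The integral of [tilt_ge] bounds the mean of [score_form v] by
    [score_var v]; the mean is homogeneous of degree one in [v] and the bound
    of degree two, so the mean vanishes. *)
Let Rintegral_score_form v : \int[P]_w score_form v w = 0.
Proof.
have le v' : \int[P]_w score_form v' w <= score_var v'.
  have : \int[P]_w (1 + score_form v' w - score_var v') <= \int[P]_w tilt v' w.
    apply: le_Rintegral => //.
    by apply: integrable_add => //; exact: integrable_add.
  rewrite Rintegral_tilt RintegralD//; last exact: integrable_add.
  by rewrite RintegralD// !Rintegral_cst1; lra.
have scale a : a * \int[P]_w score_form v w <= a ^+ 2 * score_var v.
  have := le (a *: v); rewrite score_varZ; apply: le_trans.
  rewrite -RintegralZl// le_eqVlt; apply/orP; left; apply/eqP/eq_Rintegral => w _.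
  by rewrite score_formZ.
set m := (X in X = 0); have q0 := score_var_ge0 v.
(* [m / (score_var v + 1)] makes the quadratic term smaller than the linear
   one, also when [score_var v] is zero. *)
have := scale (m / (score_var v + 1)); set q := score_var v in q0 *.
have q1 : 0 < q + 1 by lra.
rewrite -/m -subr_ge0 => h; apply/eqP; rewrite -sqrf_eq0 eq_le sqr_ge0 andbT.
have : 0 <= - (m ^+ 2) / (q + 1) ^+ 2.
  apply: le_trans h _; rewrite le_eqVlt; apply/orP; left; apply/eqP.
  field; lra.
by rewrite ler_pdivlMr ?exprn_gt0// mul0r oppr_ge0.
Qed.

Section Regularised.
Variables (g : borelV -> R) (M : R).
Hypothesis mg : measurable_fun setT g.
Hypothesis gM : forall u, `|g u| <= M.

Definition regularised (u : V) : R := \int[P]_w g (u + xi w).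
(** The derivative of [regularised] at [u] in the direction [B *m v]: it puts
    the derivative on the weight and not on [g], which is only measurable. *)
Definition regularised_diff (u v : V) : R :=
  \int[P]_w (g (u + xi w) * score_form v w).

Let M0 : 0 <= M. Proof. exact: le_trans (gM 0). Qed.

Let mgu u : measurable_fun setT (fun w => g (u + xi w)).
Proof.
have mX : measurable_fun setT ((fun w => u + xi w) : Omega -> borelV).
  by apply: measurable_vec => i; under eq_fun do rewrite mxE; exact: measurable_funD.
exact: (measurableT_comp mg mX).
Qed.

Let igu u : P.-integrable setT (EFin \o (fun w => g (u + xi w))).
Proof. by apply: (@integrable_le _ (cst M)) => //; exact: integrable_cst. Qed.

Let igM u (f : Omega -> R) : measurable_fun setT f -> P.-integrable setT (EFin \o f) ->
  P.-integrable setT (EFin \o (fun w => g (u + xi w) * f w)).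
Proof.
move=> mf jf; apply: (@integrable_le _ (fun w => M * `|f w|)).
- exact: measurable_funM.
- by apply: integrable_scale; exact: integrable_norm.
- by move=> w; rewrite normrM ler_wpM2r.
Qed.

Lemma regularised_shift u v :
  regularised (u + B *m v) = \int[P]_w (g (u + xi w) * tilt v w).
Proof.
(* Adding [M] makes the test function nonnegative. *)
have mG : measurable_fun setT (fun z : borelV => (g (u + z) + M)%:E).
  apply/measurable_EFinP; apply: measurable_funD => //.
  have mX : measurable_fun setT ((fun z => u + z) : borelV -> borelV).
    apply: measurable_vec => i; under eq_fun do rewrite mxE; apply: measurable_funD => //.
    by apply: (@continuous_measurable_vec _ _ (fun z : V => z i ord0)); exact: coord_continuous.
  exact: (measurableT_comp mg mX).
have G0 z : (0 <= (g (u + z) + M)%:E)%E.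
  by rewrite lee_fin -lerBlDr sub0r; have := gM (u + z); rewrite ler_norml => /andP[].
have := quasi_invariant v mG G0.
under eq_integral do rewrite [in (_ + B *m v)%R]addrC addrA.
move=> /(congr1 fine).
rewrite -/(Rintegral P setT (fun w => g (u + B *m v + xi w) + M)).
under [X in _ = fine X]eq_integral do rewrite -EFinM mulrDl.
rewrite -/(Rintegral P setT (fun w => g (u + xi w) * tilt v w + M * tilt v w)).
rewrite RintegralD// RintegralD//; [|exact: igM|exact: integrable_scale].
by rewrite RintegralZl// Rintegral_tilt mulr1 Rintegral_cst1 => /addIr.
Qed.

(** The remainder [tilt v - 1 - score_form v] has mean zero and is at least
    [- score_var v], so that its absolute value has mean at most
    [2 * score_var v]. *)
Lemma regularised_taylor u v :
  `|regularised (u + B *m v) - regularised u - regularised_diff u v|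
    <= 2 * score_var v * M.
Proof.
pose rem w := tilt v w - 1 - score_form v w.
have irem : P.-integrable setT (EFin \o rem).
  apply: (@integrable_le _ (fun w => tilt v w + (1 + `|score_form v w|))).
  - by apply: measurable_funB => //; exact: measurable_funB.
  - by do 2 apply: integrable_add => //; exact: integrable_norm.
  - move=> w; rewrite /rem; have t0 : 0 <= tilt v w by exact: expR_ge0.
    have a := ler_norm (score_form v w).
    have b := ler_norm (- score_form v w); rewrite normrN in b.
    by rewrite ler_norml; apply/andP; split; lra.
have mrem : measurable_fun setT rem by do 2 apply: measurable_funB => //.
have -> : regularised (u + B *m v) - regularised u - regularised_diff u v =
    \int[P]_w (g (u + xi w) * rem w).
  rewrite regularised_shift /regularised /regularised_diff.
  have i1 := igM u (measurable_tilt v) (integrable_tilt v).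
  have i2 := igM u (measurable_score_form v) (integrable_score_form v).
  have i3 := integrable_add i1 (integrable_scale (-1) (igu u)).
  rewrite -RintegralB// -RintegralB//.
    by apply: eq_Rintegral => w _; rewrite /rem; ring.
  apply: eq_integrable i3 => // w _ /=; congr (_%:E); ring.
have rem_bd w : `|rem w| <= rem w + 2 * score_var v.
  have := tilt_ge v w; rewrite /rem => h.
  have q0 := score_var_ge0 v.
  by rewrite ler_norml; apply/andP; split; lra.
have irem2 : P.-integrable setT (EFin \o (fun w => rem w + 2 * score_var v)).
  by apply: integrable_add => //; exact: integrable_cst.
apply: (le_trans (le_normr_Rintegral _ _)) => //; first exact: igM.
apply: (@le_trans _ _ (\int[P]_w (M * (rem w + 2 * score_var v)))).
  apply: le_Rintegral => //.
  - by apply: integrable_norm; exact: igM.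
  - exact: integrable_scale.
  - by move=> w _; rewrite normrM ler_pM.
rewrite RintegralZl// RintegralD// Rintegral_cst1.
rewrite RintegralB//; last by apply: (@integrable_add (tilt v) (fun=> -1)) => //; exact: integrable_cst.
by rewrite RintegralB// Rintegral_tilt Rintegral_cst1 Rintegral_score_form; lra.
Qed.

Lemma regularised_bound u : `|regularised u| <= M.
Proof.
apply: (le_trans (le_normr_Rintegral _ _)) => //.
rewrite -[leRHS](Rintegral_cst1 M); apply: le_Rintegral => //.
by apply: integrable_norm; exact: igu.
Qed.

Lemma regularised_diffZ u a v : regularised_diff u (a *: v) = a * regularised_diff u v.
Proof.
rewrite /regularised_diff -RintegralZl//; last exact: igM.
by apply: eq_Rintegral => w _; rewrite score_formZ mulrCA.
Qed.

Lemma regularised_diffD u v v' :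
  regularised_diff u (v + v') = regularised_diff u v + regularised_diff u v'.
Proof.
rewrite /regularised_diff -RintegralD//; [|exact: igM|exact: igM].
by apply: eq_Rintegral => w _; rewrite score_formD mulrDr.
Qed.

(** On a step of size [kappa ^ -1/2], the scale of the noise, the increment of
    [regularised] is at most [2 * M] and the Taylor remainder at most
    [n%:R * M]; linearity in [v] does the rest. *)
Lemma regularised_diff_le u v : 0 < kappa ->
  `|regularised_diff u v| <= (2 + n%:R) * M * (Num.sqrt kappa * `|v|).
Proof.
move=> kappa_gt0.
have unit_step z : `|z| <= (Num.sqrt kappa)^-1 ->
    `|regularised_diff u z| <= (2 + n%:R) * M.
  move=> zk; have T := regularised_taylor u z.
  have a := regularised_bound u; have b := regularised_bound (u + B *m z).
  have q : score_var z <= n%:R / 2.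
    rewrite /score_var; apply: (@le_trans _ _ (kappa / 2 * \sum_(i < n) kappa^-1)).
      rewrite ler_wpM2l ?divr_ge0//; apply: ler_sum => i _.
      rewrite -(sqr_sqrtr (ltW kappa_gt0)) -exprVn -real_normK ?num_real//.
      by rewrite ler_pXn2r// ?nnegrE ?invr_ge0 ?sqrtr_ge0// (le_trans (le_coord_norm _ _)).
    rewrite sumr_const card_ord -[kappa^-1 *+ n]mulr_natl le_eqVlt.
    by apply/orP; left; apply/eqP; field; rewrite gt_eqF.
  have qM : score_var z * M <= n%:R / 2 * M by rewrite ler_wpM2r.
  move: T a b; rewrite !ler_norml => /andP[T1 T2] /andP[a1 a2] /andP[b1 b2].
  by apply/andP; split; lra.
have [->|v0] := eqVneq v 0.
  by rewrite -(scale0r 0) regularised_diffZ mul0r normr0 !mulr_ge0// addr_ge0.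
have nv : 0 < `|v| by rewrite normr_gt0.
have sk : 0 < Num.sqrt kappa by rewrite sqrtr_gt0.
pose a := (Num.sqrt kappa * `|v|)^-1.
have a0 : 0 < a by rewrite invr_gt0 mulr_gt0.
have := unit_step (a *: v); rewrite normrZ regularised_diffZ normrM gtr0_norm//.
rewrite {1}/a invfM mulfVK ?gt_eqF// => /(_ (lexx _)).
by rewrite /a -ler_pdivlMl ?invr_gt0 ?mulr_gt0// invrK mulrC.
Qed.

End Regularised.
End Smoothing.

(** * Integrals against signed measures *)

Section BoundedIntegrands.
Context (R : realType) d (T : measurableType d) (m : {finite_measure set T -> \bar R}).
Variables (A : set T) (mA : measurable A).

Lemma bounded_integrable (f : T -> R) (M : R) : measurable_fun A f ->
  (forall x, A x -> `|f x| <= M) -> m.-integrable A (EFin \o f).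
Proof.
move=> mf fM; apply: measurable_bounded_integrable => //.
  by rewrite ltey_eq fin_num_measure.
exists M; split; first by rewrite num_real.
by move=> N MN x Ax /=; rewrite (le_trans (fM _ Ax))// ltW.
Qed.

Lemma le_norm_Rintegral_bound (f : T -> R) (M : R) : measurable_fun A f ->
  (forall x, A x -> `|f x| <= M) ->
  `|\int[m]_(x in A) f x| <= M * fine (m A).
Proof.
move=> mf fM; have jf := bounded_integrable mf fM.
apply: (le_trans (le_normr_Rintegral mA jf)).
rewrite -Rintegral_cst//; apply: le_Rintegral => //.
  exact: integrable_norm.
by apply: finite_measure_integrable_cst.
Qed.

End BoundedIntegrands.

Section ShiftedIntegral.
Context (R : realType).
Variables (m : {finite_measure set (measurableTypeR R) -> \bar R}).
Variables (A : set R) (mA : measurable A).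

Lemma measurable_shifted (f : measurableTypeR R -> R) (s : R) :
  measurable_fun setT f -> measurable_fun setT (fun r : measurableTypeR R => f (s + r)).
Proof.
move=> mf; have ms : measurable_fun setT (fun r : measurableTypeR R => s + r : measurableTypeR R).
  exact: measurable_funD.
exact: (measurableT_comp mf ms).
Qed.

(** Fubini's theorem, after adding a constant that makes [f] nonnegative. *)
Lemma measurable_shifted_integral (f : measurableTypeR R -> R) (M : R) :
  measurable_fun setT f -> (forall s, `|f s| <= M) ->
  measurable_fun setT (fun s : measurableTypeR R => \int[m]_(r in A) f (s + r)).
Proof.
move=> mf fM.
have fM0 s : 0 <= f s + M by have := fM s; rewrite ler_norml => /andP[]; lra.
pose F (z : measurableTypeR R * measurableTypeR R) : \bar R :=
  ((f (z.1 + z.2) + M) * \1_A z.2)%:E.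
have mF : measurable_fun setT F.
  apply/measurable_EFinP; apply: measurable_funM.
    apply: measurable_funD => //.
    have ma : measurable_fun setT (fun z : measurableTypeR R * measurableTypeR R => z.1 + z.2 : measurableTypeR R).
      by apply: measurable_funD; [exact: measurable_fst|exact: measurable_snd].
    exact: (measurableT_comp mf ma).
  have mi : measurable_fun setT (\1_A : measurableTypeR R -> R) by exact: measurable_indic.
  exact: (measurableT_comp mi measurable_snd).
have F0 z : (0 <= F z)%E by rewrite lee_fin mulr_ge0.
have := @measurable_fun_fubini_tonelli_F _ _ _ _ _ m _ mF F0.
rewrite /fubini_F => mG.
rewrite (_ : (fun s => _) = (fun s => fine (\int[m]_r F (s, r))%E - M * fine (m A))).
  by apply: measurable_funB => //; apply: measurableT_comp mG.
apply/funext => s.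
have mfs := measurable_shifted s mf.
have js : m.-integrable A (EFin \o (fun r => f (s + r))).
  by apply: (@bounded_integrable _ _ _ m A mA _ M) => //; exact: measurable_funTS.
rewrite -Rintegral_cst// (_ : fine _ = \int[m]_(r in A) (f (s + r) + M)).
  rewrite RintegralD//; last by apply: finite_measure_integrable_cst.
  by rewrite addrK.
rewrite [RHS]Rintegral_mkcond; congr fine; apply: eq_integral => r _.
by rewrite /F /= patchE indicE; case: ifP; rewrite ?mulr1 ?mulr0.
Qed.

End ShiftedIntegral.

Section ChargeIntegral.
Context {R : realType}.
Implicit Types (nu : {charge set (measurableTypeR R) -> \bar R}) (f g : measurableTypeR R -> R).

Definition bounded_measurable f :=
  measurable_fun setT f /\ exists M, forall s, `|f s| <= M.

(** The Jordan parts for the Hahn decomposition chosen by [charge_integral]. *)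
Definition charge_pos nu : {finite_measure set (measurableTypeR R) -> \bar R} :=
  jordan_pos (projT2 (cid (projT2 (cid (Hahn_decomposition nu))))).
Definition charge_neg nu : {finite_measure set (measurableTypeR R) -> \bar R} :=
  jordan_neg (projT2 (cid (projT2 (cid (Hahn_decomposition nu))))).

Lemma charge_integralE nu A f : charge_integral nu A f =
  \int[charge_pos nu]_(s in A) f s - \int[charge_neg nu]_(s in A) f s.
Proof. by []. Qed.

Definition charge_mass nu (A : set (measurableTypeR R)) : R :=
  fine (charge_pos nu A) + fine (charge_neg nu A).

Lemma charge_mass_ge0 nu A : 0 <= charge_mass nu A.
Proof. by rewrite addr_ge0// fine_ge0. Qed.

Section OnMeasurable.
Variables (A : set (measurableTypeR R)) (mA : measurable A).

Let jnt (m : {finite_measure set (measurableTypeR R) -> \bar R}) f :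
  bounded_measurable f -> m.-integrable A (EFin \o f).
Proof.
move=> [mf [M fM]]; apply: (@bounded_integrable _ _ _ m A mA _ M) => //.
exact: measurable_funTS.
Qed.

Lemma charge_integralD nu f g : bounded_measurable f -> bounded_measurable g ->
  charge_integral nu A (fun s => f s + g s) =
  charge_integral nu A f + charge_integral nu A g.
Proof.
by move=> bf bg; rewrite !charge_integralE !RintegralD//; [ring|exact: jnt..].
Qed.

Lemma charge_integralZ nu a f : bounded_measurable f ->
  charge_integral nu A (fun s => a * f s) = a * charge_integral nu A f.
Proof.
by move=> bf; rewrite !charge_integralE !RintegralZl//; [ring|exact: jnt..].
Qed.

Lemma eq_charge_integral nu f g : (forall s, A s -> f s = g s) ->
  charge_integral nu A f = charge_integral nu A g.
Proof.
move=> fg; rewrite !charge_integralE.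
by congr (_ - _); apply: eq_Rintegral => s /[!inE] /fg.
Qed.

Lemma charge_integral_le nu f M : measurable_fun A f ->
  (forall s, A s -> `|f s| <= M) ->
  `|charge_integral nu A f| <= M * charge_mass nu A.
Proof.
move=> mf fM; rewrite charge_integralE (le_trans (ler_normB _ _))// mulrDr.
by rewrite lerD//; exact: le_norm_Rintegral_bound.
Qed.

Lemma measurable_shifted_charge_integral nu f : bounded_measurable f ->
  measurable_fun setT (fun s : measurableTypeR R => charge_integral nu A (fun r => f (s + r))).
Proof.
move=> [mf [M fM]]; apply: measurable_funB; exact: (measurable_shifted_integral _ mA mf fM).
Qed.

End OnMeasurable.
End ChargeIntegral.

(** * Causal operators and Picard iteration *)

Section CausalOperators.
Context {R : realType} {n : nat}.
Local Notation V := 'cV[R]_n.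
Local Notation leb := (@lebesgue_measure R).

Definition bounded_path (f : R -> V) : Prop :=
  (forall i, measurable_fun setT (fun s : measurableTypeR R => f s i ord0)) /\
  exists M, forall s, `|f s| <= M.

Lemma bounded_path_coord f i : bounded_path f ->
  bounded_measurable (fun s : measurableTypeR R => f s i ord0).
Proof.
by move=> [mf [M fM]]; split=> //; exists M => s; exact: le_trans (le_coord_norm _ _) _.
Qed.

Lemma bounded_pathD f g : bounded_path f -> bounded_path g ->
  bounded_path (fun s => f s + g s).
Proof.
move=> [mf [M fM]] [mg [N gN]]; split.
  by move=> i; under eq_fun do rewrite mxE; exact: measurable_funD.
by exists (M + N) => s; rewrite (le_trans (ler_normD _ _))// lerD.
Qed.

Lemma bounded_pathZ (a : R) f : bounded_path f -> bounded_path (fun s => a *: f s).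
Proof.
move=> [mf [M fM]]; split.
  by move=> i; under eq_fun do rewrite mxE; exact: measurable_funM.
by exists (`|a| * M) => s; rewrite normrZ ler_wpM2l.
Qed.

(** What the argument needs from a delay operator. The drift of the equation
    and the observation [delay_map] both have this form. *)
Record causal_operator (K : R) (H : (R -> V) -> R -> V) : Prop := {
  causal_ge0 : 0 <= K;
  causalD : forall f g s, bounded_path f -> bounded_path g ->
    H (fun s => f s + g s) s = H f s + H g s;
  causalZ : forall a f s, bounded_path f -> H (fun s => a *: f s) s = a *: H f s;
  causal_le : forall f s M, bounded_path f ->
    (forall u, u <= s -> `|f u| <= M) -> `|H f s| <= K * M;
  causal_measurable : forall f i, bounded_path f ->
    measurable_fun setT (fun s : measurableTypeR R => H f s i ord0) }.

Definition delay_operator (c : 'M[R]_n) (m : @mx_charge R n) (A : set R)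
    (f : R -> V) (s : R) : V :=
  c *m f s + mx_integral m A (fun r => f (s + r)).

Definition delay_mass (m : @mx_charge R n) (A : set R) : R :=
  \sum_i \sum_j charge_mass (m i j) A.

Lemma mx_integral_le (m : @mx_charge R n) (A : set (measurableTypeR R)) (g : R -> V) M :
  measurable A -> bounded_path g -> 0 <= M ->
  (forall r, A r -> `|g r| <= M) -> `|mx_integral m A g| <= delay_mass m A * M.
Proof.
move=> mA bg M0 gM.
have mass0 i : 0 <= \sum_j charge_mass (m i j) A.
  by apply: sumr_ge0 => j _; exact: charge_mass_ge0.
apply: norm_le_coord => [|i]; first by rewrite mulr_ge0// sumr_ge0.
rewrite mxE (le_trans (ler_norm_sum _ _ _))//.
apply: (@le_trans _ _ (\sum_j charge_mass (m i j) A * M)).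
  apply: ler_sum => j _; rewrite mulrC; apply: charge_integral_le => //.
    by case: bg => mg _; exact: measurable_funTS.
  by move=> r Ar; exact: le_trans (le_coord_norm _ _) (gM _ Ar).
rewrite -mulr_suml ler_wpM2r// [leRHS](bigD1 i)//= lerDl.
by apply: sumr_ge0 => k _; exact: mass0.
Qed.

Lemma bounded_path_shift f s : bounded_path f -> bounded_path (fun r => f (s + r)).
Proof.
move=> [mf [M fM]]; split; last by exists M.
by move=> i; exact: (measurable_shifted s (mf i)).
Qed.

Lemma causal_delay_operator (c : 'M[R]_n) m (A : set (measurableTypeR R)) :
  measurable A -> (forall r, A r -> r <= 0) ->
  causal_operator (\sum_i \sum_j `|c i j| + delay_mass m A) (delay_operator c m A).
Proof.
move=> mA A0.
have c0 : 0 <= \sum_i \sum_j `|c i j|.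
  by apply: sumr_ge0 => i _; exact: sumr_ge0.
have m0 : 0 <= delay_mass m A.
  by do 2 apply: sumr_ge0 => ? _; exact: charge_mass_ge0.
split; first exact: addr_ge0.
- move=> f g s bf bg; rewrite /delay_operator mulmxDr addrACA; congr (_ + _).
  apply/colP => i; rewrite !mxE -big_split; apply: eq_bigr => j _ /=.
  rewrite -(charge_integralD mA); last 2 first.
  + exact/bounded_path_coord/bounded_path_shift.
  + exact/bounded_path_coord/bounded_path_shift.
  by apply: eq_charge_integral => // r _; rewrite mxE.
- move=> a f s bf; rewrite /delay_operator scalerDr -scalemxAr; congr (_ + _).
  apply/colP => i; rewrite !mxE mulr_sumr; apply: eq_bigr => j _ /=.
  rewrite -(charge_integralZ mA); last exact/bounded_path_coord/bounded_path_shift.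
  by apply: eq_charge_integral => // r _; rewrite mxE.
- move=> f s M bf fM; have M0 : 0 <= M by rewrite (le_trans _ (fM s _)).
  rewrite (le_trans (ler_normD _ _))// mulrDl lerD//.
    by rewrite (le_trans (norm_mulmx_le _ _))// ler_wpM2l// fM.
  apply: mx_integral_le => //; first exact: bounded_path_shift.
  by move=> r Ar; apply: fM; rewrite gerDl A0.
- move=> f i bf; under eq_fun do rewrite !mxE.
  have mc j : measurable_fun setT (fun s : measurableTypeR R => c i j * f s j ord0).
    by apply: measurable_funM => //; case: bf => mf _; exact: mf.
  have mm j : measurable_fun setT (fun s : measurableTypeR R =>
      charge_integral (m i j) A (fun r => f (s + r) j ord0)).
    exact: (measurable_shifted_charge_integral mA (m i j) (bounded_path_coord j bf)).
  by apply: measurable_funD; [exact: (measurable_sum _ mc)|exact: (measurable_sum _ mm)].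
Qed.

End CausalOperators.

Section Volterra.
Context {R : realType} {n : nat}.
Local Notation V := 'cV[R]_n.
Local Notation leb := (@lebesgue_measure R).

Lemma lebesgue_segment_lty (a b : R) : (leb (`[a, b]%classic : set R) < +oo)%E.
Proof.
by rewrite lebesgue_measure_itv/=; case: ifP; rewrite ?ltry// -EFinB ltry.
Qed.

Lemma fine_lebesgue_segment (a b : R) : a <= b ->
  fine (leb (`[a, b]%classic : set R)) = b - a.
Proof.
by rewrite lebesgue_measure_itv/= lte_fin; case: ltgtP => // ->; rewrite subrr.
Qed.

Lemma integral_expR_le (l s : R) : 0 < l -> 0 <= s ->
  \int[leb]_(u in `[0, s]) expR (l * u) <= l^-1 * expR (l * s).
Proof.
move=> l0; rewrite le_eqVlt => /predU1P[<-|s0].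
  by rewrite set_itv1 Rintegral_set1 mulr_ge0 ?expR_ge0// invr_ge0 ltW.
have dF x : is_derive x (1 : R) (fun u => l^-1 * expR (l * u)) (expR (l * x)).
  apply: is_derive_eq; rewrite /GRing.scale/= mulr1 mulrCA mulVf ?mulr1//.
  by rewrite gt_eqF.
have cF : continuous (fun u => l^-1 * expR (l * u)).
  by move=> x; apply: differentiable_continuous; exact/derivable1_diffP/(@ex_derive _ _ _ _ _ _ _ (dF x)).
have cf : continuous (fun u => expR (l * u)).
  move=> x; apply: continuous_comp; last exact: continuous_expR.
  by apply: cvgM; [exact: cvg_cst|exact: cvg_id].
have -> : \int[leb]_(u in `[0, s]) expR (l * u) =
    l^-1 * expR (l * s) - l^-1 * expR (l * 0).
  rewrite /Rintegral (continuous_FTC2 (F := fun u => l^-1 * expR (l * u)) s0)//.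
  - exact: continuous_subspaceT.
  - split=> [x _||].
    + exact: (@ex_derive _ _ _ _ _ _ _ (dF x)).
    + exact/cvg_at_right_filter/cF.
    + exact/cvg_at_left_filter/cF.
  - by move=> x _; rewrite derive1E; exact: (@derive_val _ _ _ _ _ _ _ (dF x)).
by rewrite lerBlDr lerDl mulr_ge0 ?expR_ge0// invr_ge0 ltW.
Qed.

Variables (K : R) (H : (R -> V) -> R -> V) (causalH : causal_operator K H).
Variables (t : R) (t0 : 0 <= t).

(** It vanishes outside the time interval, so that the past of the initial
    state belongs to the forcing and the unknown path starts at time zero. *)
Definition volterra (f : R -> V) (s : R) : V :=
  if 0 <= s <= t then \col_i \int[leb]_(u in `[0, s]) H f u i ord0 else 0.

Lemma causal_integrable f i s : bounded_path f ->
  leb.-integrable `[0, s] (EFin \o (fun u => H f u i ord0)).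
Proof.
move=> bf; have [mf [M fM]] := bf.
have [s0|s0] := leP 0 s; last first.
  by rewrite set_itv_ge ?bnd_simp -?ltNge//; exact: integrable_set0.
apply: measurable_bounded_integrable => //.
- exact: lebesgue_segment_lty.
- by apply: measurable_funTS; exact: causal_measurable causalH _ _ bf.
- exists (K * M); split; first by rewrite num_real.
  move=> N MN u _ /=; rewrite (le_trans (le_coord_norm _ _))// (le_trans _ (ltW MN))//.
  exact: causal_le causalH _ _ _ bf _.
Qed.

Lemma volterraD f g s : bounded_path f -> bounded_path g ->
  volterra (fun s => f s + g s) s = volterra f s + volterra g s.
Proof.
move=> bf bg; rewrite /volterra; case: ifP => _; last by rewrite addr0.
apply/colP => i; rewrite !mxE -RintegralD//; [|exact: causal_integrable..].
by apply: eq_Rintegral => u _; rewrite (causalD causalH)// mxE.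
Qed.

Lemma volterraZ a f s : bounded_path f ->
  volterra (fun s => a *: f s) s = a *: volterra f s.
Proof.
move=> bf; rewrite /volterra; case: ifP => _; last by rewrite scaler0.
apply/colP => i; rewrite !mxE -RintegralZl//; [|exact: causal_integrable].
by apply: eq_Rintegral => u _; rewrite (causalZ causalH)// mxE.
Qed.

Lemma volterra_le f b s : bounded_path f -> 0 <= s <= t ->
  leb.-integrable `[0, s] (EFin \o b) ->
  (forall u, 0 <= u <= s -> `|H f u| <= b u) ->
  `|volterra f s| <= \int[leb]_(u in `[0, s]) b u.
Proof.
move=> bf st ib Hb; rewrite /volterra st.
have b0 : 0 <= \int[leb]_(u in `[0, s]) b u.
  by apply: Rintegral_ge0 => u /=; rewrite in_itv/= => /Hb; exact: le_trans.
apply: norm_le_coord => // i; rewrite mxE.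
have jH := causal_integrable i s bf.
apply: (le_trans (le_normr_Rintegral _ jH)) => //.
apply: le_Rintegral => //; first exact: integrable_norm.
by move=> u /=; rewrite in_itv/= => /Hb; exact: le_trans (le_coord_norm _ _).
Qed.

(** By causality the bound on [H f u] only involves times up to [u], among
    which the weight is largest at [u]. *)
Lemma volterra_exp f M l s : bounded_path f -> 0 <= M -> 0 < l ->
  (forall u, `|f u| <= M * expR (l * u)) ->
  `|volterra f s| <= K / l * M * expR (l * s).
Proof.
move=> bf M0 l0 fM; have K0 := causal_ge0 causalH.
have [st|st] := boolP (0 <= s <= t); last first.
  by rewrite /volterra (negbTE st) normr0 !mulr_ge0 ?expR_ge0// invr_ge0 ltW.
have /andP[s0 _] := st.
have jexp : leb.-integrable `[0, s] (EFin \o (fun u => expR (l * u))).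
  apply: measurable_bounded_integrable => //.
  - exact: lebesgue_segment_lty.
  - by apply: measurable_funTS; apply: measurableT_comp => //; exact: measurable_funM.
  - exists (expR (l * s)); split; first by rewrite num_real.
    move=> N MN u /=; rewrite in_itv/= => /andP[u0 us].
    rewrite ger0_norm ?expR_ge0// (le_trans _ (ltW MN))// ler_expR.
    by rewrite ler_pM2l.
apply: (@le_trans _ _ (\int[leb]_(u in `[0, s]) (K * M * expR (l * u)))).
  apply: volterra_le => //.
    rewrite (_ : EFin \o _ = (fun u => (K * M)%:E * (EFin \o (fun u => expR (l * u))) u))%E.
      exact: integrableZl.
    by apply/funext => u; rewrite /= EFinM.
  move=> u /andP[u0 us]; rewrite -mulrA; apply: (causal_le causalH) => // v vu.
  by rewrite (le_trans (fM v))// ler_wpM2l// ler_expR ler_pM2l.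
rewrite RintegralZl// (le_trans (ler_wpM2l _ (integral_expR_le l0 s0)))//.
  exact: mulr_ge0.
by rewrite mulrA [K / l * M]mulrAC.
Qed.

Lemma volterra_late f M a s : bounded_path f -> 0 <= M -> 0 <= a ->
  (forall u, u < a -> f u = 0) -> (forall u, `|f u| <= M) ->
  `|volterra f s| <= if a <= s <= t then K * M * (s - a) else 0.
Proof.
move=> bf M0 a0 fa fM; have K0 := causal_ge0 causalH.
have [st|st] := boolP (0 <= s <= t); last first.
  rewrite /volterra (negbTE st) normr0; case: ifP => // /andP[as_ _].
  by rewrite !mulr_ge0// subr_ge0.
have /andP[s0 s1] := st.
pose b u := K * M * \1_(`[a, s] : set R) u.
have ib : leb.-integrable `[0, s] (EFin \o b).
  apply: measurable_bounded_integrable => //.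
  - exact: lebesgue_segment_lty.
  - by apply: measurable_funTS; apply: measurable_funM => //; exact: measurable_indic.
  - exists (K * M); split; first by rewrite num_real.
    move=> N MN u _ /=; rewrite (le_trans _ (ltW MN))// normrM ger0_norm ?mulr_ge0//.
    by rewrite ler_piMr ?mulr_ge0// indicE ger0_norm// lern1; case: (_ \in _).
apply: (le_trans (volterra_le bf st ib _)).
  move=> u /andP[u0 us]; rewrite /b indicE.
  have [au|ua] := leP a u.
    rewrite mem_set/= ?in_itv/= ?au// mulr1.
    exact: causal_le causalH _ _ _ bf _.
  rewrite memNset/= ?mulr0; last by rewrite in_itv/= leNgt ua.
  rewrite -(mulr0 K); apply: (causal_le causalH) => // v vu.
  by rewrite fa ?normr0// (le_lt_trans vu).
have i1 : leb.-integrable `[0, s] (EFin \o (\1_(`[a, s] : set R) : R -> R)).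
  apply: measurable_bounded_integrable => //.
  - exact: lebesgue_segment_lty.
  - exists 1; split; first by rewrite num_real.
    move=> N N1 u _ /=; rewrite (le_trans _ (ltW N1))//.
    by rewrite indicE ger0_norm// lern1; case: (_ \in _).
rewrite s1 andbT /b RintegralZl//.
have -> : \int[leb]_(u in `[0, s]) \1_(`[a, s] : set R) u =
    fine (leb (`[a, s]%classic : set R)).
  rewrite /Rintegral integral_indic//; congr fine; congr (leb _).
  apply/seteqP; split=> [u []//|u /= us]; split=> //.
  by move: us; rewrite /= !in_itv/= => /andP[au ->]; rewrite (le_trans a0 au).
rewrite lebesgue_measure_itv/= lte_fin.
case: ltgtP => [as_|sa|<-]/=; rewrite ?mulr0 ?subrr ?mulr0//.
Qed.

(** The iteration for the equation [y = f + volterra y]. *)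
Fixpoint picard (f : R -> V) (k : nat) (s : R) : V :=
  if k is k'.+1 then f s + volterra (picard f k') s else f s.

Definition supported (f : R -> V) := forall s, ~~ (0 <= s <= t) -> f s = 0.

Lemma volterra_supported f : supported (volterra f).
Proof. by move=> s st; rewrite /volterra (negbTE st). Qed.

Lemma volterra_sup f M s : bounded_path f -> (forall u, `|f u| <= M) ->
  `|volterra f s| <= K * M * t.
Proof.
move=> bf fM; have M0 : 0 <= M by rewrite (le_trans _ (fM 0)).
have K0 := causal_ge0 causalH.
have [st|st] := boolP (0 <= s <= t); last first.
  by rewrite volterra_supported// normr0 !mulr_ge0.
have /andP[s0 s1] := st.
rewrite (@le_trans _ _ (\int[leb]_(u in `[0, s]) (K * M)))//.
  apply: volterra_le => //.
    apply: measurable_bounded_integrable => //; first exact: lebesgue_segment_lty.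
    exists (K * M); split; first by rewrite num_real.
    by move=> N /ltW KN u _ /=; rewrite ger0_norm// mulr_ge0.
  by move=> u _; apply: (causal_le causalH) => // v _.
rewrite Rintegral_cst// [X in _ * X <= _](_ : _ = s - 0).
  by rewrite subr0 ler_wpM2l// mulr_ge0.
exact: fine_lebesgue_segment.
Qed.

Lemma bounded_path_volterra f : bounded_path f -> bounded_path (volterra f).
Proof.
move=> bf; have [mf [M fM]] := bf; split.
  move=> i.
  rewrite (_ : (fun s => _) = (fun s : measurableTypeR R =>
    \int[leb]_(u in `[0, s]) H f u i ord0) \_ (`[0, t])); last first.
    apply/funext => s; rewrite patchE /volterra.
    rewrite (_ : (s \in _) = (0 <= s <= t)); last first.
      by apply/idP/idP => [/set_mem|h]; [rewrite /= in_itv|apply/mem_set; rewrite /= in_itv].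
    by case: ifP => _; rewrite mxE.
  apply/(measurable_restrict _ (measurable_itv _) measurableT); rewrite setTI.
  apply: subspace_continuous_measurable_fun => //.
  exact: (parameterized_integral_continuous t0 (causal_integrable i t bf)).
by exists (K * M * t) => s; exact: volterra_sup.
Qed.

Lemma bounded_path_picard f k : bounded_path f -> bounded_path (picard f k).
Proof.
move=> bf; elim: k => [|k IH] //=.
by apply: bounded_pathD => //; exact: bounded_path_volterra.
Qed.

Lemma picardD f g k : bounded_path f -> bounded_path g ->
  picard (fun s => f s + g s) k = (fun s => picard f k s + picard g k s).
Proof.
move=> bf bg; apply/funext; elim: k => [|k IH] s //=.
rewrite (funext IH) volterraD; [|exact: bounded_path_picard..].
by rewrite addrACA.
Qed.

Lemma picardZ a f k : bounded_path f ->
  picard (fun s => a *: f s) k = (fun s => a *: picard f k s).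
Proof.
move=> bf; apply/funext; elim: k => [|k IH] s //=.
by rewrite (funext IH) volterraZ ?scalerDr//; exact: bounded_path_picard.
Qed.

(** The rate of an exponential weight for which the Volterra operator at
    least halves the weighted supremum norm, on any time interval. *)
Definition rate : R := 2 * K + 1.

Lemma rate_gt0 : 0 < rate.
Proof. by have := causal_ge0 causalH; rewrite /rate; lra. Qed.

Lemma volterra_contracts f M s : bounded_path f -> 0 <= M ->
  (forall u, `|f u| <= M * expR (rate * u)) ->
  `|volterra f s| <= M / 2 * expR (rate * s).
Proof.
move=> bf M0 fM; have r0 := rate_gt0.
apply: (le_trans (volterra_exp s bf M0 r0 fM)).
rewrite ler_wpM2r ?expR_ge0// mulrC ler_wpM2l//.
by rewrite ler_pdivrMr// /rate; lra.
Qed.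

Lemma supported_exp f M s : supported f -> (forall u, `|f u| <= M) ->
  `|f s| <= M * expR (rate * s).
Proof.
move=> sf fM; have M0 : 0 <= M by rewrite (le_trans _ (fM 0)).
have [/andP[s0 _]|st] := boolP (0 <= s <= t); last first.
  by rewrite sf// normr0 mulr_ge0// expR_ge0.
rewrite (le_trans (fM s))// ler_peMr// -expR0 ler_expR.
by rewrite mulr_ge0// ltW// rate_gt0.
Qed.

Lemma volterraB (f g : R -> V) s : bounded_path f -> bounded_path g ->
  volterra (fun s => f s - g s) s = volterra f s - volterra g s.
Proof.
move=> bf bg; rewrite -[- volterra g s]scaleN1r -volterraZ// -volterraD//.
  by congr volterra; apply/funext => u; rewrite scaleN1r.
exact: bounded_pathZ.
Qed.

Lemma bounded_pathB (f g : R -> V) : bounded_path f -> bounded_path g ->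
  bounded_path (fun s => f s - g s).
Proof.
move=> bf bg; rewrite (_ : (fun s => _) = (fun s => f s + (-1) *: g s)).
  by apply: bounded_pathD => //; exact: bounded_pathZ.
by apply/funext => s; rewrite scaleN1r.
Qed.

Lemma picard_le f M k s : bounded_path f -> supported f ->
  (forall u, `|f u| <= M) -> `|picard f k s| <= 2 * M * expR (rate * s).
Proof.
move=> bf sf fM; have M0 : 0 <= M by rewrite (le_trans _ (fM 0)).
elim: k s => [|k IH] s /=; have fs := supported_exp s sf fM.
  rewrite (le_trans fs)// ler_wpM2r ?expR_ge0//; lra.
rewrite (le_trans (ler_normD _ _))//.
have M20 : 0 <= 2 * M by lra.
have := volterra_contracts s (bounded_path_picard k bf) M20 IH; lra.
Qed.

Lemma picard_step f M k s : bounded_path f -> supported f ->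
  (forall u, `|f u| <= M) ->
  `|picard f k.+1 s - picard f k s| <= M * 2^-1 ^+ k * expR (rate * s).
Proof.
move=> bf sf fM; have M0 : 0 <= M by rewrite (le_trans _ (fM 0)).
elim: k s => [|k IH] s.
  rewrite /= addrC addKr expr0 mulr1.
  apply: (le_trans (volterra_contracts s bf M0 _)).
    by move=> u; exact: supported_exp.
  by rewrite ler_wpM2r ?expR_ge0//; lra.
have bk := bounded_path_picard k bf; have bk1 := bounded_path_picard k.+1 bf.
rewrite [picard f k.+2 s]/= [X in _ - X]/= opprD addrACA subrr add0r.
rewrite -volterraB// exprSr mulrA.
apply: volterra_contracts => //; first exact: bounded_pathB.
by rewrite mulr_ge0// exprn_ge0.
Qed.

Lemma picard_solution f y M k s : bounded_path f -> bounded_path y ->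
  supported y -> (forall s, y s = f s + volterra y s) ->
  (forall u, `|y u| <= M) ->
  `|y s - picard f k s| <= M * 2^-1 ^+ k * expR (rate * s).
Proof.
move=> bf by_ sy yE yM; have M0 : 0 <= M by rewrite (le_trans _ (yM 0)).
elim: k s => [|k IH] s.
  rewrite /= yE addrC addKr expr0 mulr1.
  apply: (le_trans (volterra_contracts s by_ M0 _)).
    by move=> u; exact: supported_exp.
  by rewrite ler_wpM2r ?expR_ge0//; lra.
have bk := bounded_path_picard k bf.
rewrite {1}yE /= opprD addrACA subrr add0r -volterraB// exprSr mulrA.
apply: volterra_contracts => //; first exact: bounded_pathB.
by rewrite mulr_ge0// exprn_ge0.
Qed.

Lemma picard_early f a k s : bounded_path f -> 0 <= a ->
  (forall u, u < a -> f u = 0) -> s < a -> picard f k s = 0.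
Proof.
move=> bf a0 fa; elim: k s => [|k IH] s sa /=; first exact: fa.
rewrite fa// add0r; have [mk [M kM]] := bounded_path_picard k bf.
have M0 : 0 <= M by rewrite (le_trans _ (kM 0)).
have := volterra_late s (bounded_path_picard k bf) M0 a0 IH kM.
by rewrite [a <= s]leNgt sa/= normr_le0 => /eqP.
Qed.

End Volterra.

(** * Observed response to a forcing *)

Section Response.
Context {R : realType} {n : nat}.
Local Notation V := 'cV[R]_n.

Lemma geometric_cvg (w : nat -> V) (D : R) :
  (forall k, `|w k.+1 - w k| <= D * 2^-1 ^+ k) -> cvg (w @ \oo).
Proof.
move=> wD; suff wi i : cvg ((fun k => w k i ord0) @ \oo).
  apply: (cvgP (\col_i lim ((fun k => w k i ord0) @ \oo))).
  by apply: cvg_coord => i; rewrite mxE; exact: wi.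
pose e k := w k.+1 i ord0 - w k i ord0.
have -> : (fun k => w k i ord0) = (fun k => w 0%N i ord0 + series e k).
  by apply/funext => k; rewrite seriesEnat/= telescope_sumr// addrC subrK.
apply: is_cvgD; first exact: is_cvg_cst.
have : cvgn (series e); last by [].
apply: normed_cvg; apply: (@series_le_cvg _ _ (fun k => D * 2^-1 ^+ k)) => //.
- by move=> k /=.
- by move=> k; rewrite (le_trans _ (wD k)).
- by move=> k; rewrite (le_trans _ (wD k))//; have := le_coord_norm (w k.+1 - w k) i; rewrite !mxE.
- apply: is_cvg_geometric_series.
  by rewrite ger0_norm ?invr_ge0// invf_lt1// ltr1n.
Qed.

Lemma norm_cvg_le (w : nat -> V) (l : V) (c : R) : w @ \oo --> l ->
  (forall k, `|w k| <= c) -> `|l| <= c.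
Proof.
by move=> wl wc; apply: (cvgr_to_le (cvg_norm wl)); exact: nearW.
Qed.

Lemma norm_cvg_dist_le (w : nat -> V) (l z : V) (c : R) : w @ \oo --> l ->
  (forall k, `|w k - z| <= c) -> `|l - z| <= c.
Proof.
move=> wl wc; apply: norm_cvg_le wc; apply: cvgB => //; exact: cvg_cst.
Qed.

Variables (K : R) (H : (R -> V) -> R -> V) (causalH : causal_operator K H).
Variables (L : R) (Q : (R -> V) -> R -> V) (causalQ : causal_operator L Q).
Variables (t : R) (t0 : 0 <= t).

Local Notation picard := (picard H t).
Local Notation volterra := (volterra H t).
Local Notation supported := (@supported R n t).

(** The value observed by [Q] at time [t] of the solution of
    [y = f + volterra y]. Defined as a limit, it makes sense for every bounded
    measurable forcing, the step paths among them. *)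
Definition response (f : R -> V) : V := lim (Q (picard f k) t @[k --> \oo]).

Definition response_mass : R := L * (2 * expR (rate K * t)).

Lemma response_mass_ge0 : 0 <= response_mass.
Proof. by rewrite !mulr_ge0 ?expR_ge0 ?(causal_ge0 causalQ). Qed.

Lemma causalB f g s : bounded_path f -> bounded_path g ->
  Q (fun s => f s - g s) s = Q f s - Q g s.
Proof.
move=> bf bg; rewrite -[- Q g s]scaleN1r -(causalZ causalQ)// -(causalD causalQ)//.
  by congr Q; apply/funext => u; rewrite scaleN1r.
exact: bounded_pathZ.
Qed.

Let exp_mono u : u <= t -> expR (rate K * u) <= expR (rate K * t).
Proof. by move=> ut; rewrite ler_expR ler_wpM2l// ltW// (rate_gt0 causalH). Qed.

Lemma response_cvg f : bounded_path f -> supported f ->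
  Q (picard f k) t @[k --> \oo] --> response f.
Proof.
move=> bf sf; have [_ [M fM]] := bf.
have M0 : 0 <= M by rewrite (le_trans _ (fM 0)).
apply: (@geometric_cvg _ (L * (M * expR (rate K * t)))) => k.
rewrite -causalB; [|exact: (bounded_path_picard causalH t0)..].
rewrite -mulrA; apply: (causal_le causalQ).
  by apply: bounded_pathB; exact: (bounded_path_picard causalH t0).
move=> u ut; apply: (le_trans (picard_step causalH t0 k u bf sf fM)).
by rewrite -!mulrA ler_wpM2l// mulrC ler_wpM2r ?exprn_ge0// exp_mono.
Qed.

Lemma responseD f g : bounded_path f -> supported f ->
  bounded_path g -> supported g ->
  response (fun s => f s + g s) = response f + response g.
Proof.
move=> bf sf bg sg; apply/cvg_lim => //.
rewrite (_ : (fun k => _) = (fun k => Q (picard f k) t + Q (picard g k) t)).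
  by apply: cvgD; exact: response_cvg.
apply/funext => k; rewrite (picardD causalH)// (causalD causalQ)//;
  exact: (bounded_path_picard causalH t0).
Qed.

Lemma responseZ a f : bounded_path f -> supported f ->
  response (fun s => a *: f s) = a *: response f.
Proof.
move=> bf sf; apply/cvg_lim => //.
rewrite (_ : (fun k => _) = (fun k => a *: Q (picard f k) t)).
  by apply: cvgZr; exact: response_cvg.
apply/funext => k; rewrite (picardZ causalH)// (causalZ causalQ)//.
exact: (bounded_path_picard causalH t0).
Qed.

Lemma response_le f M : bounded_path f -> supported f -> (forall u, `|f u| <= M) ->
  `|response f| <= response_mass * M.
Proof.
move=> bf sf fM; have M0 : 0 <= M by rewrite (le_trans _ (fM 0)).
apply: (norm_cvg_le (response_cvg bf sf)) => k.
rewrite /response_mass -mulrA; apply: (causal_le causalQ).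
  exact: (bounded_path_picard causalH t0).
move=> u ut; apply: (le_trans (picard_le causalH t0 k u bf sf fM)).
by rewrite mulrAC ler_wpM2r// ler_wpM2l// exp_mono.
Qed.

Lemma response_solution f y : bounded_path f -> supported f ->
  bounded_path y -> supported y -> (forall s, y s = f s + volterra y s) ->
  response f = Q y t.
Proof.
move=> bf sf by_ sy yE; have [_ [M yM]] := by_.
have M0 : 0 <= M by rewrite (le_trans _ (yM 0)).
apply/cvg_lim => //; apply/cvgrPdist_le => e e0.
have : L * (M * expR (rate K * t)) * 2^-1 ^+ k @[k --> \oo] --> (0 : R).
  rewrite -[X in _ --> X](mulr0 (L * (M * expR (rate K * t)))).
  apply: cvgM; first exact: cvg_cst.
  by apply: cvg_expr; rewrite ger0_norm ?invr_ge0// invf_lt1// ltr1n.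
move=> /cvgrPdist_le/(_ _ e0); apply: filterS => k.
rewrite sub0r normrN ger0_norm; last first.
  by rewrite !mulr_ge0 ?expR_ge0 ?exprn_ge0 ?(causal_ge0 causalQ).
apply: le_trans; rewrite -causalB//; last exact: (bounded_path_picard causalH t0).
rewrite -mulrA; apply: (causal_le causalQ).
  by apply: bounded_pathB => //; exact: (bounded_path_picard causalH t0).
move=> u ut; apply: (le_trans (picard_solution causalH t0 k u bf by_ sy yE yM)).
by rewrite -!mulrA ler_wpM2l// mulrC ler_wpM2r ?exprn_ge0// exp_mono.
Qed.

(** Each iterate differs from [f] by the Volterra operator applied to a path
    that vanishes before [a], hence by a multiple of [t - a]. *)
Lemma response_late f M a : bounded_path f -> supported f -> 0 <= a <= t ->
  (forall u, u < a -> f u = 0) -> (forall u, `|f u| <= M) ->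
  `|response f - Q f t| <= response_mass * K * M * (t - a).
Proof.
move=> bf sf /andP[a0 at_] fa fM.
have M0 : 0 <= M by rewrite (le_trans _ (fM 0)).
have K0 := causal_ge0 causalH; have L0 := causal_ge0 causalQ.
apply: (norm_cvg_dist_le (response_cvg bf sf)) => k.
have bk j := bounded_path_picard causalH t0 j bf.
rewrite -causalB//.
rewrite /response_mass -!mulrA; apply: (causal_le causalQ).
  exact: bounded_pathB.
move=> u ut; case: k => [|k] /=.
  by rewrite subrr normr0 !mulr_ge0 ?expR_ge0// subr_ge0.
rewrite addrC addKr.
have pM v : `|picard f k v| <= 2 * M * expR (rate K * t).
  have [vt|tv] := leP v t.
    apply: (le_trans (picard_le causalH t0 k v bf sf fM)).
    by rewrite ler_wpM2l ?exp_mono// mulr_ge0.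
  have : ~~ (0 <= v <= t) by rewrite [v <= t]leNgt tv andbF.
  case: (k) => [|j] vt /=; first by rewrite sf// normr0 !mulr_ge0 ?expR_ge0.
  by rewrite sf// (volterra_supported H _ vt) addr0 normr0 !mulr_ge0 ?expR_ge0.
have M1 : 0 <= 2 * M * expR (rate K * t) by rewrite !mulr_ge0 ?expR_ge0.
have early v : v < a -> picard f k v = 0.
  by move=> va; exact: (picard_early causalH t0 k bf a0 fa va).
apply: (le_trans (volterra_late causalH t u (bk k) M1 a0 early pM)).
have E0 := expR_ge0 (rate K * t).
case: ifP => [/andP[au _]|_]; last by rewrite !mulr_ge0// subr_ge0.
rewrite (_ : 2 * (_ * _) = K * (2 * M * expR (rate K * t)) * (t - a)); last by ring.
by rewrite ler_wpM2l ?lerB// mulr_ge0.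
Qed.

End Response.

(** * Step approximation of paths *)

Section StepPaths.
Context {R : realType} {n : nat}.
Local Notation V := 'cV[R]_n.
Implicit Types (p : R -> V) (t : R).

Definition cut t p (s : R) : V := if 0 <= s <= t then p s else 0.

Lemma cut_supported t p : supported t (cut t p).
Proof. by move=> s st; rewrite /cut (negbTE st). Qed.

Lemma bounded_path_cut t p : {within `[0, t], continuous p} -> bounded_path (cut t p).
Proof.
move=> cp; split.
  move=> i.
  rewrite (_ : (fun s => _) = (fun s : measurableTypeR R => p s i ord0) \_ (`[0, t])); last first.
    apply/funext => s; rewrite patchE /cut.
    rewrite (_ : (s \in _) = (0 <= s <= t)); last first.
      by apply/idP/idP => [/set_mem|h]; [rewrite /= in_itv|apply/mem_set; rewrite /= in_itv].
    by case: ifP => _ //; rewrite mxE.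
  apply/(measurable_restrict _ (measurable_itv _) measurableT); rewrite setTI.
  apply: subspace_continuous_measurable_fun => //.
  by move=> s; exact: (cvg_comp _ _ (cp s) (@coord_continuous _ _ _ i ord0 (p s))).
have /compact_bounded[M [_ pM]] : compact (p @` `[0, t]).
  by apply: continuous_compact => //; exact: segment_compact.
exists (`|M| + 1) => s; rewrite /cut; case: ifP => st; last first.
  by rewrite normr0 addr_ge0.
apply: pM; first by rewrite ltr_pwDr// ler_norm.
by exists s => //; rewrite /= in_itv.
Qed.

Lemma bounded_path_mulmx (A : 'M[R]_n) p : bounded_path p ->
  bounded_path (fun s => A *m p s).
Proof.
move=> [mp [M pM]]; split.
  move=> i; under eq_fun do rewrite mxE.
  have mj j : measurable_fun setT (fun s : measurableTypeR R => A i j * p s j ord0).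
    by apply: measurable_funM => //; exact: mp.
  exact: (measurable_sum _ mj).
exists ((\sum_i \sum_j `|A i j|) * M) => s.
rewrite (le_trans (norm_mulmx_le _ _))// ler_wpM2l//.
by apply: sumr_ge0 => i _; exact: sumr_ge0.
Qed.

(** Heine's theorem. *)
Lemma segment_uniform_continuity t p (e : R) : {within `[0, t], continuous p} ->
  0 < e -> exists2 dl : R, 0 < dl & forall x y, 0 <= x <= t -> 0 <= y <= t ->
    `|x - y| < dl -> `|p x - p y| <= e.
Proof.
move=> /subspace_continuousP cp e0.
have /compact_near_coveringP/near_covering_withinP := @segment_compact R 0 t.
move=> /(_ R (0 : R)^'+ (fun dl x => forall y, 0 <= y <= t ->
  `|x - y| < dl -> `|p x - p y| <= e) _) near_cover.
have : \forall dl \near (0 : R)^'+, `[0, t]%classic `<=`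
    (fun x => forall y, 0 <= y <= t -> `|x - y| < dl -> `|p x - p y| <= e).
  apply: near_cover => x xt; have e20 : 0 < e / 2 by rewrite divr_gt0.
  have := cp x xt; move=> /cvgrPdist_lt/(_ _ e20).
  rewrite near_withinE => /nbhs_ballP[eta /= eta0 xeta].
  exists (ball x (eta / 2), [set dl | dl < eta / 2]).
    split=> /=; first by apply: nbhsx_ballx; rewrite divr_gt0.
    by apply: nbhs_right_lt; rewrite divr_gt0.
  move=> [x' dl] /= [xx' dleta] x't y yt x'y.
  have xx'2 : `|x - x'| < eta / 2 by move: xx'; rewrite -ball_normE.
  have px' : `|p x - p x'| < e / 2.
    apply: xeta => //; rewrite -ball_normE/= (lt_trans xx'2)//.
    by rewrite ltr_pdivrMr// ltr_pMr// ltr1n.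
  have py : `|p x - p y| < e / 2.
    apply: xeta => /=; last by rewrite in_itv.
    rewrite -ball_normE/= -(subrKA x') (le_lt_trans (ler_normD _ _))//.
    by rewrite (splitr eta) ltrD// (lt_trans x'y).
  rewrite -(subrKA (p x)) (le_trans (ler_normD _ _))// (splitr e) lerD//.
    by rewrite distrC ltW.
  exact: ltW.
move=> near_dl.
have [dl [dl0 dlP]] := @filter_ex _ _ (at_right_proper_filter (0 : R)) _
  (filterI (nbhs_right_gt (0 : R)) near_dl).
by exists dl => // x y xt yt; exact: dlP.
Qed.

Definition grid t (m : nat) (k : nat) : R := k%:R * (t / m%:R).

(** When [p 0 = 0] this is [p] at the last grid point up to [s]. The
    telescoped form shows it as a linear combination of the increments of [p],
    which are independent when [p] is a Wiener path. *)
Definition step_path t m p (s : R) : V :=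
  \sum_(j < m) (if grid t m j.+1 <= s <= t
    then p (grid t m j.+1) - p (grid t m j) else 0).

Lemma step_path_dist t m p (dl e : R) : 0 < t -> (0 < m)%N -> 0 <= e -> p 0 = 0 ->
  (forall x y, 0 <= x <= t -> 0 <= y <= t -> `|x - y| < dl -> `|p x - p y| <= e) ->
  t / m%:R < dl -> forall s, `|cut t p s - step_path t m p s| <= e.
Proof.
move=> t0 m0 e0 p0 pe mdl s.
have h0 : 0 < t / m%:R by rewrite divr_gt0// ltr0n.
have mR : 0 < m%:R :> R by rewrite ltr0n.
have [st|/negP st] := boolP (0 <= s <= t); last first.
  rewrite /cut (negbTE (introN idP st)) /step_path big1 ?subrr ?normr0// => j _.
  case: ifP => // /andP[js st']; case: st; rewrite st' andbT.
  by rewrite (le_trans _ js)// mulr_ge0// ltW.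
have /andP[s0 s1] := st.
pose J := Num.truncn (s / (t / m%:R)).
have /andP[J1 J2] : J%:R <= s / (t / m%:R) < J.+1%:R.
  by apply: truncn_itv; rewrite divr_ge0// ltW.
have Jm : (J <= m)%N.
  rewrite -(ler_nat R) (le_trans J1)// ler_pdivrMr// mulrC divfK ?gt_eqF//.
have stepE : step_path t m p s = p (grid t m J).
  rewrite /step_path (eq_bigr (fun j : 'I_m => if (j < J)%N then
      p (grid t m j.+1) - p (grid t m j) else 0)); last first.
    move=> j _; rewrite s1 andbT /grid -ler_pdivlMr//.
    by rewrite -truncn_ge_nat// ?divr_ge0// ltW.
  rewrite -big_mkcond/= -(big_ord_widen m
    (fun j => p (grid t m j.+1) - p (grid t m j)) Jm)/=.
  rewrite -(big_mkord xpredT (fun j => p (grid t m j.+1) - p (grid t m j))).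
  by rewrite telescope_sumr// /grid mul0r p0 subr0.
have gs : grid t m J <= s by rewrite /grid -ler_pdivlMr.
have g0 : 0 <= grid t m J by rewrite /grid mulr_ge0// ltW.
rewrite /cut st stepE; apply: pe => //; first by rewrite g0 (le_trans gs).
have sg : s < grid t m J + t / m%:R.
  by move: J2; rewrite ltr_pdivrMr// -natr1 mulrDl mul1r.
by rewrite ger0_norm ?subr_ge0// (lt_trans _ mdl)// ltrBlDl.
Qed.

Definition unit_step t (m : nat) (A : 'M[R]_n) (z : 'I_m * 'I_n) (s : R) : V :=
  if grid t m z.1.+1 <= s <= t then A *m delta_mx z.2 ord0 else 0.

Lemma mul_step_path t m (A : 'M[R]_n) p s :
  A *m step_path t m p s =
  \sum_(z : 'I_m * 'I_n) (p (grid t m z.1.+1) z.2 ord0 - p (grid t m z.1) z.2 ord0) *: unit_step t A z s.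
Proof.
rewrite /step_path mulmx_sumr -(pair_bigA _ (fun (j : 'I_m) i =>
  (p (grid t m j.+1) i ord0 - p (grid t m j) i ord0) *: unit_step t A (j, i) s))/=.
apply: eq_bigr => j _; rewrite /unit_step/=; case: ifP => _; last first.
  by rewrite mulmx0 big1// => i _; rewrite scaler0.
under eq_bigr do rewrite scalemxAr.
rewrite -mulmx_sumr; congr (_ *m _); apply/colP => i.
rewrite summxE (bigD1 i)//= !mxE !eqxx mulr1 big1 ?addr0// => k ki.
by rewrite !mxE eq_sym (negbTE ki) mulr0.
Qed.

Lemma bounded_path_unit_step t m A z : 0 <= t -> bounded_path (@unit_step t m A z).
Proof.
move=> t0; split; last first.
  exists `|A *m (delta_mx z.2 ord0 : V)| => s; rewrite /unit_step.
  by case: ifP => _ //; rewrite normr0.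
move=> i; rewrite (_ : (fun s => _) = (fun s : measurableTypeR R =>
    (A *m delta_mx z.2 ord0 : V) i ord0 * \1_(`[grid t m z.1.+1, t] : set R) s)).
  by apply: measurable_funM => //; exact: measurable_indic.
apply/funext => s; rewrite /unit_step indicE.
rewrite (_ : (s \in _) = (grid t m z.1.+1 <= s <= t)); last first.
  by apply/idP/idP => [/set_mem|h]; [rewrite /= in_itv|apply/mem_set; rewrite /= in_itv].
by case: ifP => _; rewrite ?mulr1 ?mulr0 ?mxE.
Qed.

Lemma unit_step_supported t m A z : 0 <= t -> supported t (@unit_step t m A z).
Proof.
move=> t0 s st; rewrite /unit_step; case: ifP => // /andP[gs s1].
move: st; rewrite s1 andbT (le_trans _ gs)// /grid mulr_ge0// divr_ge0//.
Qed.

End StepPaths.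

(** * Cameron-Martin formula along a ramp *)

Section CameronMartin.
Context {R : realType} {n : nat}.
Local Notation V := 'cV[R]_n.
Local Notation borelV := (g_sigma_algebraType (@open V)).

(** The Cameron-Martin argument only sees the observed response through these
    properties. *)
Record bounded_functional (t C : R) (S : (R -> V) -> V) : Prop := {
  functional_ge0 : 0 <= C;
  functionalD : forall f g, bounded_path f -> supported t f ->
    bounded_path g -> supported t g -> S (fun s => f s + g s) = S f + S g;
  functionalZ : forall a f, bounded_path f -> supported t f ->
    S (fun s => a *: f s) = a *: S f;
  functional_le : forall f M, bounded_path f -> supported t f ->
    (forall s, `|f s| <= M) -> `|S f| <= C * M }.

Variables (t C : R) (S : (R -> V) -> V).
Hypotheses (t_gt0 : 0 < t) (bS : bounded_functional t C S).
Variable A : 'M[R]_n.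

Let t0 : 0 <= t. Proof. exact: ltW. Qed.

Lemma functional_sum (I : Type) (l : seq I) (c : I -> R) (f : I -> R -> V) :
  (forall i, bounded_path (f i)) -> (forall i, supported t (f i)) ->
  [/\ bounded_path (fun s => \sum_(i <- l) c i *: f i s),
      supported t (fun s => \sum_(i <- l) c i *: f i s) &
      S (fun s => \sum_(i <- l) c i *: f i s) = \sum_(i <- l) c i *: S (f i)].
Proof.
move=> bf sf; elim: l => [|i l [IHb IHs IHS]].
  have b0 : bounded_path (fun=> 0 : V).
    split=> [i|]; last by exists 0 => s; rewrite normr0.
    by under eq_fun do rewrite mxE; exact: measurable_cst.
  rewrite (_ : (fun s => _) = (fun=> 0)); last first.
    by apply/funext => s; rewrite big_nil.
  split=> //; rewrite big_nil; apply/eqP; rewrite -normr_le0 -(mulr0 C).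
  by apply: (functional_le bS) => // s; rewrite normr0.
rewrite (_ : (fun s => _) = (fun s => c i *: f i s + \sum_(i <- l) c i *: f i s)); last first.
  by apply/funext => s; rewrite big_cons.
have bi : bounded_path (fun s => c i *: f i s) by exact: bounded_pathZ.
have si : supported t (fun s => c i *: f i s) by move=> s st; rewrite sf// scaler0.
split; first exact: bounded_pathD.
  by move=> s st; rewrite si// IHs// addr0.
by rewrite (functionalD bS)// (functionalZ bS)// IHS big_cons.
Qed.

Definition step_functional (m : nat) (p : R -> V) : V :=
  \sum_(z : 'I_m * 'I_n)
    (p (grid t m z.1.+1) z.2 ord0 - p (grid t m z.1) z.2 ord0) *: S (unit_step t A z).

Lemma step_functionalE m p :
  [/\ bounded_path (fun s => A *m step_path t m p s),
      supported t (fun s => A *m step_path t m p s) &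
      S (fun s => A *m step_path t m p s) = step_functional m p].
Proof.
rewrite (_ : (fun s => _) = (fun s => \sum_(z : 'I_m * 'I_n)
    (p (grid t m z.1.+1) z.2 ord0 - p (grid t m z.1) z.2 ord0) *: unit_step t A z s)).
  by apply: functional_sum => z; [exact: bounded_path_unit_step|exact: unit_step_supported].
by apply/funext => s; rewrite mul_step_path.
Qed.

(** The step paths converge uniformly and [S] is bounded in the supremum
    norm. *)
Lemma step_functional_cvg (p : R -> V) (q : nat) : {within `[0, t], continuous p} -> p 0 = 0 ->
  step_functional (q.+1 * k.+1) p @[k --> \oo] --> S (fun s => A *m cut t p s).
Proof.
move=> cp p0; apply/cvgrPdist_le => e e0.
set KA := \sum_i \sum_j `|A i j|.
have KA0 : 0 <= KA by apply: sumr_ge0 => i _; exact: sumr_ge0.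
have C0 := functional_ge0 bS.
pose e' := e / (C * KA + 1).
have e'0 : 0 < e' by rewrite divr_gt0// ltr_wpDl// mulr_ge0.
have [dl dl0 pe] := segment_uniform_continuity cp e'0.
have : \forall k \near \oo, t / dl < k%:R by exact: nbhs_infty_gtr.
apply: filterS => k tk.
have mdl : t / (q.+1 * k.+1)%:R < dl.
  rewrite ltr_pdivrMr ?ltr0n ?muln_gt0// mulrC -ltr_pdivrMr//.
  by rewrite (lt_le_trans tk)// ler_nat (leq_trans (leqnSn k))// leq_pmull.
have dist := step_path_dist t_gt0 (ltn0Sn _) (ltW e'0) p0 pe mdl.
have [bs ss sE] := step_functionalE (q.+1 * k.+1) p.
have bc := bounded_path_mulmx A (bounded_path_cut cp).
have sc : supported t (fun s => A *m cut t p s).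
  by move=> s st; rewrite cut_supported// mulmx0.
rewrite -sE -[- S _]scaleN1r -(functionalZ bS)// -(functionalD bS)//; last 2 first.
- exact: bounded_pathZ.
- by move=> s st; rewrite ss// scaler0.
apply: (@le_trans _ _ (C * (KA * e'))).
  apply: (functional_le bS).
  - by apply: bounded_pathD => //; exact: bounded_pathZ.
  - by move=> s st; rewrite ss// sc// scaler0 addr0.
  - move=> s; rewrite scaleN1r -mulmxBr (le_trans (norm_mulmx_le _ _))//.
    by rewrite ler_wpM2l.
rewrite mulrA /e' mulrA ler_pdivrMr ?ltr_wpDl ?mulr_ge0//.
by rewrite mulrC ler_wpM2l ?ltW// ltrDl.
Qed.

Variable (q' : nat).
Local Notation q := q'.+1.
(** The ramp rises from 0 to 1 on the last [q]-th part of the time interval. *)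
Definition ramp_length : R := t / q%:R.
Definition ramp_start : R := t * q'%:R / q%:R.
Definition ramp (s : R) : R := Num.max 0 ((s - ramp_start) / ramp_length).

Let r_gt0 : 0 < ramp_length. Proof. by rewrite divr_gt0// ltr0n. Qed.

Let qR : (q%:R : R) != 0. Proof. by rewrite pnatr_eq0. Qed.

Lemma ramp_start_length : ramp_start + ramp_length = t.
Proof. by rewrite /ramp_start /ramp_length; field; rewrite nat1r qR. Qed.

Lemma ramp_start_ge0 : 0 <= ramp_start.
Proof. by rewrite divr_ge0// mulr_ge0. Qed.

Lemma ramp_bounds s : s <= t -> 0 <= ramp s <= 1.
Proof.
move=> st; rewrite le_max lexx/= ge_max ler01/= ler_pdivrMr// mul1r.
by rewrite lerBlDl ramp_start_length.
Qed.

Lemma ramp_early s : s <= ramp_start -> ramp s = 0.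
Proof.
by move=> sa; rewrite /ramp max_l// pmulr_lle0 ?invr_gt0// subr_le0.
Qed.

Lemma ramp_end : ramp t = 1.
Proof.
rewrite /ramp -[in X in Num.max _ X]ramp_start_length addrAC subrr add0r divff ?gt_eqF//.
by rewrite max_r.
Qed.

Definition ramp_path (v : V) (s : R) : V := ramp s *: v.

Lemma continuous_ramp : continuous ramp.
Proof.
move=> s; apply: (@continuous_max R R (cst 0) (fun s => (s - ramp_start) / ramp_length)).
  exact: cvg_cst.
apply: cvgM; last exact: cvg_cst.
by apply: cvgB; [exact: cvg_id|exact: cvg_cst].
Qed.

Lemma continuous_ramp_path v : {within `[0, t], continuous (ramp_path v)}.
Proof.
apply: continuous_subspaceT => s; apply: cvgZl; exact: continuous_ramp.
Qed.

(** The matrix of the displacement of [S] when the path is shifted by the ramp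
    in a given direction. *)
Definition ramp_response : 'M[R]_n :=
  \matrix_(i, j) S (fun s => A *m cut t (ramp_path (delta_mx j ord0)) s) i ord0.

Lemma ramp_responseE v :
  ramp_response *m v = S (fun s => A *m cut t (ramp_path v) s).
Proof.
pose f j s := A *m cut t (ramp_path (delta_mx j ord0)) s.
have bf j : bounded_path (f j).
  by apply: bounded_path_mulmx; apply: bounded_path_cut; exact: continuous_ramp_path.
have sf j : supported t (f j) by move=> s st; rewrite /f cut_supported// mulmx0.
have [_ _ fE] := functional_sum (index_enum 'I_n) (fun j => v j ord0) bf sf.
rewrite (_ : (fun s => A *m _) = (fun s => \sum_j v j ord0 *: f j s)).
  rewrite fE; apply/colP => i; rewrite !mxE summxE; apply: eq_bigr => j _.
  by rewrite !mxE mulrC.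
apply/funext => s; rewrite /f.
under eq_bigr do rewrite scalemxAr; rewrite -mulmx_sumr; congr (_ *m _).
rewrite /cut; case: ifP => _; last by rewrite big1// => j _; rewrite scaler0.
apply/colP => i; rewrite summxE (bigD1 i)//= big1; last first.
  by move=> j ji; rewrite !mxE eq_sym (negbTE ji) !mulr0.
by rewrite !mxE !eqxx addr0 mulr1 mulrC.
Qed.

(** A grid of [q * N] steps contains the starting time of the ramp. Its
    increments are then equal on the steps after that time and zero on the
    others, and the sums weighted by them telescope. *)
Section Grid.
Variable N : nat.
Hypothesis N_gt0 : (0 < N)%N.
Let m := (q * N)%N.

Let NR : (N%:R : R) != 0. Proof. by rewrite pnatr_eq0 -lt0n. Qed.

Let mE : m%:R = q%:R * N%:R :> R. Proof. by rewrite natrM. Qed.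

Lemma gridS j : grid t m j.+1 - grid t m j = t / m%:R.
Proof. by rewrite /grid -mulrBl -natr1 addrAC subrr add0r mul1r. Qed.

Lemma grid_last : grid t m m = t.
Proof. by rewrite /grid mE; field; rewrite nat1r NR qR. Qed.

Lemma grid_start : grid t m (q' * N) = ramp_start.
Proof. by rewrite /grid /ramp_start mE natrM; field; rewrite nat1r NR qR. Qed.

Lemma telescope_late (u : nat -> R) :
  \sum_(j < m) (if (q' * N <= j)%N then u j.+1 - u j else 0) = u m - u (q' * N)%N.
Proof.
have qNm : (q' * N <= m)%N by rewrite leq_mul2r leqnSn orbT.
pose v j := u (maxn j (q' * N)).
rewrite (eq_bigr (fun j : 'I_m => v j.+1 - v j)).
  rewrite -(big_mkord xpredT (fun j => v j.+1 - v j)) telescope_sumr// /v.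
  by rewrite (maxn_idPl qNm) max0n.
move=> j _; rewrite /v; case: leqP => jq.
  by rewrite (maxn_idPl (leqW jq)).
by rewrite (maxn_idPr jq) subrr.
Qed.

Let h_gt0 : 0 < t / m%:R.
Proof. by rewrite divr_gt0// ltr0n muln_gt0. Qed.

Lemma ramp_grid j : ramp (grid t m j.+1) - ramp (grid t m j) =
  if (q' * N <= j)%N then (t / m%:R) / ramp_length else 0.
Proof.
have late k : (q' * N <= k)%N ->
    ramp (grid t m k) = (grid t m k - ramp_start) / ramp_length.
  move=> qk; rewrite /ramp max_r// divr_ge0 ?(ltW r_gt0)// subr_ge0 -grid_start.
  by rewrite /grid ler_pM2r// ler_nat.
case: leqP => jq.
  rewrite !late//; last exact: leqW.
  by rewrite -mulrBl -(gridS j); congr (_ / _); ring.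
by rewrite !ramp_early ?subrr// -grid_start /grid ler_pM2r// ler_nat// ltnW.
Qed.

End Grid.

Context d (Omega : measurableType d) (P : probability Omega R).
Variable W : R -> Omega -> V.
Hypothesis hW : standard_wiener P W.

(** The integral of the derivative of the ramp against the path. *)
Definition ramp_score (i : 'I_n) (w : Omega) : R :=
  (W t w i ord0 - W ramp_start w i ord0) / ramp_length.

Lemma measurable_wiener s i : 0 <= s -> measurable_fun setT (fun w => W s w i ord0).
Proof. by case: hW => + _ _ _; exact. Qed.

Lemma measurable_ramp_score i : measurable_fun setT (ramp_score i).
Proof.
apply: measurable_funM => //; apply: measurable_funB; apply: measurable_wiener => //.
exact: ramp_start_ge0.
Qed.

Lemma measurable_step_functional m i :
  measurable_fun setT (fun w => step_functional m (W ^~ w) i ord0).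
Proof.
pose F (z : 'I_m * 'I_n) w := (W (grid t m z.1.+1) w z.2 ord0 - W (grid t m z.1) w z.2 ord0)
   * S (unit_step t A z) i ord0.
rewrite (_ : (fun w => _) = (fun w => \sum_z F z w)).
  apply: measurable_sum => z; apply: measurable_funM => //.
  by apply: measurable_funB; apply: measurable_wiener; rewrite mulr_ge0// divr_ge0.
by apply/funext => w; rewrite summxE; apply: eq_bigr => z _; rewrite mxE.
Qed.

(** The density of the shift does not depend on the grid, because the sums in
    its exponent telescope; in the limit only the test function varies. *)
Lemma step_quasi_invariant k v (g : V -> R) : continuous g -> (forall u, 0 <= g u <= 1) ->
  let m := (q * k.+1)%N in
  (\int[P]_w (g (step_functional m (W ^~ w) + step_functional m (ramp_path v)))%:E =
   \int[P]_w (g (step_functional m (W ^~ w)) *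
     tilt ramp_score ramp_length^-1 v w)%:E)%E.
Proof.
move=> cg g01 m.
have m_gt0 : (0 < m)%N by rewrite muln_gt0.
have h_gt0 : 0 < t / m%:R by rewrite divr_gt0// ltr0n.
pose X (z : 'I_m * 'I_n) w := W (grid t m z.1.+1) w z.2 ord0 - W (grid t m z.1) w z.2 ord0.
have [_ _ _ /(_ m (grid t m))[||/= indX lawX]] := hW.
- by rewrite /grid mul0r.
- by move=> j _; rewrite -subr_gt0 gridS.
pose sd (z : 'I_m * 'I_n) := Num.sqrt (t / m%:R).
have sd0 z : sd z != 0 by rewrite gt_eqF// sqrtr_gt0.
have mX z : measurable_fun setT (X z).
  by apply: measurable_funB; apply: measurable_wiener; rewrite mulr_ge0// divr_ge0.
have lawX' z (B : set R) : measurable B -> P (X z @^-1` B) = normal_prob 0 (sd z) B.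
  by move=> mB; rewrite /sd -(gridS k.+1 z.1); exact: lawX.
pose c (z : 'I_m * 'I_n) := ramp_path v (grid t m z.1.+1) z.2 ord0 -
  ramp_path v (grid t m z.1) z.2 ord0.
pose comb (x : coord_space R ('I_m * 'I_n)%type) : V := \sum_z x z *: S (unit_step t A z).
have mcomb i : measurable_fun setT (fun x => comb x i ord0).
  pose F z (x : coord_space R ('I_m * 'I_n)%type) := x z * S (unit_step t A z) i ord0.
  rewrite (_ : (fun x => _) = (fun x => \sum_z F z x)).
    by apply: measurable_sum => z; apply: measurable_funM => //; exact: measurable_coord.
  by apply/funext => x; rewrite summxE; apply: eq_bigr => z _; rewrite mxE.
pose F x := (g (comb x))%:E.
have mF : measurable_fun setT F.
  apply/measurable_EFinP.
  by apply: (measurableT_comp (continuous_measurable_vec cg)); exact: measurable_vec.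
have F0 x : (0 <= F x)%E by rewrite lee_fin; case/andP: (g01 (comb x)).
have := integral_shift_coordinates mX indX sd0 lawX' c mF F0.
rewrite (_ : (fun w => F _) = (fun w => (g (step_functional m (W ^~ w) +
    step_functional m (ramp_path v)))%:E)); last first.
  apply/funext => w; rewrite /F /comb /step_functional -big_split/=.
  by congr (g _)%:E; apply: eq_bigr => z _; rewrite -scalerDl.
move=> ->; apply: eq_integral => w _; rewrite -EFinM; congr (_ * _)%:E.
rewrite /tilt -expR_sum; congr expR.
have cE z : c z = (if (q' * k.+1 <= z.1)%N then (t / m%:R) / ramp_length else 0) * v z.2 ord0.
  by rewrite /c /ramp_path !mxE -mulrBl ramp_grid.
have sd2 z : sd z ^+ 2 = t / m%:R by rewrite sqr_sqrtr// ltW.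
have r_neq0 : ramp_length != 0 by rewrite gt_eqF.
have h_neq0 : t / m%:R != 0 by rewrite gt_eqF.
have r_def : t - ramp_start = ramp_length by rewrite -{1}ramp_start_length addrC addKr.
rewrite sumrB; congr (_ - _).
  rewrite -(pair_bigA _ (fun (j : 'I_m) i => c (j, i) * X (j, i) w / sd (j, i) ^+ 2))/=.
  rewrite exchange_big; apply: eq_bigr => i _ /=.
  have := @telescope_late k.+1 (fun j => W (grid t m j) w i ord0).
  rewrite grid_last// grid_start// /ramp_score => <-.
  rewrite mulr_suml mulr_sumr; apply: eq_bigr => j _; rewrite cE sd2 /X/=.
  case: ifP => _; last by rewrite !(mul0r, mulr0).
  by rewrite -!mulrA; field; rewrite r_neq0 -?mE; move: h_neq0; rewrite mulf_eq0 invr_eq0 negb_or => /andP[-> ->].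
rewrite -(pair_bigA _ (fun (j : 'I_m) i => c (j, i) ^+ 2 / (sd (j, i) ^+ 2 *+ 2)))/=.
rewrite exchange_big /score_var mulr_sumr; apply: eq_bigr => i _ /=.
have := @telescope_late k.+1 (grid t m); rewrite grid_last// grid_start// r_def => rE.
rewrite -[X in X / 2](mulfK (expf_neq0 2 r_neq0)) mulrA.
rewrite (_ : ramp_length^-1 * ramp_length ^+ 2 = ramp_length); last by rewrite expr2 mulKf.
rewrite -{1}rE !mulr_suml; apply: eq_bigr => j _; rewrite cE sd2 gridS.
case: ifP => _; last by rewrite !(mul0r, mulr0, expr0n).
rewrite -/m; set h := t / m%:R in h_neq0 *; rewrite -mulr_natr; field.
by rewrite r_neq0 h_neq0.
Qed.

(** The noise [xi] is set to zero on a null set that contains the irregular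
    paths, which makes it measurable as a limit of step functionals. *)
Lemma wiener_quasi_invariant : exists xi : Omega -> V,
  [/\ forall i, measurable_fun setT (fun w => xi w i ord0),
      {ae P, forall w, {within `[0, t], continuous (W ^~ w)} /\
        xi w = S (fun s => A *m cut t (W ^~ w) s)} &
      forall (v : V) (G : borelV -> \bar R),
        measurable_fun setT G -> (forall u, 0 <= G u)%E ->
        (\int[P]_w G (xi w + ramp_response *m v)%R =
         \int[P]_w (G (xi w) * (tilt ramp_score ramp_length^-1 v w)%:E))%E].
Proof.
have [_ [N1 [mN1 N10 N1P]] [N2 [mN2 N20 N2P]] _] := hW.
pose N := N1 `|` N2.
have mN : measurable N by exact: measurableU.
have N0 : P N = 0 by rewrite measureU0.
have good w : ~ N w -> W 0 w = 0 /\ {within `[0, t], continuous (W ^~ w)}.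
  move=> Nw; have W0 : W 0 w = 0 by apply: contrapT => h; apply: Nw; left; exact: N1P.
  split=> //; have : {within `[0, +oo[, continuous (W ^~ w)}.
    by apply: contrapT => h; apply: Nw; right; exact: N2P.
  by apply: continuous_subspaceW => s /=; rewrite !in_itv/= andbT => /andP[].
pose xi w := if w \in N then 0 else S (fun s => A *m cut t (W ^~ w) s).
pose xi_ k w := step_functional (q * k.+1) (W ^~ w).
have xi_cvg w : ~ N w -> xi_ k w @[k --> \oo] --> xi w.
  move=> Nw; have [W0 cW] := good w Nw.
  by rewrite /xi memNset//; exact: step_functional_cvg.
have mxi_ k i : measurable_fun setT (fun w => xi_ k w i ord0).
  exact: measurable_step_functional.
have mxi i : measurable_fun setT (fun w => xi w i ord0).
  pose h k w := \1_(~` N) w * xi_ k w i ord0.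
  apply: (measurable_fun_cvg (h := h)) => //.
    move=> k; apply: measurable_funM => //; apply: measurable_indic.
    exact: measurableC.
  move=> w _; rewrite /h indicE in_setC.
  have [wN|/negP wN] := boolP (w \in N).
    under eq_fun do rewrite mul0r; rewrite /xi wN mxE; exact: cvg_cst.
  under eq_fun do rewrite mul1r.
  have Nw : ~ N w by move=> h'; apply: wN; exact/mem_set.
  exact: (cvg_comp _ _ (xi_cvg w Nw) (@coord_continuous _ _ _ i ord0 (xi w))).
exists xi; split=> //.
  exists N; split=> // w; apply: contra_notP => Nw; have [_ cW] := good w Nw.
  by split=> //; rewrite /xi memNset.
move=> v G mG G0.
have mscore := measurable_ramp_score.
have mtilt := measurable_tilt ramp_length^-1 mscore v.
have step := fun k g (cg : continuous g) g01 => @step_quasi_invariant k v g cg g01.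
have itilt : P.-integrable setT (EFin \o tilt ramp_score ramp_length^-1 v).
  apply/integrableP; split; first exact/measurable_EFinP.
  under eq_integral do rewrite /= ger0_norm ?expR_ge0//.
  have c1 : continuous (cst 1 : V -> R) by move=> u; exact: cst_continuous.
  have b1 (u : V) : 0 <= (cst 1 u : R) <= 1 by rewrite /= ler01 lexx.
  rewrite (eq_integral (fun w => (cst 1 (xi_ 0%N w) * tilt ramp_score ramp_length^-1 v w)%:E)).
    by rewrite -(step 0%N _ c1 b1)/= integral_cst// mul1e (le_lt_trans (probability_le1 P measurableT))// ltry.
  by move=> w _; rewrite /= mul1r.
apply: (@quasi_invariance_limit _ _ _ _ P xi_ xi
  (fun k => step_functional (q * k.+1) (ramp_path v))) => //.
- by exists N; split=> // w; apply: contra_notP; exact: xi_cvg.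
- rewrite ramp_responseE; apply: step_functional_cvg.
    exact: continuous_ramp_path.
  by rewrite /ramp_path ramp_early ?scale0r// ramp_start_ge0.
- by move=> w; exact: expR_ge0.
Qed.

End CameronMartin.

(** * Right-continuity, vanishing masses, quadratic remainders *)

Section RightContinuousMeasurable.
Context {R : realType}.

(** A right-continuous function is the limit of its values at the next point
    of a grid. *)
Lemma right_continuous_measurable (g : R -> R) :
  (forall s, g r @[r --> s^'+] --> g s) -> measurable_fun setT (g : measurableTypeR R -> R).
Proof.
move=> cg.
pose h k (s : measurableTypeR R) := g ((Num.floor (s * k.+1%:R) + 1)%:~R / k.+1%:R).
apply: (measurable_fun_cvg (h := h)) => //.
  move=> k _ B mB; rewrite setTI.
  have k0 : (0 : R) < k.+1%:R by rewrite ltr0n.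
  rewrite (_ : _ @^-1` B = \bigcup_i (if unpickle i is Some z then
      if `[< B (g ((z + 1)%:~R / k.+1%:R)) >]
      then [set` `[z%:~R / k.+1%:R, (z + 1)%:~R / k.+1%:R[] else set0 else set0)).
    apply: (@bigcupT_measurable _ (measurableTypeR R)) => i.
    by case: unpickle => // z; case: ifP.
  apply/seteqP; split=> [s /= Bs|s [i _]].
    exists (pickle (Num.floor (s * k.+1%:R))) => //; rewrite pickleK.
    case: asboolP => //= _; rewrite in_itv/= ler_pdivrMr// ltr_pdivlMr//.
    by rewrite floor_le/= floorD1_gt.
  case: unpickle => // z; case: asboolP => // Bz.
  rewrite /= in_itv/= ler_pdivrMr// ltr_pdivlMr// => sz.
  by rewrite /h (floor_def sz).
move=> s _; move/cvg_at_rightP : (cg s); apply; split=> [k|].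
  by rewrite ltr_pdivlMr ?ltr0n// floorD1_gt.
apply: (@squeeze_cvgr _ _ _ _ (cst s) (fun k => s + k.+1%:R^-1)).
- apply: nearW => k /=; have k0 : (0 : R) < k.+1%:R by rewrite ltr0n.
  rewrite ltW ?ltr_pdivlMr// ?floorD1_gt//= ler_pdivrMr// mulrDl mulVf ?gt_eqF//.
  by rewrite intrD lerD2r floor_le.
- exact: cvg_cst.
- rewrite -[X in _ --> X]addr0; apply: cvgD; first exact: cvg_cst.
  exact: cvg_harmonic.
Qed.

End RightContinuousMeasurable.

Section SmallCharge.
Context {R : realType} {n : nat}.
Local Notation V := 'cV[R]_n.

Lemma charge_mass_cvg0 (nu : {charge set (measurableTypeR R) -> \bar R})
    (F : nat -> set (measurableTypeR R)) :
  (forall k, measurable (F k)) -> nonincreasing_seq F -> \bigcap_k F k = set0 ->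
  charge_mass nu (F k) @[k --> \oo] --> 0.
Proof.
move=> mF nF F0.
have fin0 (m : {finite_measure set (measurableTypeR R) -> \bar R}) :
    fine (m (F k)) @[k --> \oo] --> 0.
  have : m (F k) @[k --> \oo] --> m (\bigcap_k F k).
    apply: nonincreasing_cvg_mu => //; first by rewrite ltey_eq fin_num_measure.
    by rewrite F0.
  by rewrite F0 measure0; exact: fine_cvg.
by rewrite -[X in _ --> X]addr0; apply: cvgD; exact: fin0.
Qed.

Lemma delay_mass_cvg0 (m : @mx_charge R n) (F : nat -> set (measurableTypeR R)) :
  (forall k, measurable (F k)) -> nonincreasing_seq F -> \bigcap_k F k = set0 ->
  delay_mass m (F k) @[k --> \oo] --> 0.
Proof.
move=> mF nF F0; rewrite /delay_mass.
rewrite -[X in _ --> X](_ : \sum_(i < n) \sum_(j < n) 0 = 0); last first.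
  by rewrite big1// => i _; rewrite big1.
have cvg_sum (f : 'I_n -> nat -> R) (l : 'I_n -> R) :
    (forall i, f i k @[k --> \oo] --> l i) ->
    \sum_i f i k @[k --> \oo] --> \sum_(i < n) l i.
  by move=> fl; apply: cvg_big; [exact: add_continuous|move=> i _; exact: fl].
apply: (cvg_sum (fun i k => \sum_j charge_mass (m i j) (F k))) => i.
apply: (cvg_sum (fun j k => charge_mass (m i j) (F k))) => j.
exact: charge_mass_cvg0.
Qed.

Lemma mx_integral_subset (m : @mx_charge R n) (A A' : set R) (g : R -> V) :
  A' `<=` A -> (forall r, A r -> ~ A' r -> g r = 0) ->
  mx_integral m A g = mx_integral m A' g.
Proof.
move=> AA' g0; apply/colP => i; rewrite !mxE; apply: eq_bigr => j _.
have int (mm : {finite_measure set (measurableTypeR R) -> \bar R}) :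
    \int[mm]_(s in A) g s j ord0 = \int[mm]_(s in A') g s j ord0.
  rewrite Rintegral_mkcond [RHS]Rintegral_mkcond; congr (Rintegral mm setT _).
  apply/funext => s; rewrite !patchE.
  have [sA'|sA'] := pselect (A' s); first by rewrite !mem_set//; exact: AA'.
  rewrite [s \in A']memNset//; case: ifP => // /set_mem sA.
  by rewrite g0// mxE.
by rewrite !charge_integralE !int.
Qed.

End SmallCharge.

Section Differentiability.
Context {R : realType} {X : normedModType R}.

(** The bound on [D] gives its continuity, which is part of
    differentiability in infinite dimension. *)
Lemma differentiable_quadratic (f D : X -> R^o) (x : X) (K K' : R) : linear D ->
  (forall h, `|D h| <= K' * `|h|) ->
  (forall h, `|f (x + h) - f x - D h| <= K * `|h| ^+ 2) ->
  differentiable f x /\ 'd f x = D :> (X -> R^o).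
Proof.
move=> linD DK fK.
pose L : {linear X -> R^o} := HB.pack D (GRing.isLinear.Build R X R^o _ D linD).
have cD : continuous L.
  apply/linear_bounded_continuous/bounded_funP => r.
  exists (`|K'| * `|r|) => h hr; rewrite (le_trans (DK h))//.
  rewrite (le_trans (ler_wpM2r _ (ler_norm K')))// ler_wpM2l//.
  by rewrite (le_trans hr)// ler_norm.
have fE : f \o shift x = cst (f x) + L +o_ 0 id.
  apply/eqaddoP => _/posnumP[e].
  near=> h; change (`|f (h + x) - (f x + D h)| <= e%:num * `|h|).
  rewrite [h + x]addrC opprD addrA.
  rewrite (le_trans (fK h))// expr2 mulrA ler_wpM2r//.
  rewrite (le_trans (ler_wpM2r _ (ler_norm K)))//.
  have : `|h| <= e%:num / (`|K| + 1).
    near: h; apply/nbhs_ballP; exists (e%:num / (`|K| + 1)) => /=.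
      by rewrite divr_gt0// ltr_wpDl.
    by move=> h; rewrite -ball_normE/= sub0r normrN => /ltW.
  rewrite ler_pdivlMr ?ltr_wpDl// mulrDr mulr1 mulrC; apply: le_trans.
  by rewrite lerDl.
have dE := diff_unique cD fE.
by split=> //; apply/diff_locallyP; rewrite dE.
Unshelve. all: by end_near. Qed.

End Differentiability.

(** * Segments of solutions as states *)

Section EuclideanMaxNorm.
Context {R : realType} {n : nat}.
Implicit Types u : 'cV[R]_n.

Lemma norm_le_enorm u : `|u| <= enorm u.
Proof.
apply: norm_le_coord => [|i]; first exact: enorm_ge0.
rewrite -sqrtr_sqr /enorm ler_wsqrtr// (bigD1 i)//= lerDl.
by apply: sumr_ge0 => j _; exact: sqr_ge0.
Qed.

Lemma enorm_le_norm u : enorm u <= Num.sqrt n%:R * `|u|.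
Proof.
rewrite -[X in _ * X]ger0_norm// -sqrtr_sqr -sqrtrM// /enorm ler_wsqrtr//.
apply: (@le_trans _ _ (\sum_(i < n) `|u| ^+ 2)).
  by apply: ler_sum => i _; rewrite -real_normK ?num_real// lerXn2r ?nnegrE// le_coord_norm.
by rewrite sumr_const card_ord mulr_natl.
Qed.

End EuclideanMaxNorm.

Section OneSidedLimits.
Context {R : realType} {V : normedModType R}.
Implicit Types f g : R -> V.

Lemma cvg_right_shift f (t s : R) (l : V) :
  f u @[u --> (t + s)^'+] --> l -> f (t + r) @[r --> s^'+] --> l.
Proof.
move=> /cvgrPdist_lt fl; apply/cvgrPdist_lt => e /fl.
move=> /nbhs_ballP[a /= a0 fa]; apply/nbhs_ballP; exists a => //= r.
rewrite -ball_normE/= => sr lsr; apply: fa; last by rewrite ltrD2l.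
by rewrite -ball_normE/= opprD addrACA subrr add0r.
Qed.

Lemma cvg_left_shift f (t s : R) (l : V) :
  f u @[u --> (t + s)^'-] --> l -> f (t + r) @[r --> s^'-] --> l.
Proof.
move=> /cvgrPdist_lt fl; apply/cvgrPdist_lt => e /fl.
move=> /nbhs_ballP[a /= a0 fa]; apply/nbhs_ballP; exists a => //= r.
rewrite -ball_normE/= => sr lsr; apply: fa; last by rewrite ltrD2l.
by rewrite -ball_normE/= opprD addrACA subrr add0r.
Qed.

Lemma cvg_right_eq f g (s b : R) (l : V) : s < b ->
  (forall u, s < u < b -> f u = g u) ->
  f u @[u --> s^'+] --> l -> g u @[u --> s^'+] --> l.
Proof.
move=> sb fg; apply: cvg_trans; apply: near_eq_cvg; near=> u.
by apply: fg; apply/andP; split; near: u; [exact: nbhs_right_gt|exact: nbhs_right_lt].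
Unshelve. all: by end_near. Qed.

Lemma cvg_left_eq f g (s b : R) (l : V) : b < s ->
  (forall u, b < u < s -> f u = g u) ->
  f u @[u --> s^'-] --> l -> g u @[u --> s^'-] --> l.
Proof.
move=> sb fg; apply: cvg_trans; apply: near_eq_cvg; near=> u.
by apply: fg; apply/andP; split; near: u; [exact: nbhs_left_gt|exact: nbhs_left_lt].
Unshelve. all: by end_near. Qed.

Lemma segment_right_continuous f (T u : R) : {within `[0, T], continuous f} ->
  0 <= u < T -> f r @[r --> u^'+] --> f u.
Proof.
move=> /subspace_continuousP cf /andP[u0 uT].
have /cvgrPdist_lt fu : f @ within `[0, T]%classic (nbhs u) --> f u.
  by apply: cf; rewrite /= in_itv/= u0 ltW.
apply/cvgrPdist_lt => e /fu; rewrite near_withinE => fe.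
near=> r; have : r \in `[0, T].
  rewrite in_itv/=; apply/andP; split; last by near: r; exact: nbhs_right_le.
  by apply: (le_trans u0); near: r; exact: nbhs_right_ge.
by near: r; exact: cvg_at_right_filter fe.
Unshelve. all: by end_near. Qed.

Lemma segment_left_continuous f (T u : R) : {within `[0, T], continuous f} ->
  0 < u <= T -> f r @[r --> u^'-] --> f u.
Proof.
move=> /subspace_continuousP cf /andP[u0 uT].
have /cvgrPdist_lt fu : f @ within `[0, T]%classic (nbhs u) --> f u.
  by apply: cf; rewrite /= in_itv/= uT ltW.
apply/cvgrPdist_lt => e /fu; rewrite near_withinE => fe.
near=> r; have : r \in `[0, T].
  rewrite in_itv/=; apply/andP; split; first by near: r; exact: nbhs_left_ge.
  by apply: le_trans uT; near: r; exact: nbhs_left_le.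
by near: r; exact: cvg_at_left_filter fe.
Unshelve. all: by end_near. Qed.

End OneSidedLimits.

Section Segments.
Context {R : realType} {n : nat} (d : R).
Local Notation V := 'cV[R]_n.

Lemma past_le_norm (x : state R n d) s : `|past x s| <= `|x|.
Proof.
apply: (le_trans (norm_le_enorm _)); apply: (le_trans (le_past_norm x s)).
by rewrite [leRHS]/Num.norm/= /state_norm lerDr enorm_ge0.
Qed.

Lemma present_le_norm (x : state R n d) : `|present x| <= `|x|.
Proof.
apply: (le_trans (norm_le_enorm _)).
by rewrite [leRHS]/Num.norm/= /state_norm lerDl past_norm_ge0.
Qed.

Lemma past_right_continuous (x : state R n d) s :
  past x r @[r --> s^'+] --> past x s.
Proof.
have [xout _ xr _] := pastP x.
have [s1|s1] := ltP s (- d).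
  apply: (@cvg_right_eq _ _ (cst (past x s)) _ s (- d)) => //; last exact: cvg_cst.
  by move=> u /andP[_ ud]; rewrite /= !xout// => -/andP[]; rewrite leNgt ?s1 ?ud.
have [s2|s2] := ltP s 0; first by apply: xr; rewrite s1.
apply: (@cvg_right_eq _ _ (cst (past x s)) _ s (s + 1)); first by rewrite ltrDl.
  move=> u /andP[su _]; rewrite /= !xout// => -/andP[_]; rewrite ltNge ?s2//.
  by rewrite (le_trans s2)// ltW.
exact: cvg_cst.
Qed.

Lemma bounded_path_past (x : state R n d) : bounded_path (past x).
Proof.
split; last by exists `|x| => s; exact: past_le_norm.
move=> i; apply: (@right_continuous_measurable _ (fun s => past x s i ord0)) => s.
by apply: (cvg_comp (past x) (fun z : V => z i ord0));
  [exact: past_right_continuous|exact: coord_continuous].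
Qed.

(** Besides the jumps of the initial past, the segment may jump where that past
    meets the solution, and there each of the two supplies its own one-sided
    limit. *)
Lemma segment_state (x : state R n d) (T t : R) (f : R -> V) : 0 < t <= T ->
  (forall s, - d <= s < 0 -> f s = past x s) -> {within `[0, T], continuous f} ->
  segment d t f \in @state_pred R n d.
Proof.
move=> /andP[t0 tT] fx cf; have [xout _ xr xl] := pastP x.
apply/asboolP; split=> /=.
- by move=> s; case: ifP.
- have [_ [M fM]] := bounded_path_cut cf.
  exists (Num.max (past_norm x) (Num.sqrt n%:R * M)) => s sd; rewrite sd le_max.
  have /andP[s1 s2] := sd; have [ts|ts] := ltP (t + s) 0.
    have tsd : - d <= t + s by rewrite (le_trans s1)// lerDr ltW.
    by rewrite fx ?tsd// le_past_norm.
  have := fM (t + s); rewrite /cut ts/= (_ : t + s <= T); last first.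
    by rewrite (le_trans _ tT)// gerDl ltW.
  move=> h; apply/orP; right; apply: (le_trans (enorm_le_norm _)).
  by rewrite ler_wpM2l.
- move=> s sd; rewrite sd; have /andP[s1 s2] := sd.
  apply: (@cvg_right_eq _ _ (fun r => f (t + r)) _ s 0) => //.
    by move=> u /andP[su ->]; rewrite (le_trans s1 (ltW su)).
  apply: (@cvg_right_shift _ _ f); have tsT : t + s < T.
    by rewrite (lt_le_trans _ tT)// gtrDl.
  have [ts|ts] := ltP (t + s) 0; last by apply: (segment_right_continuous cf); rewrite ts.
  have tsd : - d <= t + s by rewrite (le_trans s1)// lerDr ltW.
  rewrite fx ?tsd//; apply: (@cvg_right_eq _ _ (past x) f (t + s) 0 (past x (t + s))) => //.
    by move=> u /andP[su u0]; rewrite fx// u0 (le_trans tsd (ltW su)).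
  exact: past_right_continuous.
- move=> s /andP[s1 s2].
  suff [l fl] : exists l : V, f u @[u --> (t + s)^'-] --> l.
    exists l; apply: (@cvg_left_eq _ _ (fun r => f (t + r)) _ s (- d)) => //.
      by move=> u /andP[du us]; rewrite (ltW du) (lt_le_trans us).
    exact: cvg_left_shift.
  have [ts|ts] := leP (t + s) 0; last first.
    exists (f (t + s)); apply: (segment_left_continuous cf).
    by rewrite ts (le_trans _ tT)// gerDl.
  have tsd : - d < t + s by rewrite (lt_trans s1)// ltrDr.
  have [|l xll] := xl (t + s); first by rewrite tsd ts.
  exists l; apply: (@cvg_left_eq _ _ (past x) _ _ (- d)) => //.
  by move=> u /andP[du us]; rewrite fx// (ltW du) (lt_le_trans us).
Qed.

End Segments.

(** * Decomposition into drift and noise *)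

Section Decomposition.
Context {R : realType} {n : nat} (d : R).
Local Notation V := 'cV[R]_n.

Lemma eq_mx_integral (m : @mx_charge R n) (A : set (measurableTypeR R)) (g g' : R -> V) :
  (forall r, A r -> g r = g' r) -> mx_integral m A g = mx_integral m A g'.
Proof.
move=> gg; apply/colP => i; rewrite !mxE; apply: eq_bigr => j _.
by apply: eq_charge_integral => r Ar; rewrite gg.
Qed.

Lemma pastD (x z : state R n d) s : past (x + z) s = past x s + past z s.
Proof. by rewrite /past raddfD. Qed.

Lemma pastZ (c : R) (x : state R n d) s : past (c *: x) s = c *: past x s.
Proof. by rewrite /past linearZ. Qed.

Lemma presentD (x z : state R n d) : present (x + z) = present x + present z.
Proof. by rewrite /present raddfD. Qed.

Lemma presentZ (c : R) (x : state R n d) : present (c *: x) = c *: present x.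
Proof. by rewrite /present linearZ. Qed.

Variables (K : R) (H : (R -> V) -> R -> V) (causalH : causal_operator K H).
Variables (L : R) (Q : (R -> V) -> R -> V) (causalQ : causal_operator L Q).
Variables (t : R) (t_gt0 : 0 < t).

Let t0 : 0 <= t := ltW t_gt0.

(** The contribution of the initial state to the equation for the path on the
    time interval: its present value and the delayed effect of its past. *)
Definition initial_forcing (x : state R n d) (s : R) : V :=
  cut t (fun=> present x) s + volterra H t (past x) s.

Lemma bounded_path_initial_forcing x : bounded_path (initial_forcing x).
Proof.
apply: bounded_pathD.
  by apply: bounded_path_cut; apply: continuous_subspaceT => s; exact: cvg_cst.
exact: (bounded_path_volterra causalH t0 (bounded_path_past x)).
Qed.

Lemma initial_forcing_supported x : supported t (initial_forcing x).
Proof.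
by move=> s st; rewrite /initial_forcing cut_supported// (volterra_supported H _ st) addr0.
Qed.

(** The observation at time [t] of the solution without noise. *)
Definition drift (x : state R n d) : V :=
  Q (past x) t + response H Q t (initial_forcing x).

Lemma driftD x z : drift (x + z) = drift x + drift z.
Proof.
have bx := bounded_path_past x; have bz := bounded_path_past z.
rewrite /drift (funext (pastD x z)) (causalD causalQ)//.
rewrite (_ : initial_forcing (x + z) = (fun s => initial_forcing x s + initial_forcing z s)).
  rewrite (responseD causalH causalQ)//; first exact: addrACA.
  - exact: bounded_path_initial_forcing.
  - exact: initial_forcing_supported.
  - exact: bounded_path_initial_forcing.
  - exact: initial_forcing_supported.
apply/funext => s; rewrite /initial_forcing (funext (pastD x z)) (volterraD causalH)//.
by rewrite addrACA; congr (_ + _); rewrite /cut presentD; case: ifP; rewrite ?addr0.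
Qed.

Lemma driftZ c x : drift (c *: x) = c *: drift x.
Proof.
have bx := bounded_path_past x.
rewrite /drift (funext (pastZ c x)) (causalZ causalQ)//.
rewrite (_ : initial_forcing (c *: x) = (fun s => c *: initial_forcing x s)).
  rewrite (responseZ causalH causalQ)//; first by rewrite scalerDr.
  - exact: bounded_path_initial_forcing.
  - exact: initial_forcing_supported.
apply/funext => s; rewrite /initial_forcing (funext (pastZ c x)) (volterraZ causalH)//.
by rewrite scalerDr; congr (_ + _); rewrite /cut presentZ; case: ifP; rewrite ?scaler0.
Qed.

Lemma drift_le x : `|drift x| <= (L + response_mass K L t * (1 + K * t)) * `|x|.
Proof.
have bx := bounded_path_past x.
rewrite (le_trans (ler_normD _ _))// mulrDl lerD//.
  by apply: (causal_le causalQ) => // s _; exact: past_le_norm.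
rewrite -mulrA; apply: (response_le causalH causalQ t0).
- exact: bounded_path_initial_forcing.
- exact: initial_forcing_supported.
move=> s; rewrite (le_trans (ler_normD _ _))// mulrDl mul1r lerD//.
  by rewrite /cut; case: ifP => _; rewrite ?normr0// present_le_norm.
rewrite mulrAC; apply: (volterra_sup causalH t0 s bx) => u.
exact: past_le_norm.
Qed.

(** By linearity the response to the sum of the two forcings splits. *)
Lemma solution_observation (x : state R n d) (f w : R -> V) (A : 'M[R]_n) :
  {within `[0, t], continuous f} -> {within `[0, t], continuous w} ->
  (forall s, 0 <= s <= t -> f s = present x +
     volterra H t (fun u => past x u + cut t f u) s + A *m w s) ->
  Q (fun u => past x u + cut t f u) t =
    drift x + response H Q t (fun s => A *m cut t w s).
Proof.
move=> cf cw fE.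
have bx := bounded_path_past x; have bf := bounded_path_cut cf.
have bw := bounded_path_mulmx A (bounded_path_cut cw).
have sw : supported t (fun s => A *m cut t w s).
  by move=> s st; rewrite cut_supported// mulmx0.
have bi := bounded_path_initial_forcing x.
have si := initial_forcing_supported x.
rewrite (causalD causalQ)// /drift -addrA; congr (_ + _).
rewrite -(responseD causalH causalQ)//.
apply/esym; apply: (response_solution causalH causalQ t0) => //.
- exact: bounded_pathD.
- by move=> s st; rewrite si// sw// addr0.
- exact: cut_supported.
move=> s; have [st|st] := boolP (0 <= s <= t); last first.
  by rewrite cut_supported// si// sw// (volterra_supported H _ st) !addr0.
rewrite {1}/cut st fE// (volterraD causalH)// /initial_forcing /cut st.
by rewrite -!addrA; congr (_ + (_ + _)); rewrite addrC.
Qed.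

End Decomposition.

Section Observation.
Context {R : realType} {n : nat} (d : R).
Local Notation V := 'cV[R]_n.
Hypothesis d_gt0 : 0 < d.
Variables (T t : R) (t_gt0 : 0 < t) (tT : t <= T).
Variables (a0 sigma : 'M[R]_n) (a1 mu : @mx_charge R n).

Local Notation H := (delay_operator a0 a1 `[- d, 0]).
Local Notation Q := (delay_operator (mx_atom mu 0) (drop_atom0 mu) `[- d, 0[).

Lemma delay_map_solution K L (x : state R n d) (y : R -> V) (w : R -> V) :
  causal_operator K H -> causal_operator L Q ->
  (forall s, - d <= s < 0 -> y s = past x s) ->
  {within `[0, T], continuous y} -> {within `[0, t], continuous w} ->
  (forall s, 0 <= s <= T -> y s = present x
     + \col_i \int[lebesgue_measure]_(u in `[0, s])
         (a0 *m y u + mx_integral a1 `[- d, 0] (fun r => y (u + r))) i ord0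
     + sigma *m w s) ->
  delay_map mu (insubd 0 (segment d t y) : state R n d) =
    drift H Q t x + response H Q t (fun s => sigma *m cut t w s).
Proof.
move=> causalH causalQ yx cy cw yE.
have cyt : {within `[0, t], continuous y}.
  by apply: continuous_subspaceW cy; apply: subset_itvl; rewrite bnd_simp.
have yst : segment d t y \in @state_pred R n d.
  by apply: (segment_state (x := x) _ yx cy); rewrite t_gt0.
have ysplit u : - d <= u <= t -> y u = past x u + cut t y u.
  move=> /andP[du ut]; have [u0|u0] := ltP u 0.
    by rewrite cut_supported ?addr0 ?yx ?du// [0 <= u]leNgt u0.
  by rewrite /cut u0 ut past_out ?add0r// => /andP[_]; rewrite ltNge u0.
rewrite -(solution_observation causalH causalQ t_gt0 (f := y) (w := w))//; last first.
  move=> s st; have /andP[s0 s1] := st.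
  rewrite yE; last by rewrite s0 (le_trans s1 tT).
  suff -> : volterra H t (fun u => past x u + cut t y u) s =
    \col_i \int[lebesgue_measure]_(u in `[0, s])
      (a0 *m y u + mx_integral a1 `[- d, 0] (fun r => y (u + r))) i ord0 by [].
  rewrite /volterra st; apply/colP => i; rewrite [LHS]mxE [RHS]mxE.
  apply: eq_Rintegral => u; rewrite inE/= in_itv/= => /andP[u0 us].
  have ut : u <= t by exact: le_trans s1.
  have yu : past x u + cut t y u = y u.
    by apply/esym/ysplit; rewrite ut andbT (le_trans _ u0)// oppr_le0 ltW.
  suff -> : delay_operator a0 a1 `[- d, 0] (fun u => past x u + cut t y u) u =
    a0 *m y u + mx_integral a1 `[- d, 0] (fun r => y (u + r)) by [].
  rewrite /delay_operator yu; congr +%R; apply: eq_mx_integral => r.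
  rewrite /= in_itv/= => /andP[dr r0]; apply/esym/ysplit.
  by rewrite (le_trans _ ut) ?gerDl// andbT (le_trans dr)// lerDr.
rewrite /delay_map /delay_operator /present /past insubdK//=.
congr (_ *m _ + _).
  by apply: ysplit; rewrite lexx andbT (le_trans _ (ltW t_gt0))// oppr_le0 ltW.
apply: eq_mx_integral => r; rewrite /= in_itv/= => rd; rewrite rd.
have /andP[dr r0] := rd; apply: ysplit.
by rewrite gerDl (ltW r0) andbT (le_trans dr)// lerDr ltW.
Qed.

End Observation.

(** * Nondegeneracy of the ramp response *)

Section RampResponse.
Context {R : realType} {n : nat} (d T : R).
Local Notation V := 'cV[R]_n.
Hypotheses (d_gt0 : 0 < d) (T_gt0 : 0 < T).
Variables (K : R) (H : (R -> V) -> R -> V) (causalH : causal_operator K H).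
Variables (alpha0 sigma : 'M[R]_n) (m : @mx_charge R n).

Local Notation Q := (delay_operator alpha0 m `[- d, 0[).
Variables (L : R) (causalQ : causal_operator L Q).

Lemma injective_unitmx (B : 'M[R]_n) : (forall v : V, B *m v = 0 -> v = 0) ->
  B \in unitmx.
Proof.
move=> inj; rewrite -unitmx_tr -row_free_unit -kermx_eq0; apply/eqP/row_matrixP => i.
rewrite row0; apply: trmx_inj; rewrite trmx0; apply: inj.
have /(congr1 (row i)) := mulmx_ker B^T; rewrite row_mul row0 => ker0.
by rewrite -[LHS]trmxK trmx_mul trmxK ker0 trmx0.
Qed.

Lemma bounded_functional_response t : 0 < t ->
  bounded_functional t (response_mass K L t) (response H Q t).
Proof.
move=> t_gt0; have t0 := ltW t_gt0; split.
- exact: (response_mass_ge0 K causalQ).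
- by move=> f g *; exact: (responseD causalH causalQ).
- by move=> a f *; exact: (responseZ causalH causalQ).
- by move=> f M *; exact: (response_le causalH causalQ).
Qed.

(** Over a short time window the solution driven by the ramp has no time to
    feel the drift, and the window is seen only by the part of the measure
    [m] on [near0], a family of sets that decreases to the empty set because
    the delay [0] is excluded. The bound depends on [t] through [T] only. *)
Lemma ramp_response_close (e : R) : 0 < e -> exists q : nat, forall (t : R) (v : V),
  0 < t <= T ->
  `|ramp_response t (response H Q t) sigma q *m v - (alpha0 *m sigma) *m v| <= e * `|v|.
Proof.
move=> e0; set Ks := \sum_i \sum_j `|sigma i j|.
have Ks0 : 0 <= Ks by apply: sumr_ge0 => i _; exact: sumr_ge0.
have K0 := causal_ge0 causalH; have L0 := causal_ge0 causalQ.
(* For [t <= T] the ramp window is at most [T / k.+1] long; only delays in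
   [near0 k] can reach into it from time [t]. *)
pose near0 k : set (measurableTypeR R) := `[- d, 0[ `&` `[- (T / k.+1%:R), 0[.
have mass0 : delay_mass m (near0 k) @[k --> \oo] --> 0.
  apply: delay_mass_cvg0.
  - by move=> k; apply: measurableI; exact: measurable_itv.
  - move=> k l kl; apply/subsetPset => r [/= rd]; rewrite !in_itv/= => /andP[r1 r2].
    split=> //; rewrite /= in_itv/= r2 andbT (le_trans _ r1)// lerN2.
    by rewrite ler_wpM2l ?(ltW T_gt0)// lef_pV2 ?posrE ?ltr0n// ler_nat.
  - rewrite -subset0 => r rF; have [_] := rF 0%N I; rewrite /= in_itv/= => /andP[_ r0].
    have Tr : 0 < - r by rewrite oppr_gt0.
    have [k _ /(_ k (leqnn k))/= kr] := @nbhs_infty_gtr R (T / - r).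
    have [_] := rF k I; rewrite /= in_itv/= => /andP[+ _].
    apply/negP; rewrite -ltNge ltrNr ltr_pdivrMr// mulrC -ltr_pdivrMr//.
    by rewrite (lt_trans kr)// ltr_nat.
set c := response_mass K L T * K * Ks.
have c0 : 0 <= c by rewrite !mulr_ge0// (response_mass_ge0 K causalQ).
have err0 : c * T * k.+1%:R^-1 + delay_mass m (near0 k) * Ks @[k --> \oo] --> 0.
  rewrite -[X in _ --> X]addr0; apply: cvgD.
    rewrite -[X in _ --> X](mulr0 (c * T)); apply: cvgM; first exact: cvg_cst.
    exact: cvg_harmonic.
  by rewrite -[X in _ --> X](mul0r Ks); apply: cvgM => //; exact: cvg_cst.
have [q _ /(_ q (leqnn q))/=] : \forall k \near \oo,
    `|0 - (c * T * k.+1%:R^-1 + delay_mass m (near0 k) * Ks)| <= e.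
  by move/cvgrPdist_le : err0; apply.
rewrite sub0r normrN => qe.
exists q => t v /andP[t_gt0 tT].
have {}qe : c * T * q.+1%:R^-1 + delay_mass m (near0 q) * Ks <= e.
  by rewrite (le_trans (ler_norm _)).
have t0 := ltW t_gt0.
rewrite (ramp_responseE (bounded_functional_response t_gt0)).
set f := fun s => sigma *m cut t (ramp_path t q v) s.
have bf : bounded_path f.
  by apply: bounded_path_mulmx; apply: bounded_path_cut; exact: continuous_ramp_path.
have sf : supported t f by move=> s st; rewrite /f cut_supported// mulmx0.
have fM s : `|f s| <= Ks * `|v|.
  rewrite (le_trans (norm_mulmx_le _ _))// ler_wpM2l// /cut.
  case: ifP => [/andP[_ st]|_]; last by rewrite normr0.
  have /andP[r0 r1] := ramp_bounds t_gt0 q st.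
  by rewrite /ramp_path normrZ ger0_norm// ler_piMl.
have fearly s : s < ramp_start t q -> f s = 0.
  move=> sa; rewrite /f /cut; case: ifP => _; last by rewrite mulmx0.
  by rewrite /ramp_path ramp_early ?scale0r ?mulmx0// ltW.
have ft : f t = sigma *m v.
  by rewrite /f /cut t0 lexx/= /ramp_path ramp_end// scale1r.
have len : t - ramp_start t q = t / q.+1%:R.
  by rewrite -{1}(ramp_start_length t q) addrC addKr.
have lenT : t / q.+1%:R <= T / q.+1%:R by rewrite ler_wpM2r ?invr_ge0.
have a0 := ramp_start_ge0 t_gt0 q.
have at_ : ramp_start t q <= t by rewrite -subr_ge0 len divr_ge0.
have late : `|response H Q t f - Q f t| <= c * `|v| * (T / q.+1%:R).
  have := response_late causalH causalQ t0 bf sf (a := ramp_start t q) _ fearly fM.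
  rewrite a0 at_ len => /(_ isT)/le_trans; apply.
  have mt : response_mass K L t <= response_mass K L T.
    rewrite /response_mass ler_wpM2l// ler_wpM2l// ler_expR ler_wpM2l// ltW//.
    exact: (rate_gt0 causalH).
  have mt0 := response_mass_ge0 K causalQ t.
  have KK : 0 <= Ks * `|v| by exact: mulr_ge0.
  rewrite (_ : c * _ = response_mass K L T * K * (Ks * `|v|)); last by rewrite /c; ring.
  apply: ler_pM => //; rewrite ?divr_ge0 ?mulr_ge0//.
  by rewrite ler_wpM2r// ler_wpM2r.
have obs : `|Q f t - (alpha0 *m sigma) *m v| <= delay_mass m (near0 q) * (Ks * `|v|).
  rewrite /delay_operator ft mulmxA addrC addKr.
  rewrite (@mx_integral_subset _ _ m _ (near0 q)).
  - apply: mx_integral_le.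
    + by apply: measurableI; exact: measurable_itv.
    + exact: bounded_path_shift.
    + by rewrite mulr_ge0.
    + by move=> r _; exact: fM.
  - by move=> r [].
  - move=> r rd rF; apply: fearly; rewrite -ltrBrDl -opprB len ltrNr.
    apply: (le_lt_trans lenT); rewrite ltNge; apply/negP => h; apply: rF; split=> //.
    by move: rd; rewrite /= !in_itv/= => /andP[_ ->]; rewrite andbT lerNl.
rewrite -(subrKA (Q f t)) (le_trans (ler_normD _ _))//.
apply: (le_trans (lerD late obs)).
rewrite (_ : _ + _ = (c * T * q.+1%:R^-1 + delay_mass m (near0 q) * Ks) * `|v|).
  by rewrite ler_wpM2r.
by ring.
Qed.

End RampResponse.

(** * Differentiability of the transition semigroup *)

Section TransitionFormula.
Context {R : realType} {n : nat} (d T : R) disp (Omega : measurableType disp).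
Local Notation V := 'cV[R]_n.
Hypothesis d_gt0 : 0 < d.
Variables (P : probability Omega R) (completeP : measure_is_complete P).
Variables (W : R -> Omega -> V) (a0 sigma : 'M[R]_n) (a1 mu : @mx_charge R n).
Variables (y : state R n d -> R -> Omega -> V).
Hypothesis hy : forall x, delay_solution P T a0 sigma a1 W x (y x).

Local Notation H := (delay_operator a0 a1 `[- d, 0]).
Local Notation Q := (delay_operator (mx_atom mu 0) (drop_atom0 mu) `[- d, 0[).
Variables (K L : R) (causalH : causal_operator K H) (causalQ : causal_operator L Q).
Variables (t : R) (t_gt0 : 0 < t) (tT : t <= T).

(** The decomposition into drift and noise holds almost surely; since [P] is
    complete, this also makes the observed process measurable. *)
Lemma transition_regularised (xi : Omega -> V) (phibar : V -> R)
    (x : state R n d) :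
  (forall i, measurable_fun setT (fun w => xi w i ord0)) ->
  {ae P, forall w, {within `[0, t], continuous (W ^~ w)} /\
     xi w = response H Q t (fun s => sigma *m cut t (W ^~ w) s)} ->
  borel_vec_fun phibar ->
  transition P y t (phibar \o delay_map mu) x =
    regularised P xi phibar (drift H Q t x).
Proof.
move=> mxi xiE mphi.
have mg : measurable_fun setT (fun w => (phibar (drift H Q t x + xi w))%:E).
  apply/measurable_EFinP.
  have mX : measurable_fun setT
      ((fun w => drift H Q t x + xi w) : Omega -> g_sigma_algebraType (@open V)).
    by apply: measurable_vec => i; under eq_fun do rewrite mxE; exact: measurable_funD.
  exact: (measurableT_comp mphi mX).
have [_ ysol] := hy x.
have ae_eq_obs : ae_eq P setT (fun w => (phibar (drift H Q t x + xi w))%:E)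
    (fun w => ((phibar \o delay_map mu) (ou_process d (y x) t w))%:E).
  apply: filterS2 xiE ysol => w [cW ->] [yx _ cy yE] _; congr (phibar _)%:E.
  by apply/esym; exact: (delay_map_solution d_gt0 t_gt0 tT causalH causalQ yx cy cW yE).
rewrite /transition expectation.unlock /regularised /Rintegral; congr fine.
apply/esym; apply: ae_eq_integral => //.
exact: (ae_measurable_fun completeP ae_eq_obs mg).
Qed.

End TransitionFormula.

Lemma le_sup_norm (R : realType) (S : Type) (g : S -> R) :
  bounded_function g -> forall z, `|g z| <= sup_norm g.
Proof.
move=> [M gM] z; apply: ub_le_sup; last by exists z.
by exists M => _ [u _ <-].
Qed.

(** States with zero past suffice. A bound for [phibar \o delay_map mu] is
    thus a bound for [phibar]. *)
Lemma delay_map_surjective (R : realType) (n : nat) (d : R) (mu : @mx_charge R n)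
    (u : 'cV[R]_n) :
  mx_atom mu 0 \in unitmx -> exists x : state R n d, delay_map mu x = u.
Proof.
move=> mu0; pose z : 'cV[R]_n * (R -> 'cV[R]_n) := (invmx (mx_atom mu 0) *m u, fun=> 0).
have zst : z \in @state_pred R n d.
  apply/asboolP; split=> //=.
  - by exists 0 => s _; rewrite enorm0.
  - by move=> s _; exact: cvg_cst.
  - by move=> s _; exists 0; exact: cvg_cst.
exists (State zst); rewrite /delay_map /present /past/= mulKVmx//.
rewrite [X in _ + X](_ : _ = 0) ?addr0//.
apply/eqP; rewrite -normr_le0 -[leRHS](mulr0 (delay_mass (drop_atom0 mu) `[- d, 0[)).
apply: mx_integral_le => //.
- split=> [i|]; last by exists 0 => s; rewrite normr0.
  by under eq_fun do rewrite mxE; exact: measurable_cst.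
- by move=> r _; rewrite normr0.
Qed.

Theorem proposition2p6 (R : realType) (n : nat) (hn : (1 <= n)%N)
    (d T : R) (hd : 0 < d) (hT : 0 < T)
    (a0 sigma : 'M[R]_n)
    (a1 : @mx_charge R n) (ha1 : concentrated_on `[- d, 0] a1)
    (ha1_0 : mx_atom a1 0 = 0)
    (mu : @mx_charge R n) (hmu : concentrated_on `[- d, 0] mu)
    (disp : measure_display) (Omega : measurableType disp)
    (P : probability Omega R) (hP : measure_is_complete P)
    (W : R -> Omega -> 'cV[R]_n) (hW : standard_wiener P W)
    (y : state R n d -> R -> Omega -> 'cV[R]_n)
    (hy : forall x : state R n d, delay_solution P T a0 sigma a1 W x (y x))
    (hsigma : sigma \in unitmx) (hmu0 : mx_atom mu 0 \in unitmx) :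
  exists C : R, 0 < C /\
    forall phibar : 'cV[R]_n -> R,
      bounded_function phibar -> borel_vec_fun phibar ->
      let phi : state R n d -> R := phibar \o delay_map mu in
      (forall t : R, 0 < t <= T ->
        forall x : state R n d,
          differentiable (transition P y t phi : state R n d -> R^o) x) /\
      (forall (t : R) (x h : state R n d), 0 < t <= T ->
        `|'d (transition P y t phi : state R n d -> R^o) x h|
          <= C * (`|h| / Num.sqrt t) * sup_norm phi).
Proof.
pose alpha0 := mx_atom mu 0.
pose H := delay_operator a0 a1 `[- d, 0].
pose Q := delay_operator alpha0 (drop_atom0 mu) `[- d, 0[.
have [K causalH] : exists K, causal_operator K H.
  eexists; apply: causal_delay_operator; first exact: measurable_itv.
  by move=> r; rewrite /= in_itv/= => /andP[].
have [L causalQ] : exists L, causal_operator L Q.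
  eexists; apply: causal_delay_operator; first exact: measurable_itv.
  by move=> r; rewrite /= in_itv/= => /andP[_ /ltW].
have K0 := causal_ge0 causalH; have L0 := causal_ge0 causalQ.
have unit0 : alpha0 *m sigma \in unitmx by rewrite unitmx_mul hmu0 hsigma.
pose k0 := \sum_i \sum_j `|invmx (alpha0 *m sigma) i j|.
have k00 : 0 <= k0 by apply: sumr_ge0 => i _; exact: sumr_ge0.
have inv0 (v : 'cV[R]_n) : `|v| <= k0 * `|alpha0 *m sigma *m v|.
  by rewrite -{1}(mulKmx unit0 v) norm_mulmx_le.
(* A perturbation of [alpha0 *m sigma] of relative size [e] keeps at least half
   of the lower bound [inv0]. *)
pose e := (2 * (k0 + 1))^-1.
have e0 : 0 < e by rewrite invr_gt0 mulr_gt0// ltr_wpDl.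
have [q qe] := @ramp_response_close R n d T hT K H causalH alpha0 sigma
  (drop_atom0 mu) L causalQ e e0.
have lower t (v : 'cV[R]_n) : 0 < t <= T ->
    `|v| <= 2 * k0 * `|ramp_response t (response H Q t) sigma q *m v|.
  move=> tT; have := qe t v tT; set B := ramp_response _ _ _ _ => Be.
  have tri : `|alpha0 *m sigma *m v| <= `|B *m v| + e * `|v|.
    rewrite -[X in `|X|](subrK (B *m v)) addrC (le_trans (ler_normD _ _))// lerD2l.
    by rewrite distrC.
  have k0e : k0 * e <= 2^-1.
    by rewrite /e invfM mulrCA ler_piMr// ler_pdivrMr ?ltr_wpDl// mul1r lerDl.
  have step1 := le_trans (inv0 v) (ler_wpM2l k00 tri).
  have step2 : k0 * e * `|v| <= 2^-1 * `|v| by rewrite ler_wpM2r.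
  by rewrite mulrDr mulrA in step1; lra.
have Bunit t : 0 < t <= T -> ramp_response t (response H Q t) sigma q \in unitmx.
  move=> tT; apply: injective_unitmx => v Bv; apply/eqP; rewrite -normr_le0.
  by rewrite (le_trans (lower t v tT))// Bv normr0 mulr0.
pose c := L + response_mass K L T * (1 + K * T).
have mT0 := response_mass_ge0 K causalQ T.
have c0 : 0 <= c by rewrite addr_ge0// mulr_ge0// addr_ge0// mulr_ge0// ltW.
have drift_bound t (x : state R n d) : 0 < t <= T -> `|drift H Q t x| <= c * `|x|.
  move=> /andP[t0 tT]; apply: (le_trans (drift_le causalH causalQ t0 x)).
  rewrite ler_wpM2r// lerD2l ler_pM//.
  - exact: (response_mass_ge0 K causalQ).
  - by rewrite addr_ge0// mulr_ge0// ltW.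
  - rewrite /response_mass ler_wpM2l// ler_wpM2l// ler_expR ler_wpM2l// ltW//.
    exact: (rate_gt0 causalH).
  - by rewrite lerD2l ler_wpM2l.
(* [t / q.+1] is the length of the ramp, [2 * k0] bounds the inverse of the
   ramp response and [c] bounds the drift. *)
pose C0 := (2 + n%:R) * (Num.sqrt q.+1%:R * (2 * k0 * c)).
have C00 : 0 <= C0 by rewrite !mulr_ge0// addr_ge0.
(* The added [1] makes the constant positive in any case. *)
exists (C0 + 1); split; first by rewrite ltr_wpDl.
move=> phibar phib mphi phi.
have phi_bd : bounded_function phi by case: phib => M gM; exists M => x; exact: gM.
pose M := sup_norm phi.
have phiM u : `|phibar u| <= M.
  have [x <-] := delay_map_surjective d u hmu0.
  exact: (le_sup_norm phi_bd x).
have M0 : 0 <= M by rewrite (le_trans _ (phiM 0)).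
have main t x : 0 < t <= T ->
    exists2 D : state R n d -> R^o, differentiable (transition P y t phi : state R n d -> R^o) x /\
      'd (transition P y t phi : state R n d -> R^o) x = D :> (state R n d -> R^o) &
      forall h, `|D h| <= C0 * (`|h| / Num.sqrt t) * M.
  move=> tT; have /andP[t0 t_le] := tT.
  set S := response H Q t; set B := ramp_response t S sigma q.
  have [xi [mxi xiE quasi]] := wiener_quasi_invariant t0
    (bounded_functional_response causalH causalQ t0) sigma q hW.
  pose kappa := (ramp_length t q)^-1.
  have kappa_gt0 : 0 < kappa by rewrite invr_gt0 divr_gt0// ltr0n.
  have mscore := measurable_ramp_score t0 q hW.
  have tr z : transition P y t phi z = regularised P xi phibar (drift H Q t z).
    exact: (transition_regularised hd hP hy causalH causalQ t0 t_le).
  pose pull (h : state R n d) := invmx B *m drift H Q t h.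
  have Bpull h : B *m pull h = drift H Q t h by rewrite /pull mulKVmx// Bunit.
  have pull_le h : `|pull h| <= 2 * k0 * c * `|h|.
    rewrite (le_trans (lower t _ tT))// Bpull -[leRHS]mulrA ler_wpM2l ?mulr_ge0//.
    exact: drift_bound.
  pose D h := regularised_diff P xi (ramp_score t q W) phibar (drift H Q t x) (pull h).
  have linD : linear (D : state R n d -> R^o).
    move=> a h h'; rewrite /D /pull (driftD causalH causalQ t0) (driftZ causalH causalQ t0).
    rewrite mulmxDr -scalemxAr.
    rewrite (regularised_diffD mxi mscore quasi mphi phiM).
    by rewrite (regularised_diffZ mxi mscore quasi mphi phiM).

  have D_le h : `|D h| <= C0 * (`|h| / Num.sqrt t) * M.
    have := regularised_diff_le mxi mscore (ltW kappa_gt0) quasi mphi phiM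
      (drift H Q t x) (pull h) kappa_gt0.
    move=> /le_trans; apply.
    have -> : Num.sqrt kappa = Num.sqrt q.+1%:R / Num.sqrt t.
      by rewrite /kappa /ramp_length invf_div sqrtrM// (sqrtrV (ltW t0)).
    rewrite [leRHS](_ : _ = (2 + n%:R) * M *
        (Num.sqrt q.+1%:R / Num.sqrt t * (2 * k0 * c * `|h|))); last by rewrite /C0; ring.
    rewrite ler_wpM2l ?mulr_ge0 ?addr_ge0//.
    by rewrite ler_wpM2l// divr_ge0 ?sqrtr_ge0.
  exists D => //.
  apply: (differentiable_quadratic (K := kappa * n%:R * M * (2 * k0 * c) ^+ 2)
    (K' := C0 / Num.sqrt t * M)) => //.
    move=> h; rewrite (le_trans (D_le h))// le_eqVlt; apply/orP; left; apply/eqP.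
    by ring.
  move=> h; rewrite !tr (driftD causalH causalQ t0) -(Bpull h).
  have := regularised_taylor mxi mscore (ltW kappa_gt0) quasi mphi phiM
    (drift H Q t x) (pull h).
  move=> /le_trans; apply.
  have sq : \sum_i pull h i ord0 ^+ 2 <= n%:R * (2 * k0 * c * `|h|) ^+ 2.
    rewrite mulr_natl -[X in _ *+ X]card_ord -sumr_const; apply: ler_sum => i _.
    rewrite -real_normK ?num_real// ler_pXn2r// ?nnegrE ?mulr_ge0//.
    by rewrite (le_trans (le_coord_norm _ _)).
  rewrite [leRHS](_ : _ = kappa * (n%:R * (2 * k0 * c * `|h|) ^+ 2) * M); last by ring.
  rewrite ler_wpM2r// /score_var mulrA mulrC.
  rewrite [X in _ * X](_ : _ = kappa); last by field.
  by rewrite mulrC ler_wpM2l// ltW.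
split=> [t tT x|t x h tT]; have [D [dD DE] D_le] := main t x tT => //.
by rewrite DE (le_trans (D_le h))// -/M ler_wpM2r// ler_wpM2r ?lerDl//.
Qed.
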